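(* For $x=(x_1,x_2)$ sufficiently close to $(0,0)$, the function $$F_{11}(x)=x_1^{1-b_1}x_2^{1-b_3}F\left(\begin{matrix}a_1-b_1-b_3+2,&a_2-b_1-b_3+2,&a_3-b_1-b_3+2\\2-b_1,&b_2-b_1+1,&1\\2-b_3,&b_4-b_3+1,&1\end{matrix};x\right)$$ is expressed as $F_{11}(x)=C_{11}\int_{\Delta_{11}}u(t,x)\,dt$, where $dt=dt_1\wedge dt_3\wedge dt_2\wedge dt_4$, $$u(t,x)=\Bigl(\prod_{j=1}^4t_j^{-b_j}\Bigr)(1-t_1-t_3)^{b_1+b_3-a_1-2}(1-t_2-t_4)^{b_2+b_4-a_2-2}\Bigl(1-\frac{x_1}{t_1t_2}-\frac{x_2}{t_3t_4}\Bigr)^{-a_3},$$ $$C_{11}=\frac{\Gamma(b_1+b_3-a_3-1)\Gamma(b_1+b_3-a_2-1)}{\Gamma(b_1-1)\Gamma(b_3-1)\Gamma(1-a_3)\Gamma(b_1-b_2)\Gamma(b_3-b_4)\Gamma(b_2+b_4-a_2-1)},$$ and $\Delta_{11}$ is the image of $\mathrm{reg}(\triangle_1\times\triangle_2)$, associated with the weight $$s_1^{b_1-2}s_3^{b_3-2}(1-s_1-s_3)^{-a_3}\cdot s_2^{b_1-b_2-1}s_4^{b_3-b_4-1}(1-s_2-s_4)^{b_2+b_4-a_2-2},$$ under the involution $\imath_{11}:(s_1,s_2,s_3,s_4)\mapsto t=\bigl(\frac{x_1}{s_1s_2},s_2,\frac{x_2}{s_3s_4},s_4\bigr)$.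
   Context: With $(\alpha,n)=\alpha(\alpha+1)\cdots(\alpha+n-1)$, $$F\left(\begin{matrix}a_1,a_2,a_3\\ b_1,b_2,1\\ b_3,b_4,1\end{matrix};x\right)=\sum_{n_1,n_2\ge0}\frac{\prod_{i=1}^3(a_i,n_1+n_2)}{(b_1,n_1)(b_2,n_1)(1,n_1)(b_3,n_2)(b_4,n_2)(1,n_2)}x_1^{n_1}x_2^{n_2}.$$ The parameters are such that the regularization is defined and $C_{11}$ is finite: $b_1,b_3,a_3,b_1-b_2,b_3-b_4,b_2+b_4-a_2\notin\mathbb Z$ and $b_1+b_3-a_i-1\notin\{0,-1,-2,\dots\}$ $(i=2,3)$. $\triangle_1=\{(s_1,s_3)\in\mathbb R^2\mid s_1,s_3,1-s_1-s_3>0\}$, $\triangle_2=\{(s_2,s_4)\in\mathbb R^2\mid s_2,s_4,1-s_2-s_4>0\}$. For an open triangle $P$ and a weight $w$ (product of powers, with non-integral exponents, of the linear forms defining the edges), the regularization $\mathrm{reg}(P)$ is the compact twisted cycle supported in a small neighborhood of $\overline P$, loaded with branches of $w$, homologous as a locally finite twisted chain to $P$ loaded with the standard branch of $w$ (all linear forms positive on $P$); explicitly $\sigma+\sum_i\frac{S_i\times\sigma_i}{c_i-1}+\sum_{i<j}\frac{S_i\times S_j}{(c_i-1)(c_j-1)}$, $c_i=e^{2\pi\sqrt{-1}p_i}$ for the exponent $p_i$ on the $i$-th edge, $\sigma$ the shrunken triangle, $\sigma_i$ its edges, $S_i$ small positive circles around the edge lines. $\mathrm{reg}(\triangle_1\times\triangle_2)=\mathrm{reg}(\triangle_1)\times\mathrm{reg}(\triangle_2)$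 with the $(s_1,s_3)$- and $(s_2,s_4)$-factors of the displayed weight, oriented by $ds=ds_1\wedge ds_3\wedge ds_2\wedge ds_4$. ''Close to $(0,0)$'' means that $|\frac{x_1}{s_1s_2}+\frac{x_2}{s_3s_4}|<1$ on this chain. The branch of $u$ on $\Delta_{11}$ is such that $\imath_{11}^*(u\,dt)$ equals $x_1^{1-b_1}x_2^{1-b_3}$ times the displayed weight times $\bigl(1-\frac{x_1}{s_1s_2}-\frac{x_2}{s_3s_4}\bigr)^{b_1+b_3-a_1-2}ds$, with the principal branch of the last factor and the same branch of $x_1^{1-b_1}x_2^{1-b_3}$ as in $F_{11}$. *)

(* Defs.v *)
From Stdlib Require Import Reals Factorial List Lra.
From Coquelicot Require Import Coquelicot.

Import ListNotations.

Open Scope R_scope.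
Open Scope C_scope.

(** * Complex analysis: componentwise versions of Coquelicot's real operators *)

Definition Cexp (z : C) : C := (exp (Re z) * cos (Im z), exp (Re z) * sin (Im z))%R.

(** Principal argument in (-PI, PI), by the half-angle formula
    [tan (arg z / 2) = Im z / (|z| + Re z)]; meaningful for z outside ]-oo, 0]. *)
Definition Carg (z : C) : R := (2 * atan (Im z / (Cmod z + Re z)))%R.

Definition Clog (z : C) : C := (ln (Cmod z), Carg z).

Definition CLim_seq (u : nat -> C) : C :=
  (real (Lim_seq (fun n => Re (u n))), real (Lim_seq (fun n => Im (u n)))).

Definition CSeries (u : nat -> C) : C :=
  (Series (fun n => Re (u n)), Series (fun n => Im (u n))).

Definition CDerive (f : R -> C) (t : R) : C :=
  (Derive (fun y => Re (f y)) t, Derive (fun y => Im (f y)) t).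

Definition CInt (f : R -> C) (a b : R) : C := @RInt C_R_CompleteNormedModule f a b.

Definition Cis_int (z : C) : Prop := exists k : Z, z = RtoC (IZR k).

Definition Cis_nonpos_int (z : C) : Prop := exists n : nat, z = - RtoC (INR n).

(** [poch z n = z (z + 1) ... (z + n - 1)] *)
Fixpoint poch (z : C) (n : nat) : C :=
  match n with
  | O => 1
  | S m => poch z m * (z + RtoC (INR m))
  end.

(** Gauss's limit [n! n^z / (z (z + 1) ... (z + n))]. *)
Definition CGamma (z : C) : C :=
  CLim_seq (fun n => RtoC (INR (fact n)) * Cexp (z * RtoC (ln (INR n))) / poch z (S n)).

(** * The hypergeometric series and the local solution *)

Definition Fser (a1 a2 a3 b1 b2 b3 b4 x1 x2 : C) : C :=
  CSeries (fun n1 => CSeries (fun n2 =>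
    (poch a1 (n1 + n2) * poch a2 (n1 + n2) * poch a3 (n1 + n2)) /
    (poch b1 n1 * poch b2 n1 * poch 1 n1 * poch b3 n2 * poch b4 n2 * poch 1 n2) *
    (Cpow x1 n1 * Cpow x2 n2))).

(** [lx1], [lx2] are the logarithms of [x1], [x2] that fix the branch of
    [x1^(1-b1) x2^(1-b3)]. *)
Definition F11 (a1 a2 a3 b1 b2 b3 b4 x1 x2 lx1 lx2 : C) : C :=
  Cexp ((1 - b1) * lx1) * Cexp ((1 - b3) * lx2) *
  Fser (a1 - b1 - b3 + 2) (a2 - b1 - b3 + 2) (a3 - b1 - b3 + 2)
       (2 - b1) (b2 - b1 + 1) (2 - b3) (b4 - b3 + 1) x1 x2.

Definition C11 (a2 a3 b1 b2 b3 b4 : C) : C :=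
  (CGamma (b1 + b3 - a3 - 1) * CGamma (b1 + b3 - a2 - 1)) /
  (CGamma (b1 - 1) * CGamma (b3 - 1) * CGamma (1 - a3) *
   CGamma (b1 - b2) * CGamma (b3 - b4) * CGamma (b2 + b4 - a2 - 1)).

(** * Regularization of an open triangle

    The triangle is [{(z1, z2) | z1, z2, z3 > 0}] with [z3 = 1 - z1 - z2]. Since
    [z1 + z2 + z3 = 1], the form [dz1 /\ dz2] equals [dz2 /\ dz3] and [dz3 /\ dz1],
    so that everything is cyclically symmetric in the three edges.

    A branch of a product of powers is recorded by the chosen logarithms of the
    three linear forms: the branch of [z1^p1 z2^p2 z3^p3] is
    [exp (p1 log z1 + p2 log z2 + p3 log z3)]. *)

Record cell2 := Cell2 {
  coef2 : C;
  len1 : R;                       (* parameters: [0, len1] x [0, len2] *)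
  len2 : R;
  pt1 : R -> R -> C;              (* z1 *)
  pt2 : R -> R -> C;              (* z2 *)
  lg1 : R -> R -> C;              (* logarithm of z1 *)
  lg2 : R -> R -> C;              (* logarithm of z2 *)
  lg3 : R -> R -> C               (* logarithm of 1 - z1 - z2 *)
}.

Definition in_box2 (K : cell2) (u v : R) : Prop :=
  (0 <= u <= len1 K)%R /\ (0 <= v <= len2 K)%R.

(** The positive circle of radius [e] about 0 and its logarithm, real at the start. *)
Definition circ (e th : R) : C := RtoC e * Cexp (Ci * RtoC th).
Definition lcirc (e th : R) : C := RtoC (ln e) + Ci * RtoC th.

(** When [z_i = circ e th], the points with [z_{i+1} = seg e th v] and
    [z_{i+2} = seg e th (1 - v)], [0 <= v <= 1], go from [z_{i+1} = e] to
    [z_{i+2} = e]; for [th = 0] this is the edge of the shrunken triangle. *)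
Definition seg (e th v : R) : C :=
  RtoC e + RtoC v * (1 - RtoC (2 * e) - circ e th).

Definition third (e th ph : R) : C := 1 - circ e th - circ e ph.

(** The shrunken triangle [{z1, z2, z3 >= e}]. *)
Definition sig1 (e u : R) : C := RtoC (e + (1 - 3 * e) * u).
Definition sig2 (e u v : R) : C := RtoC (e + (1 - 3 * e) * (1 - u) * v).

(** [sigma + sum_i S_i x sigma_i / (c_i - 1) + sum_(i<j) S_i x S_j / ((c_i - 1) (c_j - 1))]
    with radii [e]. The edge [sigma_i] runs in the direction of increasing [z_{i+1}] and
    the tori are [S_1 x S_2], [S_2 x S_3], [S_3 x S_1], all with respect to the
    orientation [dz1 /\ dz2]; these are the signs that make the twisted boundary vanish. *)
Definition reg (p1 p2 p3 : C) (e : R) : list cell2 :=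
  let c p := Cexp (2 * RtoC PI * Ci * p) in
  let d1 := / (c p1 - 1) in
  let d2 := / (c p2 - 1) in
  let d3 := / (c p3 - 1) in
  [ Cell2 1 1 1
      (fun u v => sig1 e u)
      (fun u v => sig2 e u v)
      (fun u v => Clog (sig1 e u))
      (fun u v => Clog (sig2 e u v))
      (fun u v => Clog (1 - sig1 e u - sig2 e u v));
    Cell2 d1 (2 * PI) 1
      (fun u v => circ e u)
      (fun u v => seg e u v)
      (fun u v => lcirc e u)
      (fun u v => Clog (seg e u v))
      (fun u v => Clog (seg e u (1 - v)));
    Cell2 d2 (2 * PI) 1
      (fun u v => seg e u (1 - v))
      (fun u v => circ e u)
      (fun u v => Clog (seg e u (1 - v)))
      (fun u v => lcirc e u)
      (fun u v => Clog (seg e u v));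
    Cell2 d3 (2 * PI) 1
      (fun u v => seg e u v)
      (fun u v => seg e u (1 - v))
      (fun u v => Clog (seg e u v))
      (fun u v => Clog (seg e u (1 - v)))
      (fun u v => lcirc e u);
    Cell2 (d1 * d2) (2 * PI) (2 * PI)
      (fun u v => circ e u)
      (fun u v => circ e v)
      (fun u v => lcirc e u)
      (fun u v => lcirc e v)
      (fun u v => Clog (third e u v));
    Cell2 (d2 * d3) (2 * PI) (2 * PI)
      (fun u v => third e u v)
      (fun u v => circ e u)
      (fun u v => Clog (third e u v))
      (fun u v => lcirc e u)
      (fun u v => lcirc e v);
    Cell2 (d3 * d1) (2 * PI) (2 * PI)
      (fun u v => circ e v)
      (fun u v => third e u v)
      (fun u v => lcirc e v)
      (fun u v => Clog (third e u v))
      (fun u v => lcirc e u) ].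

Definition supp2 (ch : list cell2) (s s' : C) : Prop :=
  exists K u v, In K ch /\ in_box2 K u v /\ s = pt1 K u v /\ s' = pt2 K u v.

(** Coordinates [(z1, z2)] are [(s1, s3)] on the first triangle, [(s2, s4)] on the second. *)
Definition reg1 (a3 b1 b3 : C) (e : R) : list cell2 := reg (b1 - 2) (b3 - 2) (- a3) e.
Definition reg2 (a2 b1 b2 b3 b4 : C) (e : R) : list cell2 :=
  reg (b1 - b2 - 1) (b3 - b4 - 1) (b2 + b4 - a2 - 2) e.

(** * Integration of 4-forms over loaded singular 4-chains in C^4 *)

Record C4 := Pt4 { c1 : C; c2 : C; c3 : C; c4 : C }.

Record cell4 := Cell4 {
  coef4 : C;
  box1 : R; box2 : R; box3 : R; box4 : R;
  map4 : R -> R -> R -> R -> C4;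
  load4 : R -> R -> R -> R -> C
}.

(** Cofactor expansion along the first row. *)
Fixpoint Cdet (n : nat) (M : nat -> nat -> C) : C :=
  match n with
  | O => 1
  | S m => sum_n (fun j => Cpow (-1) j * M O j *
             Cdet m (fun i k => M (S i) (if Nat.ltb k j then k else S k))) m
  end.

Definition partial (k : nat) (f : R -> R -> R -> R -> C) (u1 u2 u3 u4 : R) : C :=
  match k with
  | O => CDerive (fun y => f y u2 u3 u4) u1
  | 1%nat => CDerive (fun y => f u1 y u3 u4) u2
  | 2%nat => CDerive (fun y => f u1 u2 y u4) u3
  | _ => CDerive (fun y => f u1 u2 u3 y) u4
  end.

(** The coordinates in the order in which they occur in [dt1 /\ dt3 /\ dt2 /\ dt4]. *)
Definition dt_coord (i : nat) (t : C4) : C :=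
  match i with
  | O => c1 t
  | 1%nat => c3 t
  | 2%nat => c2 t
  | _ => c4 t
  end.

(** The coefficient of the pull-back of [dt1 /\ dt3 /\ dt2 /\ dt4]. *)
Definition jac_dt (g : R -> R -> R -> R -> C4) (u1 u2 u3 u4 : R) : C :=
  Cdet 4 (fun i k => partial k (fun v1 v2 v3 v4 => dt_coord i (g v1 v2 v3 v4)) u1 u2 u3 u4).

Definition int_cell4 (K : cell4) : C :=
  coef4 K *
  CInt (fun u1 => CInt (fun u2 => CInt (fun u3 => CInt (fun u4 =>
    load4 K u1 u2 u3 u4 * jac_dt (map4 K) u1 u2 u3 u4)
  0 (box4 K)) 0 (box3 K)) 0 (box2 K)) 0 (box1 K).

Definition int_chain4 (ch : list cell4) : C :=
  fold_right (fun K acc => int_cell4 K + acc) 0 ch.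

(** * The integrand and the twisted cycle *)

(** Logarithms of the factors of [u], as the data of a branch. *)
Record ulogs := ULogs {
  log_t1 : C; log_t2 : C; log_t3 : C; log_t4 : C;
  log_13 : C;                     (* of 1 - t1 - t3 *)
  log_24 : C;                     (* of 1 - t2 - t4 *)
  log_x : C                       (* of 1 - x1 / (t1 t2) - x2 / (t3 t4) *)
}.

Definition is_ulogs (x1 x2 : C) (t : C4) (L : ulogs) : Prop :=
  Cexp (log_t1 L) = c1 t /\ Cexp (log_t2 L) = c2 t /\
  Cexp (log_t3 L) = c3 t /\ Cexp (log_t4 L) = c4 t /\
  Cexp (log_13 L) = 1 - c1 t - c3 t /\
  Cexp (log_24 L) = 1 - c2 t - c4 t /\
  Cexp (log_x L) = 1 - x1 / (c1 t * c2 t) - x2 / (c3 t * c4 t).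

Definition u_branch (a1 a2 a3 b1 b2 b3 b4 : C) (L : ulogs) : C :=
  Cexp (- b1 * log_t1 L) * Cexp (- b2 * log_t2 L) *
  Cexp (- b3 * log_t3 L) * Cexp (- b4 * log_t4 L) *
  Cexp ((b1 + b3 - a1 - 2) * log_13 L) *
  Cexp ((b2 + b4 - a2 - 2) * log_24 L) *
  Cexp (- a3 * log_x L).

Definition iota11 (x1 x2 : C) (s : C4) : C4 :=
  Pt4 (x1 / (c1 s * c2 s)) (c2 s) (x2 / (c3 s * c4 s)) (c4 s).

(** The product cell with first factor in [(s1, s3)] and second factor in [(s2, s4)]. *)
Definition prod_pt (K L : cell2) (u1 u2 u3 u4 : R) : C4 :=
  Pt4 (pt1 K u1 u2) (pt1 L u3 u4) (pt2 K u1 u2) (pt2 L u3 u4).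

(** The branch of [u] at [iota11 s]: there [1 - t1 - t3 = 1 - x1/(s1 s2) - x2/(s3 s4)],
    [1 - t2 - t4 = 1 - s2 - s4] and [1 - x1/(t1 t2) - x2/(t3 t4) = 1 - s1 - s3]. See
    [Delta11_ulogs] and [Delta11_pullback] below. *)
Definition logs11 (x1 x2 lx1 lx2 : C) (K L : cell2) (u1 u2 u3 u4 : R) : ulogs :=
  let s := prod_pt K L u1 u2 u3 u4 in
  ULogs (lx1 - lg1 K u1 u2 - lg1 L u3 u4)
        (lg1 L u3 u4)
        (lx2 - lg2 K u1 u2 - lg2 L u3 u4)
        (lg2 L u3 u4)
        (Clog (1 - x1 / (c1 s * c2 s) - x2 / (c3 s * c4 s)))
        (lg3 L u3 u4)
        (lg3 K u1 u2).

(** The image of [reg1 x reg2] under [iota11], loaded with [u]. *)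
Definition Delta11 (a1 a2 a3 b1 b2 b3 b4 : C) (e1 e2 : R) (x1 x2 lx1 lx2 : C)
  : list cell4 :=
  map (fun KL : cell2 * cell2 => let (K, L) := KL in
         Cell4 (coef2 K * coef2 L) (len1 K) (len2 K) (len1 L) (len2 L)
           (fun u1 u2 u3 u4 => iota11 x1 x2 (prod_pt K L u1 u2 u3 u4))
           (fun u1 u2 u3 u4 =>
              u_branch a1 a2 a3 b1 b2 b3 b4 (logs11 x1 x2 lx1 lx2 K L u1 u2 u3 u4)))
      (list_prod (reg1 a3 b1 b3 e1) (reg2 a2 b1 b2 b3 b4 e2)).

(** [|x1 / (s1 s2) + x2 / (s3 s4)| < 1] on the chain [reg1 x reg2]. *)
Definition close_to_origin (a2 a3 b1 b2 b3 b4 : C) (e1 e2 : R) (x1 x2 : C) : Prop :=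
  forall s1 s3 s2 s4 : C,
    supp2 (reg1 a3 b1 b3 e1) s1 s3 -> supp2 (reg2 a2 b1 b2 b3 b4 e2) s2 s4 ->
    (Cmod (x1 / (s1 * s2) + x2 / (s3 * s4)) < 1)%R.

(** * The chosen branches are branches of the stated functions *)

Lemma C_ext (z w : C) : Re z = Re w -> Im z = Im w -> z = w.
Proof. destruct z, w; simpl; intros; subst; reflexivity. Qed.

Lemma Cexp_plus (z w : C) : Cexp (z + w) = Cexp z * Cexp w.
Proof.
  destruct z as [a b], w as [c d]; unfold Cexp, Cplus, Cmult, Re, Im; simpl.
  rewrite exp_plus, cos_plus, sin_plus; apply C_ext; simpl; ring.
Qed.

Lemma Cexp_0 : Cexp 0 = 1.
Proof.
  unfold Cexp, Re, Im; simpl; rewrite exp_0, cos_0, sin_0; apply C_ext; simpl; ring.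
Qed.

Lemma Cexp_opp_l (z : C) : Cexp (- z) * Cexp z = 1.
Proof. rewrite <- Cexp_plus, <- Cexp_0; f_equal; ring. Qed.

Lemma Cexp_neq_0 (z : C) : Cexp z <> 0.
Proof.
  intros H; generalize (Cexp_opp_l z); rewrite H, Cmult_0_r.
  intros H1; apply (f_equal Re) in H1; simpl in H1; lra.
Qed.

Lemma Cexp_opp (z : C) : Cexp (- z) = / Cexp z.
Proof.
  rewrite <- (Cmult_1_r (Cexp (- z))), <- (Cinv_r (Cexp z)) by apply Cexp_neq_0.
  rewrite Cmult_assoc, Cexp_opp_l; ring.
Qed.

Lemma Cexp_minus (z w : C) : Cexp (z - w) = Cexp z / Cexp w.
Proof. unfold Cminus; rewrite Cexp_plus, Cexp_opp; reflexivity. Qed.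

Lemma Cexp_Clog (z : C) : (0 < Cmod z + Re z)%R -> Cexp (Clog z) = z.
Proof.
  intros Hz.
  assert (Hm : (Cmod z * Cmod z = Re z * Re z + Im z * Im z)%R).
  { unfold Cmod; rewrite sqrt_sqrt; unfold Re, Im; simpl; nra. }
  assert (Hp : (0 < Cmod z)%R).
  { destruct (Cmod_ge_0 z) as [H | H]; [exact H | exfalso].
    rewrite <- H in Hz, Hm; nra. }
  set (r := Cmod z) in *.
  set (t := (Im z / (r + Re z))%R).
  assert (Hs : (0 < 1 + t ^ 2)%R) by (simpl; nra).
  assert (Hq : (sqrt (1 + t ^ 2) * sqrt (1 + t ^ 2) = 1 + t ^ 2)%R)
    by (apply sqrt_sqrt; lra).
  assert (Hq0 : sqrt (1 + t ^ 2) <> 0%R)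
    by (apply Rgt_not_eq, sqrt_lt_R0; exact Hs).
  assert (Hi : (/ sqrt (1 + t ^ 2) * / sqrt (1 + t ^ 2) = / (1 + t ^ 2))%R)
    by (rewrite <- Rinv_mult, Hq; reflexivity).
  assert (H1 : (1 + t ^ 2 = 2 * r / (r + Re z))%R).
  { unfold t; apply (Rmult_eq_reg_r ((r + Re z) * (r + Re z))); [|nra].
    field_simplify; [|lra|lra]. nra. }
  assert (Hy : (Im z = t * (r + Re z))%R) by (unfold t; field; lra).
  unfold Cexp, Clog, Carg; fold r; simpl; fold t.
  rewrite exp_ln by exact Hp.
  rewrite cos_2a, sin_2a, cos_atan, sin_atan, ?Rsqr_pow2.
  set (q := sqrt (1 + t ^ 2)) in *.
  apply C_ext; simpl.
  - transitivity (r * ((1 - t * t) * / (1 + t ^ 2)))%R.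
    { rewrite <- Hi; unfold Rdiv; ring. }
    replace (1 - t * t)%R with (2 - (1 + t ^ 2))%R by ring.
    rewrite H1; change (fst z) with (Re z); field; lra.
  - transitivity (r * (2 * t * / (1 + t ^ 2)))%R.
    { rewrite <- Hi; unfold Rdiv; ring. }
    rewrite H1; change (snd z) with (Im z); rewrite Hy; field; lra.
Qed.

Lemma Cexp_Clog_pos (z : C) : (0 < Re z)%R -> Cexp (Clog z) = z.
Proof. intros H; apply Cexp_Clog; generalize (Cmod_ge_0 z); lra. Qed.

Lemma Cexp_lcirc (e th : R) : (0 < e)%R -> Cexp (lcirc e th) = circ e th.
Proof.
  intros He; unfold lcirc, circ; rewrite Cexp_plus; f_equal.
  unfold Cexp, RtoC, Re, Im; simpl; rewrite exp_ln, cos_0, sin_0 by exact He.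
  apply C_ext; simpl; ring.
Qed.

Lemma Re_circ (e th : R) : Re (circ e th) = (e * cos th)%R.
Proof.
  unfold circ, Cexp, Ci, RtoC, Cmult, Re, Im; simpl.
  replace (0 * th - 1 * 0)%R with 0%R by ring.
  replace (0 * 0 + 1 * th)%R with th by ring.
  rewrite exp_0; ring.
Qed.

Lemma Re_seg_pos (e th v : R) :
  (0 < e < 1 / 3)%R -> (0 <= v <= 1)%R -> (0 < Re (seg e th v))%R.
Proof.
  intros He Hv; generalize (COS_bound th); intros Hc.
  replace (Re (seg e th v)) with (e + v * (1 - 2 * e - Re (circ e th)))%R.
  2: unfold seg, Re, RtoC; simpl; ring.
  rewrite Re_circ.
  assert (0 <= 1 - 2 * e - e * cos th)%R by nra. nra.
Qed.

Lemma Re_third_pos (e th ph : R) :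
  (0 < e < 1 / 3)%R -> (0 < Re (third e th ph))%R.
Proof.
  intros He; generalize (COS_bound th) (COS_bound ph); intros Hc Hd.
  replace (Re (third e th ph)) with (1 - Re (circ e th) - Re (circ e ph))%R.
  2: unfold third, Re, RtoC; simpl; ring.
  rewrite !Re_circ; nra.
Qed.

Lemma reg_logs (p1 p2 p3 : C) (e : R) (K : cell2) (u v : R) :
  (0 < e < 1 / 3)%R -> In K (reg p1 p2 p3 e) -> in_box2 K u v ->
  Cexp (lg1 K u v) = pt1 K u v /\ Cexp (lg2 K u v) = pt2 K u v /\
  Cexp (lg3 K u v) = 1 - pt1 K u v - pt2 K u v.
Proof.
  intros He HK HB.
  assert (Hseg : (0 <= v <= 1)%R -> (0 <= 1 - v <= 1)%R) by lra.
  assert (Hsum : 1 - circ e u - seg e u v = seg e u (1 - v)).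
  { unfold seg; rewrite RtoC_minus, RtoC_mult; ring. }
  simpl in HK.
  destruct HK as [<-|[<-|[<-|[<-|[<-|[<-|[<-|[]]]]]]]];
    destruct HB as [Hu Hv]; simpl in *;
    repeat split; rewrite ?Cexp_lcirc by lra;
    rewrite ?Cexp_Clog_pos;
    try (apply Re_third_pos; exact He);
    try (apply Re_seg_pos; lra);
    try reflexivity;
    try (unfold sig1, sig2, Re, RtoC; simpl; nra);
    try (unfold third; ring);
    try (rewrite <- Hsum; ring).
  - unfold sig2, Re, RtoC; simpl.
    assert (0 <= (1 - u) * v)%R by nra. nra.
  - unfold sig1, sig2, Re, RtoC; simpl.
    apply Rlt_le_trans with (e + (1 - 3 * e) * ((1 - u) * (1 - v)))%R; [|right; ring].
    assert (0 <= (1 - u) * (1 - v))%R by nra. nra.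
Qed.

(** [u_branch] at [logs11] is a branch of [u] on [Delta11]. *)
Lemma Delta11_ulogs (a2 a3 b1 b2 b3 b4 : C) (e1 e2 : R) (x1 x2 lx1 lx2 : C)
  (K L : cell2) (u1 u2 u3 u4 : R) :
  (0 < e1 < 1 / 3)%R -> (0 < e2 < 1 / 3)%R -> Cexp lx1 = x1 -> Cexp lx2 = x2 ->
  close_to_origin a2 a3 b1 b2 b3 b4 e1 e2 x1 x2 ->
  In K (reg1 a3 b1 b3 e1) -> In L (reg2 a2 b1 b2 b3 b4 e2) ->
  in_box2 K u1 u2 -> in_box2 L u3 u4 ->
  is_ulogs x1 x2 (iota11 x1 x2 (prod_pt K L u1 u2 u3 u4))
    (logs11 x1 x2 lx1 lx2 K L u1 u2 u3 u4).
Proof.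
  intros He1 He2 Hx1 Hx2 Hx HK HL BK BL.
  destruct (reg_logs _ _ _ _ _ _ _ He1 HK BK) as (k1 & k2 & k3).
  destruct (reg_logs _ _ _ _ _ _ _ He2 HL BL) as (l1 & l2 & l3).
  assert (Hlt : (Cmod (x1 / (pt1 K u1 u2 * pt1 L u3 u4) +
                       x2 / (pt2 K u1 u2 * pt2 L u3 u4)) < 1)%R).
  { apply Hx; [exists K, u1, u2 | exists L, u3, u4]; auto. }
  assert (n1 := Cexp_neq_0 (lg1 K u1 u2)); assert (n2 := Cexp_neq_0 (lg2 K u1 u2)).
  assert (n3 := Cexp_neq_0 (lg1 L u3 u4)); assert (n4 := Cexp_neq_0 (lg2 L u3 u4)).
  assert (nx1 := Cexp_neq_0 lx1); assert (nx2 := Cexp_neq_0 lx2).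
  rewrite k1 in n1; rewrite k2 in n2; rewrite l1 in n3; rewrite l2 in n4.
  rewrite Hx1 in nx1; rewrite Hx2 in nx2.
  unfold is_ulogs, logs11; simpl.
  rewrite !Cexp_minus, k1, k2, k3, l1, l2, l3, Hx1, Hx2.
  repeat split.
  - field; auto.
  - field; auto.
  - apply Cexp_Clog_pos.
    set (y := x1 / _ + x2 / _) in Hlt.
    replace (1 - _ - _) with (1 - y) by (unfold y; ring).
    generalize (Rmax_Cmod y) (Rmax_l (Rabs (fst y)) (Rabs (snd y))) (Rle_abs (fst y)).
    unfold Re; simpl; lra.
  - field; repeat split; auto.
Qed.

(** [iota11^* (u dt)] is [x1^(1-b1) x2^(1-b3)] times the weight of [reg1 x reg2] times
    [(1 - x1/(s1 s2) - x2/(s3 s4))^(b1+b3-a1-2) ds]; the Jacobian determinant of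
    [iota11] is [x1 x2 / (s1^2 s2 s3^2 s4)]. *)
Lemma Delta11_pullback (a1 a2 a3 b1 b2 b3 b4 : C) (e1 e2 : R) (x1 x2 lx1 lx2 : C)
  (K L : cell2) (u1 u2 u3 u4 : R) :
  (0 < e1 < 1 / 3)%R -> (0 < e2 < 1 / 3)%R -> Cexp lx1 = x1 -> Cexp lx2 = x2 ->
  In K (reg1 a3 b1 b3 e1) -> In L (reg2 a2 b1 b2 b3 b4 e2) ->
  in_box2 K u1 u2 -> in_box2 L u3 u4 ->
  let s := prod_pt K L u1 u2 u3 u4 in
  u_branch a1 a2 a3 b1 b2 b3 b4 (logs11 x1 x2 lx1 lx2 K L u1 u2 u3 u4) *
    (x1 * x2 / (c1 s * c1 s * c2 s * (c3 s * c3 s) * c4 s)) =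
  Cexp ((1 - b1) * lx1) * Cexp ((1 - b3) * lx2) *
  (Cexp ((b1 - 2) * lg1 K u1 u2) * Cexp ((b3 - 2) * lg2 K u1 u2) *
   Cexp (- a3 * lg3 K u1 u2)) *
  (Cexp ((b1 - b2 - 1) * lg1 L u3 u4) * Cexp ((b3 - b4 - 1) * lg2 L u3 u4) *
   Cexp ((b2 + b4 - a2 - 2) * lg3 L u3 u4)) *
  Cexp ((b1 + b3 - a1 - 2) * Clog (1 - x1 / (c1 s * c2 s) - x2 / (c3 s * c4 s))).
Proof.
  intros He1 He2 Hx1 Hx2 HK HL BK BL s.
  destruct (reg_logs _ _ _ _ _ _ _ He1 HK BK) as (k1 & k2 & _).
  destruct (reg_logs _ _ _ _ _ _ _ He2 HL BL) as (l1 & l2 & _).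
  unfold u_branch, logs11; fold s; cbn [log_t1 log_t2 log_t3 log_t4 log_13 log_24 log_x].
  set (lw := Clog _).
  replace (x1 * x2 / _) with
    (Cexp (lx1 + lx2 - (lg1 K u1 u2 + lg1 K u1 u2 + lg1 L u3 u4 +
             (lg2 K u1 u2 + lg2 K u1 u2) + lg2 L u3 u4))).
  2: { unfold s; simpl; rewrite Cexp_minus, !Cexp_plus, k1, k2, l1, l2, Hx1, Hx2.
       reflexivity. }
  rewrite <- !Cexp_plus; f_equal; ring.
Qed.

(* Main.v *)
Require Import Defs.
From Stdlib Require Import Reals Factorial List Lra Lia Classical ClassicalEpsilon.
From Coquelicot Require Import Coquelicot.

Open Scope R_scope.
Open Scope C_scope.

(** Pulled back by the involution, the integral is that of the weight of [reg1 x reg2]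
    times [(1 - y1 - y2)^(b1+b3-a1-2)] with [y1 = x1/(s1 s2)], [y2 = x2/(s3 s4)]. On the chain
    all [s_i] have modulus at least the radius of its torus, and on the product of two tori the
    phases of [y1] and [y2] are independent; hence closeness to the origin gives
    [sup |y1| + sup |y2| < 1], and the binomial series may be integrated term by term. Each
    term is a product of two regularized Dirichlet integrals
    [Dreg p1 p2 p3 = G(p1+1) G(p2+1) G(p3+1) / G(p1+p2+p3+3)].

    For this formula, Stokes' theorem on the seven cells (whose boundary terms cancel) is
    applied to the contraction of [z1^p1 z2^p2 z3^p3 dz1 /\ dz2] with a vector field. Constant
    fields give contiguity relations between integral shifts of the exponents, and [d/de] of the
    parametrization gives independence of the radius [e]. By contiguity one may assume
    [Re p_i >= 2]; then [e -> 0] leaves the integral over the open triangle, a product of two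
    Beta integrals, which are evaluated by Gauss's limit. *)

(** The exponents are only known to be non-integral, so the product of Gamma values is not read off
    a convergent integral: both sides obey the same first-order relations under integral shifts, and
    the formula descends from exponents with large real parts. The bound 2 is chosen because [t^p],
    extended by 0, is then differentiable on the whole line. The vector fields satisfy
    [k1 + k2 + k3 = 0] because the linear forms satisfy [z1 + z2 + z3 = 1]. The coefficients
    [1 / (c - 1)] depend on an exponent only modulo 1, so one fixed chain serves every term of the
    expansion. In the term [(n1, n2)] the exponents are lowered by [n1] and [n2]; the first triangle
    yields [(a3-b1-b3+2, n1+n2)] over [(2-b1, n1) (2-b3, n2)], the second [(a2-b1-b3+2, n1+n2)] over
    [(b2-b1+1, n1) (b4-b3+1, n2)], and the binomial coefficients supply the rest. Since [CGamma],
    [CSeries] and [CInt] are total operators, every evaluation rests on a convergence proof; Gauss's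
    limit serves for the Beta integral because [CGamma] is defined by it. *)

(** * Elementary facts about complex numbers *)

Lemma Re_mult (z w : C) : Re (z * w) = (Re z * Re w - Im z * Im w)%R.
Proof. reflexivity. Qed.

Lemma Im_mult (z w : C) : Im (z * w) = (Re z * Im w + Im z * Re w)%R.
Proof. reflexivity. Qed.

Lemma sq_pos_of_neq_0 (z : C) : z <> 0 -> (0 < Re z * Re z + Im z * Im z)%R.
Proof.
  intros Hz; destruct (Req_dec (Re z * Re z + Im z * Im z) 0) as [H|H]; [|nra].
  exfalso; apply Hz; apply C_ext; simpl; nra.
Qed.

Lemma Cmod_le_abs (z : C) : (Cmod z <= Rabs (Re z) + Rabs (Im z))%R.
Proof.
  assert (E : z = RtoC (Re z) + Ci * RtoC (Im z)) by (destruct z; apply C_ext; simpl; ring).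
  rewrite E at 1.
  eapply Rle_trans; [apply Cmod_triangle|].
  rewrite Cmod_mult, Cmod_Ci, !Cmod_R; lra.
Qed.

Lemma im_le_Cmod (z : C) : (Rabs (Im z) <= Cmod z)%R.
Proof. eapply Rle_trans; [|apply Rmax_Cmod]; apply Rmax_r. Qed.

Lemma Cmod_Cexp (z : C) : Cmod (Cexp z) = exp (Re z).
Proof.
  unfold Cmod, Cexp; simpl.
  replace (_ + _)%R with (exp (Re z) * exp (Re z))%R.
  - apply sqrt_square; left; apply exp_pos.
  - assert (H := sin2_cos2 (Im z)); unfold Rsqr in H.
    transitivity (exp (Re z) * exp (Re z) *
      (sin (Im z) * sin (Im z) + cos (Im z) * cos (Im z)))%R; [rewrite H|]; ring.
Qed.

Lemma neq_0_Re_pos (z : C) : (0 < Re z)%R -> z <> 0.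
Proof. intros H E; rewrite E in H; simpl in H; lra. Qed.

Lemma Re_scale (r : R) (z : C) : Re (RtoC r * z) = (r * Re z)%R.
Proof. destruct z; simpl; ring. Qed.

(** * Componentwise continuity *)

(** Taken by components, as are [CInt] and [CDerive]. The domain is an arbitrary uniform space
    because parameters, pairs and quadruples of variables all occur. *)
Definition cont {T : UniformSpace} (f : T -> C) (t : T) : Prop :=
  continuous (fun q => Re (f q)) t /\ continuous (fun q => Im (f q)) t.

Section Cont.

Context {T : UniformSpace}.
Implicit Types (f g : T -> C) (t : T).

Lemma cont_ext f g t : (forall q, f q = g q) -> cont f t -> cont g t.
Proof.
  intros E [H1 H2]; split.
  - eapply continuous_ext; [|exact H1]; intros q; simpl; rewrite E; reflexivity.
  - eapply continuous_ext; [|exact H2]; intros q; simpl; rewrite E; reflexivity.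
Qed.

Lemma cont_const (c : C) t : cont (fun _ => c) t.
Proof. split; apply continuous_const. Qed.

Lemma cont_RtoC (h : T -> R) t : continuous h t -> cont (fun q => RtoC (h q)) t.
Proof. intros H; split; simpl; [exact H | apply continuous_const]. Qed.

Lemma cont_plus f g t : cont f t -> cont g t -> cont (fun q => f q + g q) t.
Proof.
  intros [] []; split; simpl; apply (continuous_plus (V := R_NormedModule)); assumption.
Qed.

Lemma cont_opp f t : cont f t -> cont (fun q => - f q) t.
Proof. intros []; split; simpl; apply (continuous_opp (V := R_NormedModule)); assumption. Qed.

Lemma cont_minus f g t : cont f t -> cont g t -> cont (fun q => f q - g q) t.
Proof. intros Hf Hg; apply cont_plus; [|apply cont_opp]; assumption. Qed.

Lemma cont_mult f g t : cont f t -> cont g t -> cont (fun q => f q * g q) t.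
Proof.
  intros [H1 H2] [H3 H4]; split; simpl.
  - apply (continuous_minus (V := R_NormedModule));
      apply (continuous_mult (K := R_AbsRing)); assumption.
  - apply (continuous_plus (V := R_NormedModule));
      apply (continuous_mult (K := R_AbsRing)); assumption.
Qed.

Lemma continuous_Rcomp (h : T -> R) (k : R -> R) t :
  continuous h t -> ex_derive k (h t) -> continuous (fun q => k (h q)) t.
Proof.
  intros Hh Hk; apply continuous_comp; [exact Hh|].
  apply (ex_derive_continuous (V := R_NormedModule)), Hk.
Qed.

Lemma continuous_Cmod f t : cont f t -> continuous (fun q => Cmod (f q)) t.
Proof.
  intros [H1 H2]; unfold Cmod.
  apply (continuous_comp (fun q => (fst (f q) ^ 2 + snd (f q) ^ 2)%R) sqrt).
  - apply (continuous_plus (V := R_NormedModule)).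
    + apply (continuous_Rcomp _ (fun x => x ^ 2)%R); [exact H1 | auto_derive; auto].
    + apply (continuous_Rcomp _ (fun x => x ^ 2)%R); [exact H2 | auto_derive; auto].
  - apply continuity_pt_filterlim, continuity_pt_sqrt; simpl; nra.
Qed.

Lemma cont_inv f t : f t <> 0 -> cont f t -> cont (fun q => / f q) t.
Proof.
  intros Hz [H1 H2].
  assert (Hp := sq_pos_of_neq_0 _ Hz).
  assert (Hc : continuous (fun q => / (fst (f q) ^ 2 + snd (f q) ^ 2))%R t).
  { apply (continuous_Rcomp (fun q => (fst (f q) ^ 2 + snd (f q) ^ 2)%R) Rinv).
    - apply (continuous_plus (V := R_NormedModule)).
      + apply (continuous_Rcomp _ (fun x => x ^ 2)%R); [exact H1 | auto_derive; auto].
      + apply (continuous_Rcomp _ (fun x => x ^ 2)%R); [exact H2 | auto_derive; auto].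
    - auto_derive; unfold Re, Im in Hp; nra. }
  split; simpl; unfold Rdiv; apply (continuous_mult (K := R_AbsRing)); try exact Hc.
  - exact H1.
  - apply (continuous_opp (V := R_NormedModule)), H2.
Qed.

Lemma cont_div f g t : g t <> 0 -> cont f t -> cont g t -> cont (fun q => f q / g q) t.
Proof. intros H Hf Hg; apply cont_mult; [|apply cont_inv]; assumption. Qed.

Lemma cont_Cexp f t : cont f t -> cont (fun q => Cexp (f q)) t.
Proof.
  intros [H1 H2]; split; simpl; apply (continuous_mult (K := R_AbsRing)).
  - apply (continuous_Rcomp _ exp); [exact H1 | auto_derive; auto].
  - apply (continuous_Rcomp _ cos); [exact H2 | auto_derive; auto].
  - apply (continuous_Rcomp _ exp); [exact H1 | auto_derive; auto].
  - apply (continuous_Rcomp _ sin); [exact H2 | auto_derive; auto].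
Qed.

(** A positive real part keeps the denominator [Cmod z + Re z] of the half-angle formula in [Carg]
    positive. *)
Lemma cont_Clog f t : (0 < Re (f t))%R -> cont f t -> cont (fun q => Clog (f q)) t.
Proof.
  intros Hp Hf; assert (Hm := continuous_Cmod _ _ Hf); destruct Hf as [H1 H2].
  assert (Hm0 : (0 < Cmod (f t))%R) by (apply Cmod_gt_0, neq_0_Re_pos, Hp).
  split; simpl.
  - apply (continuous_Rcomp _ ln); [exact Hm | auto_derive; auto].
  - unfold Carg; apply (continuous_Rcomp (fun q => Im (f q) / (Cmod (f q) + Re (f q)))%R
      (fun x => 2 * atan x)%R); [|auto_derive; auto].
    apply (continuous_mult (K := R_AbsRing)); [exact H2|].
    apply (continuous_Rcomp (fun q => Cmod (f q) + Re (f q))%R Rinv).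
    + apply (continuous_plus (V := R_NormedModule)); assumption.
    + auto_derive; lra.
Qed.

Lemma cont_pow f n t : cont f t -> cont (fun q => Cpow (f q) n) t.
Proof.
  intros Hf; induction n as [|n IH]; [apply cont_const | apply cont_mult; assumption].
Qed.

End Cont.

Lemma cont_comp {T U : UniformSpace} (g : T -> U) (f : U -> C) (t : T) :
  continuous g t -> cont f (g t) -> cont (fun q => f (g q)) t.
Proof.
  intros Hg [H1 H2]; split.
  - apply (continuous_comp g (fun x => Re (f x))); assumption.
  - apply (continuous_comp g (fun x => Im (f x))); assumption.
Qed.

Lemma continuous_pair {T U V : UniformSpace} (f : T -> U) (g : T -> V) (t : T) :
  continuous f t -> continuous g t -> continuous (fun q => (f q, g q)) t.
Proof.
  intros Hf Hg; apply (continuous_comp_2 f g (fun x y => (x, y))); try assumption.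
  apply (continuous_ext (fun x => x)); [intros []; reflexivity | apply continuous_id].
Qed.

(** * Componentwise differentiability *)

Definition der (f : R -> C) (t : R) (l : C) : Prop :=
  is_derive (fun s => Re (f s)) t (Re l) /\ is_derive (fun s => Im (f s)) t (Im l).

Lemma der_eq (f : R -> C) (t : R) (l l' : C) : der f t l -> l = l' -> der f t l'.
Proof. intros H <-; exact H. Qed.

Lemma der_ext (f g : R -> C) (t : R) (l : C) :
  (forall s, f s = g s) -> der f t l -> der g t l.
Proof.
  intros E [H1 H2]; split.
  - eapply is_derive_ext; [|exact H1]; intros s; simpl; rewrite E; reflexivity.
  - eapply is_derive_ext; [|exact H2]; intros s; simpl; rewrite E; reflexivity.
Qed.

Lemma der_const (c : C) (t : R) : der (fun _ => c) t 0.
Proof. split; simpl; apply (is_derive_const (V := R_NormedModule)). Qed.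

Lemma der_RtoC (h : R -> R) (t l : R) : is_derive h t l -> der (fun s => RtoC (h s)) t (RtoC l).
Proof. intros H; split; simpl; [exact H | apply (is_derive_const (V := R_NormedModule))]. Qed.

Lemma der_id (t : R) : der RtoC t 1.
Proof. apply (der_RtoC (fun s => s)); apply (is_derive_id (K := R_AbsRing)). Qed.

Lemma der_plus (f g : R -> C) (t : R) (l m : C) :
  der f t l -> der g t m -> der (fun s => f s + g s) t (l + m).
Proof.
  intros [] []; split; simpl; apply (is_derive_plus (V := R_NormedModule)); assumption.
Qed.

Lemma der_opp (f : R -> C) (t : R) (l : C) : der f t l -> der (fun s => - f s) t (- l).
Proof. intros []; split; simpl; apply (is_derive_opp (V := R_NormedModule)); assumption. Qed.

Lemma der_minus (f g : R -> C) (t : R) (l m : C) :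
  der f t l -> der g t m -> der (fun s => f s - g s) t (l - m).
Proof. intros Hf Hg; apply der_plus; [|apply der_opp]; assumption. Qed.

Lemma is_derive_Rmult (f g : R -> R) (t l m : R) :
  is_derive f t l -> is_derive g t m ->
  is_derive (fun s => f s * g s)%R t (l * g t + f t * m)%R.
Proof.
  intros Hf Hg; apply (is_derive_mult f g t l m Hf Hg); intros; apply Rmult_comm.
Qed.

Lemma der_mult (f g : R -> C) (t : R) (l m : C) :
  der f t l -> der g t m -> der (fun s => f s * g s) t (l * g t + f t * m).
Proof.
  intros [H1 H2] [H3 H4]; split; simpl.
  - eapply is_derive_ext_loc; [apply filter_forall; intros; reflexivity|].
    replace (_ + _)%R with ((Re l * Re (g t) + Re (f t) * Re m) -
      (Im l * Im (g t) + Im (f t) * Im m))%R by (unfold Re, Im; ring).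
    apply (is_derive_minus (V := R_NormedModule)); apply is_derive_Rmult; assumption.
  - replace (_ + _)%R with ((Re l * Im (g t) + Re (f t) * Im m) +
      (Im l * Re (g t) + Im (f t) * Re m))%R by (unfold Re, Im; ring).
    apply (is_derive_plus (V := R_NormedModule)); apply is_derive_Rmult; assumption.
Qed.

Lemma is_derive_Rcomp (k h : R -> R) (t l m r : R) :
  is_derive k (h t) l -> is_derive h t m -> r = (m * l)%R ->
  is_derive (fun s => k (h s)) t r.
Proof. intros Hk Hh ->; apply (is_derive_comp k h t l m Hk Hh). Qed.

Lemma der_Cexp (f : R -> C) (t : R) (l : C) :
  der f t l -> der (fun s => Cexp (f s)) t (l * Cexp (f t)).
Proof.
  intros [H1 H2].
  assert (He : is_derive (fun s => exp (Re (f s))) t (Re l * exp (Re (f t)))%R).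
  { eapply (is_derive_Rcomp exp); [apply is_derive_Reals, derivable_pt_lim_exp | exact H1 |].
    reflexivity. }
  split; simpl.
  - eapply is_derive_ext; [intros; reflexivity|].
    replace (_ - _)%R with (Re l * exp (Re (f t)) * cos (Im (f t)) +
      exp (Re (f t)) * (Im l * (- sin (Im (f t)))))%R by (unfold Re, Im; ring).
    apply (is_derive_Rmult (fun s => exp (Re (f s))) (fun s => cos (Im (f s)))); [exact He|].
    eapply (is_derive_Rcomp cos); [apply is_derive_Reals, derivable_pt_lim_cos | exact H2 |].
    reflexivity.
  - replace (_ + _)%R with (Re l * exp (Re (f t)) * sin (Im (f t)) +
      exp (Re (f t)) * (Im l * (cos (Im (f t)))))%R by (unfold Re, Im; ring).
    apply (is_derive_Rmult (fun s => exp (Re (f s))) (fun s => sin (Im (f s)))); [exact He|].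
    eapply (is_derive_Rcomp sin); [apply is_derive_Reals, derivable_pt_lim_sin | exact H2 |].
    reflexivity.
Qed.

Lemma Cmod_sq (z : C) : (Cmod z * Cmod z = Re z * Re z + Im z * Im z)%R.
Proof. unfold Cmod; rewrite sqrt_sqrt; unfold Re, Im; simpl; nra. Qed.

Lemma der_Clog (f : R -> C) (t : R) (l : C) :
  (0 < Re (f t))%R -> der f t l -> der (fun s => Clog (f s)) t (l / f t).
Proof.
  intros Hp [H1 H2].
  assert (Hm0 : (0 < Cmod (f t))%R) by (apply Cmod_gt_0, neq_0_Re_pos, Hp).
  assert (Hsq := Cmod_sq (f t)).
  set (x := Re (f t)) in *; set (y := Im (f t)) in *; set (r := Cmod (f t)) in *.
  assert (Hxy : (0 < x * x + y * y)%R) by nra.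
  assert (Hr : is_derive (fun s => Cmod (f s)) t ((x * Re l + y * Im l) / r)%R).
  { unfold Cmod.
    eapply (is_derive_Rcomp sqrt (fun s => (fst (f s) ^ 2 + snd (f s) ^ 2)%R)).
    - apply is_derive_Reals, derivable_pt_lim_sqrt.
      change (0 < x ^ 2 + y ^ 2)%R; nra.
    - apply (is_derive_plus (V := R_NormedModule)).
      + apply (is_derive_pow (fun s => Re (f s)) 2 t (Re l) H1).
      + apply (is_derive_pow (fun s => Im (f s)) 2 t (Im l) H2).
    - fold (Cmod (f t)); fold r; unfold plus; simpl.
      fold x y; field; lra. }
  split; simpl; change (fst (f t)) with x; change (snd (f t)) with y;
    change (fst l) with (Re l); change (snd l) with (Im l).
  - eapply (is_derive_Rcomp ln).
    + apply is_derive_Reals, derivable_pt_lim_ln; exact Hm0.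
    + exact Hr.
    + fold r. transitivity ((x * Re l + y * Im l) / (r * r))%R; [rewrite Hsq|]; field; try lra.
  - unfold Carg.
    assert (Hq : is_derive (fun s => Im (f s) / (Cmod (f s) + Re (f s)))%R t
      (Im l * / (r + x) + y * (- ((x * Re l + y * Im l) / r + Re l) / (r + x) ^ 2))%R).
    { apply (is_derive_Rmult (fun s => Im (f s)) (fun s => / (Cmod (f s) + Re (f s)))%R).
      - exact H2.
      - apply (is_derive_inv (fun s => Cmod (f s) + Re (f s))%R).
        + apply (is_derive_plus (V := R_NormedModule)); assumption.
        + fold r x; lra. }
    eapply (is_derive_Rcomp (fun x => 2 * atan x)%R).
    + auto_derive; [auto | reflexivity].
    + exact Hq.
    + fold x y r.
      (* Half-angle identity, a consequence of [r^2 = x^2 + y^2]; it removes the nested fraction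
         from the derivative of [atan]. *)
      assert (E : (1 + (y / (r + x))² = 2 * r / (r + x))%R).
      { unfold Rsqr; apply (Rmult_eq_reg_r ((r + x) * (r + x))); [|nra].
        field_simplify; [|lra|lra]. nra. }
      unfold Rsqr in E; simpl; rewrite ?Rmult_1_r.
      rewrite ?E.
      replace (x * x + y * y)%R with (r * r)%R by exact Hsq.
      field_simplify_eq; [|repeat split; nra].
      replace (r ^ 2)%R with (x * x + y * y)%R by (rewrite <- Hsq; ring). ring.
Qed.

Lemma der_comp_R (f : R -> C) (h : R -> R) (t l : R) (m : C) :
  is_derive h t l -> der f (h t) m -> der (fun s => f (h s)) t (RtoC l * m).
Proof.
  intros Hh [H1 H2]; split; simpl.
  - eapply (is_derive_Rcomp (fun s => Re (f s)) h); [exact H1 | exact Hh | unfold Re; ring].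
  - eapply (is_derive_Rcomp (fun s => Im (f s)) h); [exact H2 | exact Hh | unfold Re, Im; ring].
Qed.

Lemma der_cont (f : R -> C) (t : R) (l : C) : der f t l -> cont f t.
Proof.
  intros [H1 H2]; split; apply (ex_derive_continuous (V := R_NormedModule)); eexists; eassumption.
Qed.

Lemma der_CDerive (f : R -> C) (t : R) (l : C) : der f t l -> CDerive f t = l.
Proof.
  intros [H1 H2]; unfold CDerive; apply C_ext; simpl; apply is_derive_unique; assumption.
Qed.

Lemma der_inv (f : R -> C) (t : R) (l : C) :
  f t <> 0 -> der f t l -> der (fun s => / f s) t (- l / (f t * f t)).
Proof.
  intros Hz [H1 H2].
  assert (Hp := sq_pos_of_neq_0 _ Hz).
  set (x := Re (f t)) in *; set (y := Im (f t)) in *.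
  assert (Hd : is_derive (fun s => (Re (f s) ^ 2 + Im (f s) ^ 2)%R) t
    (2 * x * Re l + 2 * y * Im l)%R).
  { apply (is_derive_plus (V := R_NormedModule)).
    - replace (2 * x * Re l)%R with (INR 2 * Re l * Re (f t) ^ 1)%R by (simpl; fold x; ring).
      apply (is_derive_pow (fun s => Re (f s)) 2 t (Re l) H1).
    - replace (2 * y * Im l)%R with (INR 2 * Im l * Im (f t) ^ 1)%R by (simpl; fold y; ring).
      apply (is_derive_pow (fun s => Im (f s)) 2 t (Im l) H2). }
  assert (Hi : is_derive (fun s => / (Re (f s) ^ 2 + Im (f s) ^ 2))%R t
    (- (2 * x * Re l + 2 * y * Im l) / (x ^ 2 + y ^ 2) ^ 2)%R).
  { apply (is_derive_inv (fun s => Re (f s) ^ 2 + Im (f s) ^ 2)%R); [exact Hd|].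
    fold x y; nra. }
  split.
  - eapply is_derive_ext; [intros s; reflexivity|].
    simpl; change (fst (f t)) with x; change (snd (f t)) with y;
    change (fst l) with (Re l); change (snd l) with (Im l).
    match goal with |- is_derive _ _ ?r =>
    replace r with (Re l * / (x ^ 2 + y ^ 2) +
      x * (- (2 * x * Re l + 2 * y * Im l) / (x ^ 2 + y ^ 2) ^ 2))%R end.
    + apply (is_derive_Rmult (fun s => Re (f s)) (fun s => / (Re (f s) ^ 2 + Im (f s) ^ 2))%R);
        assumption.
    + field; repeat split; nra.
  - eapply is_derive_ext; [intros s; reflexivity|].
    simpl; change (fst (f t)) with x; change (snd (f t)) with y;
    change (fst l) with (Re l); change (snd l) with (Im l).
    match goal with |- is_derive _ _ ?r =>
    replace r with (- Im l * / (x ^ 2 + y ^ 2) +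
      - y * (- (2 * x * Re l + 2 * y * Im l) / (x ^ 2 + y ^ 2) ^ 2))%R end.
    + apply (is_derive_Rmult (fun s => - Im (f s))%R (fun s => / (Re (f s) ^ 2 + Im (f s) ^ 2))%R);
        [|assumption].
      apply (is_derive_opp (V := R_NormedModule)); assumption.
    + field; repeat split; nra.
Qed.

(** * Integrals of continuous complex functions *)

Definition clamp (b x : R) : R := Rmax 0 (Rmin x b).

Lemma clamp_in (b x : R) : (0 <= b)%R -> (0 <= clamp b x <= b)%R.
Proof.
  intros Hb; unfold clamp; split; [apply Rmax_l|].
  apply Rmax_lub; [exact Hb | apply Rmin_r].
Qed.

Lemma clamp_id (b x : R) : (0 <= x <= b)%R -> clamp b x = x.
Proof. intros H; unfold clamp; rewrite Rmin_left, Rmax_right; lra. Qed.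

Lemma continuous_clamp {T : UniformSpace} (b : R) (h : T -> R) (t : T) :
  continuous h t -> continuous (fun q => clamp b (h q)) t.
Proof.
  intros Hh; apply continuous_comp; [exact Hh|].
  apply continuity_pt_filterlim; unfold clamp.
  (* Minimum and maximum are rewritten through absolute values: [min(x,b) = (x + b - |x - b|) / 2]
     and [max(0,y) = (0 + y + |0 - y|) / 2]. *)
  apply (continuity_pt_ext (fun x => (0 + (x + b - Rabs (x - b)) / 2
    + Rabs (0 - (x + b - Rabs (x - b)) / 2)) / 2)%R).
  - intros x.
    assert (E : ((x + b - Rabs (x - b)) / 2 = Rmin x b)%R).
    { unfold Rmin, Rabs; destruct (Rle_dec x b), (Rcase_abs (x - b)); lra. }
    rewrite E; unfold Rmax, Rabs; destruct (Rle_dec 0 (Rmin x b)), (Rcase_abs (0 - Rmin x b)); lra.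
  - assert (C1 : continuity (fun x => (x + b - Rabs (x - b)) / 2)%R).
    { intros y; apply continuity_pt_mult; [|apply continuity_pt_const; intros ? ?; reflexivity].
      apply continuity_pt_minus.
      - apply continuity_pt_plus; [apply derivable_continuous_pt, derivable_pt_id
          | apply continuity_pt_const; intros ? ?; reflexivity].
      - apply (continuity_pt_comp (fun x => (x - b)%R) Rabs); [|apply Rcontinuity_abs].
        apply continuity_pt_minus; [apply derivable_continuous_pt, derivable_pt_id
          | apply continuity_pt_const; intros ? ?; reflexivity]. }
    apply continuity_pt_mult; [|apply continuity_pt_const; intros ? ?; reflexivity].
    apply continuity_pt_plus.
    + apply continuity_pt_plus; [apply continuity_pt_const; intros ? ?; reflexivity | apply C1].
    + apply (continuity_pt_comp (fun x => (0 - (x + b - Rabs (x - b)) / 2)%R) Rabs);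
        [|apply Rcontinuity_abs].
      apply continuity_pt_minus; [apply continuity_pt_const; intros ? ?; reflexivity | apply C1].
Qed.

(** Clamping makes the continuity one-sided at the end points, where parameter integrals
    need not be defined beyond the interval. *)
Definition contI (b : R) (f : R -> C) : Prop := forall x, cont (fun q => f (clamp b q)) x.

Lemma contI_of_cont (b : R) (f : R -> C) :
  (0 <= b)%R -> (forall x, (0 <= x <= b)%R -> cont f x) -> contI b f.
Proof.
  intros Hb Hf x; apply (cont_comp (clamp b) f).
  - apply (continuous_clamp b (fun v => v)), continuous_id.
  - apply Hf, clamp_in, Hb.
Qed.

Definition is_CInt (f : R -> C) (b : R) (l : C) : Prop :=
  is_RInt (fun x => Re (f x)) 0 b (Re l) /\ is_RInt (fun x => Im (f x)) 0 b (Im l).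

Lemma is_CInt_is_RInt (f : R -> C) (b : R) (l : C) :
  is_CInt f b l -> @is_RInt C_R_NormedModule f 0 b l.
Proof.
  intros [H1 H2]; destruct l as [l1 l2].
  apply (is_RInt_fct_extend_pair (U := R_NormedModule) (V := R_NormedModule)); assumption.
Qed.

Lemma is_CInt_unique (f : R -> C) (b : R) (l : C) : is_CInt f b l -> CInt f 0 b = l.
Proof.
  intros H; apply is_CInt_is_RInt in H.
  exact (is_RInt_unique (V := C_R_CompleteNormedModule) f 0 b l H).
Qed.

Lemma RInt_clamp {V : NormedModule R_AbsRing} (b : R) (f : R -> V) (l : V) :
  (0 <= b)%R -> is_RInt (fun x => f (clamp b x)) 0 b l -> is_RInt f 0 b l.
Proof.
  intros Hb; apply is_RInt_ext; intros x Hx.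
  rewrite Rmin_left, Rmax_right in Hx by exact Hb; rewrite clamp_id by lra; reflexivity.
Qed.

Lemma cont_is_CInt (b : R) (f : R -> C) :
  (0 <= b)%R -> contI b f -> is_CInt f b (CInt f 0 b).
Proof.
  intros Hb Hf.
  assert (H1 : ex_RInt (fun x => Re (f (clamp b x))) 0 b).
  { apply (ex_RInt_continuous (V := R_CompleteNormedModule)); intros z _; exact (proj1 (Hf z)). }
  assert (H2 : ex_RInt (fun x => Im (f (clamp b x))) 0 b).
  { apply (ex_RInt_continuous (V := R_CompleteNormedModule)); intros z _; exact (proj2 (Hf z)). }
  destruct H1 as [l1 H1], H2 as [l2 H2].
  assert (H : is_CInt f b (l1, l2)).
  { split; simpl.
    - apply (RInt_clamp (V := R_NormedModule) b (fun x => Re (f x)) l1 Hb H1).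
    - apply (RInt_clamp (V := R_NormedModule) b (fun x => Im (f x)) l2 Hb H2). }
  rewrite (is_CInt_unique _ _ _ H); exact H.
Qed.

Lemma CInt_ext (b : R) (f g : R -> C) :
  (0 <= b)%R -> (forall x, (0 < x < b)%R -> f x = g x) -> CInt f 0 b = CInt g 0 b.
Proof.
  intros Hb E; unfold CInt; apply (RInt_ext (V := C_R_CompleteNormedModule)); intros x Hx.
  rewrite Rmin_left, Rmax_right in Hx by exact Hb; apply E, Hx.
Qed.

Lemma is_CInt_plus (b : R) (f g : R -> C) (l m : C) :
  is_CInt f b l -> is_CInt g b m -> is_CInt (fun x => f x + g x) b (l + m).
Proof.
  intros [] []; split; simpl; apply (is_RInt_plus (V := R_NormedModule)); assumption.
Qed.

Lemma is_CInt_mult_l (b : R) (c : C) (f : R -> C) (l : C) :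
  is_CInt f b l -> is_CInt (fun x => c * f x) b (c * l).
Proof.
  intros [H1 H2]; split; simpl.
  - apply (is_RInt_minus (V := R_NormedModule));
      apply (is_RInt_scal (V := R_NormedModule)); assumption.
  - apply (is_RInt_plus (V := R_NormedModule));
      apply (is_RInt_scal (V := R_NormedModule)); assumption.
Qed.

Lemma CInt_plus (b : R) (f g : R -> C) :
  (0 <= b)%R -> contI b f -> contI b g ->
  CInt (fun x => f x + g x) 0 b = CInt f 0 b + CInt g 0 b.
Proof.
  intros Hb Hf Hg; apply is_CInt_unique, is_CInt_plus; apply cont_is_CInt; assumption.
Qed.

Lemma CInt_mult_l (b : R) (c : C) (f : R -> C) :
  (0 <= b)%R -> contI b f -> CInt (fun x => c * f x) 0 b = c * CInt f 0 b.
Proof. intros Hb Hf; apply is_CInt_unique, is_CInt_mult_l, cont_is_CInt; assumption. Qed.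

Lemma CInt_mult_r (b : R) (c : C) (f : R -> C) :
  (0 <= b)%R -> contI b f -> CInt (fun x => f x * c) 0 b = CInt f 0 b * c.
Proof.
  intros Hb Hf; rewrite Cmult_comm, <- CInt_mult_l by assumption.
  apply CInt_ext; [exact Hb | intros; ring].
Qed.

Lemma contI_minus (b : R) (f g : R -> C) :
  contI b f -> contI b g -> contI b (fun x => f x - g x).
Proof. intros Hf Hg x; apply cont_minus; [apply Hf | apply Hg]. Qed.

Lemma contI_cmul (b : R) (c : C) (f : R -> C) : contI b f -> contI b (fun x => c * f x).
Proof. intros Hf x; apply cont_mult; [apply cont_const | apply Hf]. Qed.

Lemma CInt_minus (b : R) (f g : R -> C) :
  (0 <= b)%R -> contI b f -> contI b g ->
  CInt (fun x => f x - g x) 0 b = CInt f 0 b - CInt g 0 b.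
Proof.
  intros Hb Hf Hg.
  transitivity (CInt (fun x => f x + -(1) * g x) 0 b).
  { apply CInt_ext; [exact Hb | intros; ring]. }
  rewrite CInt_plus, CInt_mult_l; try assumption; [ring|].
  apply contI_cmul, Hg.
Qed.

Lemma CInt_zero (b : R) : (0 <= b)%R -> CInt (fun _ => 0) 0 b = 0.
Proof.
  intros Hb; apply is_CInt_unique; split; simpl.
  - replace 0%R with (scal (b - 0) 0)%R at 2 by (unfold scal; simpl; unfold mult; simpl; ring).
    apply (is_RInt_const (V := R_NormedModule)).
  - replace 0%R with (scal (b - 0) 0)%R at 2 by (unfold scal; simpl; unfold mult; simpl; ring).
    apply (is_RInt_const (V := R_NormedModule)).
Qed.

Lemma norm_C_R (z : C) : @norm R_AbsRing C_R_NormedModule z = Cmod z.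
Proof.
  change (sqrt (Rabs (fst z) ^ 2 + Rabs (snd z) ^ 2) = Cmod z).
  rewrite !pow2_abs; reflexivity.
Qed.

Lemma Cmod_CInt_le (b M : R) (f : R -> C) :
  (0 <= b)%R -> contI b f -> (forall x, (0 <= x <= b)%R -> (Cmod (f x) <= M)%R) ->
  (Cmod (CInt f 0 b) <= b * M)%R.
Proof.
  intros Hb Hf HM; rewrite <- norm_C_R; replace (b * M)%R with ((b - 0) * M)%R by ring.
  apply (norm_RInt_le_const (V := C_R_NormedModule) f 0 b); [exact Hb | |].
  - intros x Hx; eapply Rle_trans; [|apply (HM x Hx)]; right; apply norm_C_R.
  - apply is_CInt_is_RInt, cont_is_CInt; assumption.
Qed.

Lemma CInt_rev (f : R -> C) :
  contI 1 f -> CInt (fun v => f (1 - v)%R) 0 1 = CInt f 0 1.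
Proof.
  intros Hf; destruct (cont_is_CInt 1 f (ltac:(lra)) Hf) as [H1 H2].
  assert (Hrev : forall (g : R -> R) (l : R), is_RInt g 0 1 l -> is_RInt (fun v => g (1 - v)%R) 0 1 l).
  { intros g l Hg.
    assert (Hs : is_RInt g (-1 * 0 + 1) (-1 * 1 + 1) (- l)%R).
    { replace (-1 * 0 + 1)%R with 1%R by ring; replace (-1 * 1 + 1)%R with 0%R by ring.
      apply (is_RInt_swap (V := R_NormedModule)), Hg. }
    apply (is_RInt_comp_lin (V := R_NormedModule)) in Hs.
    apply (is_RInt_opp (V := R_NormedModule)) in Hs.
    replace l with (opp (- l)%R : R) by (unfold opp; simpl; ring).
    eapply is_RInt_ext; [|exact Hs].
    intros x _; unfold opp, scal; simpl; unfold mult; simpl.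
    replace (-1 * x + 1)%R with (1 - x)%R by ring; ring. }
  apply is_CInt_unique; split.
  - apply (Hrev (fun v => Re (f v))), H1.
  - apply (Hrev (fun v => Im (f v))), H2.
Qed.

Lemma CInt_der (b : R) (F f : R -> C) :
  (0 <= b)%R -> (forall x, (0 <= x <= b)%R -> der F x (f x)) -> contI b f ->
  CInt f 0 b = F b - F 0%R.
Proof.
  intros Hb HF Hf; apply is_CInt_unique; split.
  - apply (RInt_clamp (V := R_NormedModule) b (fun x => Re (f x))); [exact Hb|].
    apply (is_RInt_derive (V := R_CompleteNormedModule) (fun x => Re (F x))); intros x Hx.
    + rewrite Rmin_left, Rmax_right in Hx by exact Hb; rewrite clamp_id by exact Hx; apply HF, Hx.
    + exact (proj1 (Hf x)).
  - apply (RInt_clamp (V := R_NormedModule) b (fun x => Im (f x))); [exact Hb|].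
    apply (is_RInt_derive (V := R_CompleteNormedModule) (fun x => Im (F x))); intros x Hx.
    + rewrite Rmin_left, Rmax_right in Hx by exact Hb; rewrite clamp_id by exact Hx; apply HF, Hx.
    + exact (proj2 (Hf x)).
Qed.

(** * Dependence on parameters *)

Lemma cont_ball {T : UniformSpace} (f : T -> C) (t : T) (eps : posreal) :
  cont f t -> locally t (fun s => (Cmod (f s - f t) < eps)%R).
Proof.
  intros [H1 H2].
  assert (Hh : (0 < eps / 2)%R) by (destruct eps; simpl; lra).
  assert (L1 : locally t (fun s => ball (Re (f t)) (eps / 2) (Re (f s))))
    by exact (H1 _ (locally_ball (Re (f t)) (mkposreal _ Hh))).
  assert (L2 : locally t (fun s => ball (Im (f t)) (eps / 2) (Im (f s))))
    by exact (H2 _ (locally_ball (Im (f t)) (mkposreal _ Hh))).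
  generalize (filter_and _ _ L1 L2); apply filter_imp; intros s [B1 B2].
  eapply Rle_lt_trans; [apply Cmod_le_abs|].
  change (Rabs (Re (f s) - Re (f t)) < eps / 2)%R in B1.
  change (Rabs (Im (f s) - Im (f t)) < eps / 2)%R in B2.
  change (Rabs (Re (f s) - Re (f t)) + Rabs (Im (f s) - Im (f t)) < eps)%R; lra.
Qed.

Lemma ball_cont {T : UniformSpace} (f : T -> C) (t : T) :
  (forall eps : posreal, locally t (fun s => (Cmod (f s - f t) < eps)%R)) -> cont f t.
Proof.
  intros H; split; apply filterlim_locally; intros eps; generalize (H eps);
    apply filter_imp; intros s Hs.
  - eapply Rle_lt_trans; [|exact Hs]; apply (re_le_Cmod (f s - f t)).
  - eapply Rle_lt_trans; [|exact Hs]; apply (im_le_Cmod (f s - f t)).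
Qed.

(** Tube lemma: compactness of [[0, b]] turns the radii of joint continuity at the points [(t, v)]
    into one radius valid for all [v]. *)
Lemma cont_tube {T : UniformSpace} (b : R) (f : T -> R -> C) (t : T) (eps : posreal) :
  (forall v, (0 <= v <= b)%R -> cont (fun q : T * R => f (fst q) (snd q)) (t, v)) ->
  locally t (fun s => forall v, (0 <= v <= b)%R -> (Cmod (f s v - f t v) < eps)%R).
Proof.
  intros Hf.
  assert (Hh : (0 < eps / 2)%R) by (destruct eps; simpl; lra).
  assert (Hd : forall v, exists d : posreal, (0 <= v <= b)%R ->
    forall s w, ball t d s -> (Rabs (w - v) < d)%R -> (Cmod (f s w - f t v) < eps / 2)%R).
  { intros v; destruct (classic (0 <= v <= b)%R) as [Hv|Hv].
    - destruct (cont_ball _ _ (mkposreal _ Hh) (Hf v Hv)) as [d Hd].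
      exists d; intros _ s w Hs Hw; apply (Hd (s, w)); split; [exact Hs | exact Hw].
    (* A default radius outside [[0, b]], where the required property is vacuous. *)
    - exists (mkposreal 1 Rlt_0_1); intros H; contradiction. }
  pose (delta := fun v => proj1_sig (constructive_indefinite_description _ (Hd v))).
  assert (Hdelta : forall v, (0 <= v <= b)%R -> forall s w, ball t (delta v) s ->
    (Rabs (w - v) < delta v)%R -> (Cmod (f s w - f t v) < eps / 2)%R).
  { intros v; exact (proj2_sig (constructive_indefinite_description _ (Hd v))). }
  destruct (compactness_value_1d 0 b delta) as [d Hcd].
  exists d; intros s Hs v Hv.
  (* The compactness lemma yields the nearby centre [w] only under a double negation. Both [f s v]
     and [f t v] are then compared with [f t w]. *)
  apply NNPP; intros Hn; apply (Hcd v Hv); intros (w & Hw & Hvw & Hdw); apply Hn.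
  replace (f s v - f t v) with ((f s v - f t w) + - (f t v - f t w)) by ring.
  eapply Rle_lt_trans; [apply Cmod_triangle|]; rewrite Cmod_opp.
  assert (A1 : (Cmod (f s v - f t w) < eps / 2)%R).
  { apply Hdelta; [exact Hw | | exact Hvw]. apply ball_le with d; assumption. }
  assert (A2 : (Cmod (f t v - f t w) < eps / 2)%R).
  { apply Hdelta; [exact Hw | apply ball_center | exact Hvw]. }
  lra.
Qed.

Lemma cont_CInt {T : UniformSpace} (b : R) (f : T -> R -> C) (t : T) :
  (0 <= b)%R ->
  locally t (fun s => contI b (f s)) ->
  (forall v, (0 <= v <= b)%R -> cont (fun q : T * R => f (fst q) (clamp b (snd q))) (t, v)) ->
  cont (fun s => CInt (f s) 0 b) t.
Proof.
  intros Hb Hl Hf; apply ball_cont; intros eps.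
  (* The denominator is [b + 1] since [b] may be 0. *)
  assert (Hp : (0 < eps / (b + 1))%R).
  { apply Rdiv_lt_0_compat; [apply cond_pos | lra]. }
  generalize (filter_and _ _ Hl
    (cont_tube b (fun s v => f s (clamp b v)) t (mkposreal _ Hp) Hf)).
  apply filter_imp; intros s [Hs Hu]; simpl in Hu.
  assert (Ht : contI b (f t)) by (apply locally_singleton in Hl; exact Hl).
  rewrite <- CInt_minus by assumption.
  apply Rle_lt_trans with (b * (eps / (b + 1)))%R.
  - apply Cmod_CInt_le; [exact Hb | | ].
    + intros x; apply cont_minus; [apply Hs | apply Ht].
    + intros x Hx; left; specialize (Hu x Hx); rewrite clamp_id in Hu by exact Hx; exact Hu.
  - apply Rmult_lt_reg_r with (b + 1)%R; [lra|].
    unfold Rdiv; rewrite Rmult_assoc, Rmult_assoc, Rinv_l by lra.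
    generalize (cond_pos eps); intros; nra.
Qed.

Lemma contI_of_joint {T : UniformSpace} (b : R) (f : T -> R -> C) (t : T) :
  (forall v, cont (fun q : T * R => f (fst q) (clamp b (snd q))) (t, v)) ->
  contI b (f t).
Proof.
  intros H v.
  apply (cont_comp (fun w : R => (t, w)) (fun q : T * R => f (fst q) (clamp b (snd q)))).
  - apply continuous_pair; [apply continuous_const | apply continuous_id].
  - apply H.
Qed.

Lemma cont_CInt_global {T : UniformSpace} (b : R) (f : T -> R -> C) (t : T) :
  (0 <= b)%R ->
  (forall s v, cont (fun q : T * R => f (fst q) (clamp b (snd q))) (s, v)) ->
  cont (fun s => CInt (f s) 0 b) t.
Proof.
  intros Hb Hf; apply cont_CInt; [exact Hb | | intros v _; apply Hf].
  apply filter_forall; intros s; apply contI_of_joint, Hf.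
Qed.

(** Differentiation under the integral requires a derivative jointly continuous around the end
    points; composing with [clamp b] extends the integrand past [[0, b]] without changing the
    integral. *)
Lemma is_derive_RInt_param' (b x : R) (f g : R -> R -> R) :
  (0 <= b)%R ->
  locally x (fun t => forall v, (0 <= v <= b)%R -> is_derive (fun s => f s v) t (g t v)) ->
  locally x (fun t => ex_RInt (f t) 0 b) ->
  (forall v, continuous (fun q : R * R => g (fst q) (clamp b (snd q))) (x, v)) ->
  is_derive (fun t => RInt (f t) 0 b) x (RInt (g x) 0 b).
Proof.
  intros Hb Hd Hf Hg.
  pose (f' := fun t v => f t (clamp b v)).
  assert (Hd' : locally x (fun t => forall v, is_derive (fun s => f' s v) t (g t (clamp b v)))).
  { revert Hd; apply filter_imp; intros t Ht v; apply Ht, clamp_in, Hb. }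
  assert (E : forall h : R -> R, RInt h 0 b = RInt (fun v => h (clamp b v)) 0 b).
  { intros h; apply RInt_ext; intros v Hv; rewrite Rmin_left, Rmax_right in Hv by exact Hb.
    rewrite clamp_id by lra; reflexivity. }
  apply is_derive_ext with (fun t => RInt (f' t) 0 b).
  { intros t; symmetry; apply (E (f t)). }
  replace (RInt (g x) 0 b) with (RInt (fun v => Derive (fun s => f' s v) x) 0 b).
  2: { rewrite (E (g x)); apply RInt_ext; intros v _; apply is_derive_unique.
       apply locally_singleton in Hd'; apply Hd'. }
  apply is_derive_RInt_param.
  - revert Hd'; apply filter_imp; intros t Ht v _; eexists; apply Ht.
  - intros v Hv; rewrite Rmin_left, Rmax_right in Hv by exact Hb.
    apply continuity_2d_pt_ext_loc with (fun t w => g t (clamp b w)).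
    + destruct Hd' as [d Hd']; exists d; intros t w Ht _.
      symmetry; apply is_derive_unique, Hd'; exact Ht.
    + apply continuity_2d_pt_filterlim.
      apply Hg.
  - revert Hf; apply filter_imp; intros t [l Ht]; exists l.
    eapply is_RInt_ext; [|exact Ht]; intros v Hv.
    rewrite Rmin_left, Rmax_right in Hv by exact Hb; unfold f'; rewrite clamp_id by lra.
    reflexivity.
Qed.

Lemma Re_CInt (b : R) (f : R -> C) :
  (0 <= b)%R -> contI b f -> Re (CInt f 0 b) = RInt (fun v => Re (f v)) 0 b.
Proof. intros Hb Hf; symmetry; apply is_RInt_unique, (cont_is_CInt b f Hb Hf). Qed.

Lemma Im_CInt (b : R) (f : R -> C) :
  (0 <= b)%R -> contI b f -> Im (CInt f 0 b) = RInt (fun v => Im (f v)) 0 b.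
Proof. intros Hb Hf; symmetry; apply is_RInt_unique, (cont_is_CInt b f Hb Hf). Qed.

Lemma der_CInt (b x : R) (f g : R -> R -> C) :
  (0 <= b)%R ->
  locally x (fun t => forall v, (0 <= v <= b)%R -> der (fun s => f s v) t (g t v)) ->
  locally x (fun t => contI b (f t)) ->
  (forall v, cont (fun q : R * R => g (fst q) (clamp b (snd q))) (x, v)) ->
  der (fun t => CInt (f t) 0 b) x (CInt (g x) 0 b).
Proof.
  intros Hb Hd Hf Hg; assert (Hgx := contI_of_joint b g x Hg); split.
  - rewrite Re_CInt by assumption.
    eapply is_derive_ext_loc with (fun t => RInt (fun v => Re (f t v)) 0 b).
    { revert Hf; apply filter_imp; intros t Ht; symmetry; apply Re_CInt; assumption. }
    apply (is_derive_RInt_param' b x (fun t v => Re (f t v)) (fun t v => Re (g t v))); [exact Hb | | | intros v; apply (Hg v)].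
    + revert Hd; apply filter_imp; intros t Ht v Hv; apply (Ht v Hv).
    + revert Hf; apply filter_imp; intros t Ht; eexists; apply (cont_is_CInt b (f t) Hb Ht).
  - rewrite Im_CInt by assumption.
    eapply is_derive_ext_loc with (fun t => RInt (fun v => Im (f t v)) 0 b).
    { revert Hf; apply filter_imp; intros t Ht; symmetry; apply Im_CInt; assumption. }
    apply (is_derive_RInt_param' b x (fun t v => Im (f t v)) (fun t v => Im (g t v))); [exact Hb | | | intros v; apply (Hg v)].
    + revert Hd; apply filter_imp; intros t Ht v Hv; apply (Ht v Hv).
    + revert Hf; apply filter_imp; intros t Ht; eexists; apply (cont_is_CInt b (f t) Hb Ht).
Qed.

(** * Iterated integrals over rectangles *)

Definition CInt2 (a b : R) (f : R -> R -> C) : C :=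
  CInt (fun u => CInt (fun v => f u v) 0 b) 0 a.

Definition cont2 (a b : R) (f : R -> R -> C) : Prop :=
  forall q : R * R, cont (fun q : R * R => f (clamp a (fst q)) (clamp b (snd q))) q.

Section CInt2.

Variables a b : R.
Hypotheses (Ha : (0 <= a)%R) (Hb : (0 <= b)%R).

Lemma cont2_of_cont (f : R -> R -> C) :
  (forall u v, (0 <= u <= a)%R -> (0 <= v <= b)%R ->
    cont (fun q : R * R => f (fst q) (snd q)) (u, v)) ->
  cont2 a b f.
Proof.
  intros Hf q.
  apply (cont_comp (fun q : R * R => (clamp a (fst q), clamp b (snd q)))
    (fun q : R * R => f (fst q) (snd q))).
  - apply continuous_pair; apply continuous_clamp; [apply continuous_fst | apply continuous_snd].
  - apply Hf; apply clamp_in; assumption.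
Qed.

Lemma cont2_row (f : R -> R -> C) (u : R) : cont2 a b f -> (0 <= u <= a)%R -> contI b (f u).
Proof.
  intros Hf Hu v; rewrite <- (clamp_id a u Hu).
  apply (cont_comp (fun w : R => (u, w))
    (fun q : R * R => f (clamp a (fst q)) (clamp b (snd q)))); [|apply Hf].
  apply continuous_pair; [apply continuous_const | apply continuous_id].
Qed.

Lemma cont2_inner (f : R -> R -> C) : cont2 a b f -> contI a (fun u => CInt (f u) 0 b).
Proof.
  intros Hf x; apply (cont_CInt_global b (fun u => f (clamp a u)) x Hb).
  intros s v; apply Hf.
Qed.

Lemma CInt2_ext (f g : R -> R -> C) :
  (forall u v, (0 <= u <= a)%R -> (0 <= v <= b)%R -> f u v = g u v) ->
  CInt2 a b f = CInt2 a b g.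
Proof.
  intros E; apply CInt_ext; [exact Ha|]; intros u Hu; apply CInt_ext; [exact Hb|].
  intros v Hv; apply E; lra.
Qed.

Lemma CInt2_plus (f g : R -> R -> C) : cont2 a b f -> cont2 a b g ->
  CInt2 a b (fun u v => f u v + g u v) = CInt2 a b f + CInt2 a b g.
Proof.
  intros Hf Hg; unfold CInt2; rewrite <- CInt_plus by (try assumption; apply cont2_inner; assumption).
  apply CInt_ext; [exact Ha|]; intros u Hu; apply CInt_plus; [exact Hb| |];
    apply cont2_row; try assumption; lra.
Qed.

Lemma cont2_mult (f g : R -> R -> C) : cont2 a b f -> cont2 a b g ->
  cont2 a b (fun u v => f u v * g u v).
Proof. intros Hf Hg q; apply cont_mult; [apply Hf | apply Hg]. Qed.

Lemma cont2_plus (f g : R -> R -> C) : cont2 a b f -> cont2 a b g ->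
  cont2 a b (fun u v => f u v + g u v).
Proof. intros Hf Hg q; apply cont_plus; [apply Hf | apply Hg]. Qed.

Lemma cont2_const (c : C) : cont2 a b (fun _ _ => c).
Proof. intros q; apply cont_const. Qed.

Lemma CInt2_mult_l (c : C) (f : R -> R -> C) : cont2 a b f ->
  CInt2 a b (fun u v => c * f u v) = c * CInt2 a b f.
Proof.
  intros Hf; unfold CInt2; rewrite <- CInt_mult_l by (try assumption; apply cont2_inner; assumption).
  apply CInt_ext; [exact Ha|]; intros u Hu; apply CInt_mult_l; [exact Hb|].
  apply cont2_row; try assumption; lra.
Qed.

Lemma CInt2_mult_r (c : C) (f : R -> R -> C) : cont2 a b f ->
  CInt2 a b (fun u v => f u v * c) = CInt2 a b f * c.
Proof.
  intros Hf; rewrite Cmult_comm, <- CInt2_mult_l by assumption.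
  apply CInt2_ext; intros; ring.
Qed.

Lemma CInt2_minus (f g : R -> R -> C) : cont2 a b f -> cont2 a b g ->
  CInt2 a b (fun u v => f u v - g u v) = CInt2 a b f - CInt2 a b g.
Proof.
  intros Hf Hg.
  transitivity (CInt2 a b (fun u v => f u v + -(1) * g u v)).
  { apply CInt2_ext; intros; ring. }
  rewrite CInt2_plus, CInt2_mult_l; try assumption; [ring|].
  apply cont2_mult; [apply cont2_const | assumption].
Qed.

Lemma CInt2_separate (f g : R -> C) : contI a f -> contI b g ->
  CInt2 a b (fun u v => f u * g v) = CInt f 0 a * CInt g 0 b.
Proof.
  intros Hf Hg; unfold CInt2.
  rewrite <- CInt_mult_r by assumption; apply CInt_ext; [exact Ha|].
  intros u Hu; apply CInt_mult_l; assumption.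
Qed.

Lemma Cmod_CInt2_le (M : R) (f : R -> R -> C) : cont2 a b f ->
  (forall u v, (0 <= u <= a)%R -> (0 <= v <= b)%R -> (Cmod (f u v) <= M)%R) ->
  (Cmod (CInt2 a b f) <= a * (b * M))%R.
Proof.
  intros Hf HM; apply Cmod_CInt_le; [exact Ha | apply cont2_inner; exact Hf|].
  intros u Hu; apply Cmod_CInt_le; [exact Hb | apply cont2_row; assumption|].
  intros v Hv; apply HM; assumption.
Qed.

Lemma cont_CInt2_global {T : UniformSpace} (f : T -> R -> R -> C) (t : T) :
  (forall p : T * (R * R),
    cont (fun q : T * (R * R) => f (fst q) (clamp a (fst (snd q))) (clamp b (snd (snd q)))) p) ->
  cont (fun t => CInt2 a b (f t)) t.
Proof.
  intros Hf; unfold CInt2.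
  apply (cont_CInt_global a (fun t u => CInt (fun v => f t u v) 0 b) t Ha); intros s u.
  apply (cont_CInt_global (T := prod_UniformSpace T R_UniformSpace) b
    (fun q v => f (fst q) (clamp a (snd q)) v) (s, u) Hb); intros r v.
  apply (cont_comp (fun q : (T * R) * R => (fst (fst q), (snd (fst q), snd q)))
    (fun q : T * (R * R) => f (fst q) (clamp a (fst (snd q))) (clamp b (snd (snd q))))).
  - apply continuous_pair; [|apply continuous_pair; [|apply continuous_snd]].
    + apply (continuous_comp fst fst); apply continuous_fst.
    + apply (continuous_comp fst snd); [apply continuous_fst | apply continuous_snd].
  - apply Hf.
Qed.

Lemma locally_open (lo hi x : R) : (lo < x < hi)%R -> locally x (fun t => (lo < t < hi)%R).
Proof.
  intros H; apply (open_and (fun t => (lo < t)%R) (fun t => (t < hi)%R));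
    [apply open_gt | apply open_lt | exact H].
Qed.

(** The assumptions range over the open interval [(lo, hi)] because the outer differentiation uses
    the inner one at all parameters near [x]. *)
Lemma der_CInt2 (lo hi x : R) (f g : R -> R -> R -> C) :
  (lo < x < hi)%R ->
  (forall t u v, (lo < t < hi)%R -> (0 <= u <= a)%R -> (0 <= v <= b)%R ->
    der (fun s => f s u v) t (g t u v)) ->
  (forall t u v, (lo < t < hi)%R -> (0 <= u <= a)%R -> (0 <= v <= b)%R ->
    cont (fun q : R * (R * R) => f (fst q) (fst (snd q)) (snd (snd q))) (t, (u, v))) ->
  (forall t u v, (lo < t < hi)%R -> (0 <= u <= a)%R -> (0 <= v <= b)%R ->
    cont (fun q : R * (R * R) => g (fst q) (fst (snd q)) (snd (snd q))) (t, (u, v))) ->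
  der (fun t => CInt2 a b (f t)) x (CInt2 a b (g x)).
Proof.
  intros Hx Hd Hf Hg.
  assert (cl2 : forall h : R -> R -> R -> C,
    (forall t u v, (lo < t < hi)%R -> (0 <= u <= a)%R -> (0 <= v <= b)%R ->
      cont (fun q : R * (R * R) => h (fst q) (fst (snd q)) (snd (snd q))) (t, (u, v))) ->
    forall t, (lo < t < hi)%R -> cont2 a b (h t)).
  { intros h Hh t Ht; apply cont2_of_cont; intros u v Hu Hv.
    apply (cont_comp (fun q : R * R => (t, q))
      (fun q : R * (R * R) => h (fst q) (fst (snd q)) (snd (snd q)))).
    - apply continuous_pair; [apply continuous_const | apply continuous_id].
    - apply Hh; assumption. }
  apply (der_CInt a x (fun t u => CInt (fun v => f t u v) 0 b)
    (fun t u => CInt (fun v => g t u v) 0 b) Ha).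
  - generalize (locally_open lo hi x Hx); apply filter_imp; intros t Ht u Hu.
    apply (der_CInt b t (fun t v => f t u v) (fun t v => g t u v) Hb).
    + generalize (locally_open lo hi t Ht); apply filter_imp; intros s Hs v Hv.
      apply Hd; assumption.
    + generalize (locally_open lo hi t Ht); apply filter_imp; intros s Hs.
      apply cont2_row; [apply cl2|]; assumption.
    + intros v.
      apply (cont_comp (fun q : R * R => (fst q, (u, clamp b (snd q))))
        (fun q : R * (R * R) => g (fst q) (fst (snd q)) (snd (snd q)))).
      * apply continuous_pair; [apply continuous_fst|].
        apply continuous_pair; [apply continuous_const | apply continuous_clamp, continuous_snd].
      * apply Hg; try assumption; apply clamp_in, Hb.
  - generalize (locally_open lo hi x Hx); apply filter_imp; intros t Ht.
    apply (cont2_inner (f t)), cl2; assumption.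
  - intros u.
    apply (cont_CInt (T := prod_UniformSpace R_UniformSpace R_UniformSpace) b
      (fun q v => g (fst q) (clamp a (snd q)) v) (x, u) Hb).
    + destruct (locally_open lo hi x Hx) as [d Hd']; exists d; intros [s w] [Hs _].
      simpl; apply cont2_row; [apply cl2; [exact Hg | apply Hd', Hs] | apply clamp_in, Ha].
    + intros v Hv.
      apply (cont_comp (fun q : (R * R) * R =>
          (fst (fst q), (clamp a (snd (fst q)), clamp b (snd q))))
        (fun q : R * (R * R) => g (fst q) (fst (snd q)) (snd (snd q)))).
      * apply continuous_pair; [|apply continuous_pair; apply continuous_clamp].
        -- apply (continuous_comp fst fst); apply continuous_fst.
        -- apply (continuous_comp fst snd); [apply continuous_fst | apply continuous_snd].
        -- apply continuous_snd.
      * apply Hg; [exact Hx | | ]; apply clamp_in; assumption.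
Qed.

(** Green's formula; the first integration is exchanged with a derivative, which requires
    a neighbourhood of [[0, a]]. *)
Lemma green (lo hi : R) (A A' B B' : R -> R -> C) :
  (lo < 0)%R -> (a < hi)%R ->
  (forall u v, (lo < u < hi)%R -> (0 <= v <= b)%R -> der (fun s => A s v) u (A' u v)) ->
  (forall u v, (lo < u < hi)%R -> (0 <= v <= b)%R ->
    cont (fun q : R * R => A (fst q) (snd q)) (u, v)) ->
  (forall u v, (lo < u < hi)%R -> (0 <= v <= b)%R ->
    cont (fun q : R * R => A' (fst q) (snd q)) (u, v)) ->
  (forall u v, (0 <= u <= a)%R -> (0 <= v <= b)%R -> der (B u) v (B' u v)) ->
  (forall u v, (0 <= u <= a)%R -> (0 <= v <= b)%R ->
    cont (fun q : R * R => B' (fst q) (snd q)) (u, v)) ->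
  CInt2 a b (fun u v => A' u v + B' u v) =
  CInt (A a) 0 b - CInt (A 0%R) 0 b + CInt (fun u => B u b - B u 0%R) 0 a.
Proof.
  intros Hlo Hhi HA HcA HcA' HB HcB'.
  assert (row : forall h : R -> R -> C,
    (forall u v, (lo < u < hi)%R -> (0 <= v <= b)%R ->
      cont (fun q : R * R => h (fst q) (snd q)) (u, v)) ->
    forall u, (lo < u < hi)%R -> contI b (h u)).
  { intros h Hh u Hu; apply contI_of_cont; [exact Hb|]; intros v Hv.
    apply (cont_comp (fun v : R => (u, v)) (fun q : R * R => h (fst q) (snd q))).
    - apply continuous_pair; [apply continuous_const | apply continuous_id].
    - apply Hh; assumption. }
  rewrite CInt2_plus.
  2: { apply cont2_of_cont; intros u v Hu Hv; apply HcA'; [lra | exact Hv]. }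
  2: { apply cont2_of_cont, HcB'. }
  f_equal.
  - unfold CInt2.
    rewrite (CInt_der a (fun u => CInt (A u) 0 b)); [reflexivity | exact Ha | |].
    + intros u Hu.
      apply (der_CInt b u A A' Hb).
      * assert (Hu' : (lo < u < hi)%R) by lra.
        generalize (locally_open lo hi u Hu'); apply filter_imp; intros t Ht v Hv.
        apply HA; assumption.
      * assert (Hu' : (lo < u < hi)%R) by lra.
        generalize (locally_open lo hi u Hu'); apply filter_imp; intros t Ht.
        apply row; assumption.
      * intros v.
        apply (cont_comp (fun q : R * R => (fst q, clamp b (snd q)))
          (fun q : R * R => A' (fst q) (snd q))).
        -- apply continuous_pair; [apply continuous_fst | apply continuous_clamp, continuous_snd].
        -- apply HcA'; [simpl; lra | apply clamp_in, Hb].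
    + apply (cont2_inner A'), cont2_of_cont; intros u v Hu Hv; apply HcA'; [lra | exact Hv].
  - apply CInt_ext; [exact Ha|]; intros u Hu.
    apply CInt_der; [exact Hb | intros v Hv; apply HB; lra|].
    apply (cont2_row B'); [apply cont2_of_cont, HcB' | lra].
Qed.

End CInt2.

(** * The three kinds of cells *)

Definition cis (u : R) : C := Cexp (Ci * RtoC u).

Lemma circ_cis (e u : R) : circ e u = RtoC e * cis u.
Proof. reflexivity. Qed.

Lemma cis_neq_0 (u : R) : cis u <> 0.
Proof. apply Cexp_neq_0. Qed.

Lemma cis_0 : cis 0 = 1.
Proof. unfold cis; rewrite Cmult_0_r; apply Cexp_0. Qed.

Lemma cis_2PI : cis (2 * PI) = 1.
Proof.
  unfold cis, Cexp; simpl.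
  replace (0 * (2 * PI) - 1 * 0)%R with 0%R by ring.
  replace (0 * 0 + 1 * (2 * PI))%R with (2 * PI)%R by ring.
  rewrite exp_0, cos_2PI, sin_2PI; apply C_ext; simpl; ring.
Qed.

Lemma Cmod_cis (u : R) : Cmod (cis u) = 1%R.
Proof.
  unfold cis; rewrite Cmod_Cexp; simpl.
  replace (0 * u - 1 * 0)%R with 0%R by ring; apply exp_0.
Qed.

Lemma RtoC_neq_0 (x : R) : x <> 0%R -> RtoC x <> 0.
Proof. intros H E; apply H, (f_equal Re E). Qed.

Lemma Clog_RtoC (x : R) : (0 < x)%R -> Clog (RtoC x) = RtoC (ln x).
Proof.
  intros Hx; unfold Clog, Carg; rewrite Cmod_R, Rabs_pos_eq by lra.
  apply C_ext; simpl; [reflexivity|].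
  unfold Rdiv; rewrite Rmult_0_l, atan_0; ring.
Qed.

(** * Derivatives of the cell parametrizations *)

Section Leaves.

Variables e u v : R.

Lemma der_cis : der cis u (Ci * cis u).
Proof.
  eapply der_eq; [apply der_Cexp, (der_mult (fun _ => Ci) RtoC); [apply der_const | apply der_id]|].
  unfold cis; ring.
Qed.

Lemma der_circ_u : der (fun u => circ e u) u (Ci * circ e u).
Proof.
  eapply der_eq; [apply (der_mult (fun _ => RtoC e) cis); [apply der_const | apply der_cis]|].
  rewrite circ_cis; ring.
Qed.

Lemma der_circ_e : der (fun e => circ e u) e (cis u).
Proof.
  eapply der_eq; [apply (der_mult RtoC (fun _ => cis u)); [apply der_id | apply der_const]|].
  ring.
Qed.

Lemma der_lcirc_u : der (fun u => lcirc e u) u Ci.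
Proof.
  eapply der_eq; [apply (der_plus (fun _ => RtoC (ln e)) (fun u => Ci * RtoC u));
    [apply der_const | apply (der_mult (fun _ => Ci) RtoC); [apply der_const | apply der_id]]|].
  ring.
Qed.

Lemma der_lcirc_e : (0 < e)%R -> der (fun e => lcirc e u) e (/ RtoC e).
Proof.
  intros He.
  eapply der_eq; [apply (der_plus (fun e => RtoC (ln e)) (fun _ => Ci * RtoC u));
    [apply der_RtoC, is_derive_Reals, derivable_pt_lim_ln, He | apply der_const]|].
  rewrite RtoC_inv; [ring | lra].
Qed.

Lemma seg_eq : seg e u v = RtoC e + RtoC v * (1 - 2 * RtoC e - circ e u).
Proof. unfold seg; rewrite RtoC_mult; reflexivity. Qed.

End Leaves.

Lemma der_seg_u (e u v : R) : der (fun u => seg e u v) u (- RtoC v * (Ci * circ e u)).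
Proof.
  eapply der_eq.
  - apply (der_plus (fun _ => RtoC e) (fun u => RtoC v * (1 - RtoC (2 * e) - circ e u)));
      [apply der_const|].
    apply (der_mult (fun _ => RtoC v) (fun u => 1 - RtoC (2 * e) - circ e u)); [apply der_const|].
    apply (der_minus (fun _ => 1 - RtoC (2 * e)) (fun u => circ e u));
      [apply der_const | apply der_circ_u].
  - ring.
Qed.

Lemma der_seg_v (e u v : R) : der (fun v => seg e u v) v (1 - 2 * RtoC e - circ e u).
Proof.
  eapply der_eq.
  - apply (der_plus (fun _ => RtoC e) (fun v => RtoC v * (1 - RtoC (2 * e) - circ e u)));
      [apply der_const|].
    apply (der_mult RtoC (fun _ => 1 - RtoC (2 * e) - circ e u)); [apply der_id | apply der_const].
  - rewrite RtoC_mult; ring.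
Qed.

Lemma der_seg_v' (e u v : R) :
  der (fun v => seg e u (1 - v)) v (- (1 - 2 * RtoC e - circ e u)).
Proof.
  eapply der_eq.
  - apply (der_comp_R (fun v => seg e u v) (fun v => 1 - v)%R v (-1)); [|apply der_seg_v].
    auto_derive; [auto | ring].
  - ring.
Qed.

Lemma der_seg_e (e u v : R) : der (fun e => seg e u v) e (1 - RtoC v * (2 + cis u)).
Proof.
  apply (der_ext (fun e => RtoC e + RtoC v * (1 - 2 * RtoC e - circ e u))).
  { intros s; symmetry; apply seg_eq. }
  eapply der_eq.
  - apply (der_plus RtoC (fun e => RtoC v * (1 - 2 * RtoC e - circ e u))); [apply der_id|].
    apply (der_mult (fun _ => RtoC v) (fun e => 1 - 2 * RtoC e - circ e u)); [apply der_const|].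
    apply (der_minus (fun e => 1 - 2 * RtoC e) (fun e => circ e u)); [|apply der_circ_e].
    apply (der_minus (fun _ => 1) (fun e => 2 * RtoC e)); [apply der_const|].
    apply (der_mult (fun _ => 2) RtoC); [apply der_const | apply der_id].
  - ring.
Qed.

Lemma der_third_u (e u v : R) : der (fun u => third e u v) u (- (Ci * circ e u)).
Proof.
  eapply der_eq.
  - apply (der_minus (fun u => 1 - circ e u) (fun _ => circ e v)); [|apply der_const].
    apply (der_minus (fun _ => 1) (fun u => circ e u)); [apply der_const | apply der_circ_u].
  - ring.
Qed.

Lemma der_third_v (e u v : R) : der (fun v => third e u v) v (- (Ci * circ e v)).
Proof.
  eapply der_eq.
  - apply (der_minus (fun _ => 1 - circ e u) (fun v => circ e v));
      [apply der_const | apply der_circ_u].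
  - ring.
Qed.

Lemma der_third_e (e u v : R) : der (fun e => third e u v) e (- cis u - cis v).
Proof.
  eapply der_eq.
  - apply (der_minus (fun e => 1 - circ e u) (fun e => circ e v)); [|apply der_circ_e].
    apply (der_minus (fun _ => 1) (fun e => circ e u)); [apply der_const | apply der_circ_e].
  - ring.
Qed.

Lemma sig1_eq (e u : R) : sig1 e u = RtoC e + (1 - 3 * RtoC e) * RtoC u.
Proof. unfold sig1; rewrite RtoC_plus, RtoC_mult, RtoC_minus, RtoC_mult; reflexivity. Qed.

Lemma sig2_eq (e u v : R) :
  sig2 e u v = RtoC e + (1 - 3 * RtoC e) * (1 - RtoC u) * RtoC v.
Proof.
  unfold sig2; rewrite RtoC_plus, !RtoC_mult, !RtoC_minus, RtoC_mult; reflexivity.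
Qed.

Ltac der_real := apply der_RtoC; auto_derive; [auto | reflexivity].

Lemma der_sig1_u (e u : R) : der (fun u => sig1 e u) u (1 - 3 * RtoC e).
Proof.
  eapply der_eq; [der_real|]; rewrite <- RtoC_mult, <- RtoC_minus; f_equal; ring.
Qed.

Lemma der_sig1_e (e u : R) : der (fun e => sig1 e u) e (1 - 3 * RtoC u).
Proof.
  eapply der_eq; [der_real|]; rewrite <- RtoC_mult, <- RtoC_minus; f_equal; ring.
Qed.

Lemma der_sig2_u (e u v : R) : der (fun u => sig2 e u v) u (- (1 - 3 * RtoC e) * RtoC v).
Proof.
  eapply der_eq; [der_real|].
  rewrite <- RtoC_mult, <- RtoC_minus, <- RtoC_opp, <- RtoC_mult; f_equal; ring.
Qed.

Lemma der_sig2_v (e u v : R) : der (fun v => sig2 e u v) v ((1 - 3 * RtoC e) * (1 - RtoC u)).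
Proof.
  eapply der_eq; [der_real|].
  rewrite <- RtoC_mult, <- !RtoC_minus, <- RtoC_mult; f_equal; ring.
Qed.

Lemma der_sig2_e (e u v : R) : der (fun e => sig2 e u v) e (1 - 3 * (1 - RtoC u) * RtoC v).
Proof.
  eapply der_eq; [der_real|].
  rewrite <- RtoC_minus, <- !RtoC_mult, <- RtoC_minus; f_equal; ring.
Qed.

(** The derivative is synthesized as an existential variable, to be compared with the expected one
    by [der_eq]. What remains open is positivity: of the real part under [Clog], and of the radius
    for [lcirc]. *)
Ltac der_auto :=
  lazymatch goal with
  | |- der (fun s => @?f s + @?g s) _ _ => apply (der_plus f g); der_auto
  | |- der (fun s => @?f s - @?g s) _ _ => apply (der_minus f g); der_auto
  | |- der (fun s => @?f s * @?g s) _ _ => apply (der_mult f g); der_auto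
  | |- der (fun s => - @?f s) _ _ => apply (der_opp f); der_auto
  | |- der (fun s => Cexp (@?f s)) _ _ => apply (der_Cexp f); der_auto
  | |- der (fun s => Clog (@?f s)) _ _ => apply (der_Clog f); [ | der_auto]
  | |- der (fun s => cis s) _ _ => apply der_cis
  | |- der (fun s => circ s _) _ _ => apply der_circ_e
  | |- der (fun s => circ _ s) _ _ => apply der_circ_u
  | |- der (fun s => lcirc s _) _ _ => apply der_lcirc_e
  | |- der (fun s => lcirc _ s) _ _ => apply der_lcirc_u
  | |- der (fun s => seg s _ _) _ _ => apply der_seg_e
  | |- der (fun s => seg _ s _) _ _ => apply der_seg_u
  | |- der (fun s => seg _ _ s) _ _ => apply der_seg_v
  | |- der (fun s => seg _ _ (1 - s)) _ _ => apply der_seg_v'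
  | |- der (fun s => third s _ _) _ _ => apply der_third_e
  | |- der (fun s => third _ s _) _ _ => apply der_third_u
  | |- der (fun s => third _ _ s) _ _ => apply der_third_v
  | |- der (fun s => sig1 s _) _ _ => apply der_sig1_e
  | |- der (fun s => sig1 _ s) _ _ => apply der_sig1_u
  | |- der (fun s => sig2 s _ _) _ _ => apply der_sig2_e
  | |- der (fun s => sig2 _ s _) _ _ => apply der_sig2_u
  | |- der (fun s => sig2 _ _ s) _ _ => apply der_sig2_v
  | |- der (fun s => RtoC s) _ _ => apply der_id
  | |- der RtoC _ _ => apply der_id
  | |- der cis _ _ => apply der_cis
  | |- der (fun _ => ?c) _ _ => apply (der_const c)
  end.

(** * Continuity of the cell parametrizations *)

Section ContLeaves.

Context {T : UniformSpace}.
Variables (h k m : T -> R) (t : T).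
Hypotheses (Hh : continuous h t) (Hk : continuous k t) (Hm : continuous m t).

Lemma cont_cis : cont (fun q => cis (k q)) t.
Proof. apply cont_Cexp, cont_mult; [apply cont_const | apply cont_RtoC, Hk]. Qed.

Lemma cont_circ : cont (fun q => circ (h q) (k q)) t.
Proof. apply cont_mult; [apply cont_RtoC, Hh | apply cont_cis]. Qed.

Lemma cont_lcirc : (0 < h t)%R -> cont (fun q => lcirc (h q) (k q)) t.
Proof.
  intros He; apply cont_plus.
  - apply cont_RtoC, (continuous_Rcomp h ln); [exact Hh | auto_derive; auto].
  - apply cont_mult; [apply cont_const | apply cont_RtoC, Hk].
Qed.

Lemma cont_seg : cont (fun q => seg (h q) (k q) (m q)) t.
Proof.
  apply cont_plus; [apply cont_RtoC, Hh|].
  apply cont_mult; [apply cont_RtoC, Hm|].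
  apply cont_minus; [apply cont_minus; [apply cont_const|] | apply cont_circ].
  apply cont_RtoC, (continuous_Rcomp h (fun x => 2 * x)%R); [exact Hh | auto_derive; auto].
Qed.

Lemma continuous_1_minus : continuous (fun q => 1 - m q)%R t.
Proof. apply (continuous_Rcomp m (fun x => 1 - x)%R); [exact Hm | auto_derive; auto]. Qed.

Lemma cont_third : cont (fun q => third (h q) (k q) (m q)) t.
Proof.
  apply cont_minus; [apply cont_minus; [apply cont_const | apply cont_circ]|].
  apply cont_mult; [apply cont_RtoC, Hh|].
  apply cont_Cexp, cont_mult; [apply cont_const | apply cont_RtoC, Hm].
Qed.

Lemma cont_sig1 : cont (fun q => sig1 (h q) (k q)) t.
Proof.
  eapply cont_ext; [intros q; symmetry; apply sig1_eq|].
  apply cont_plus; [apply cont_RtoC, Hh|]; apply cont_mult; [|apply cont_RtoC, Hk].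
  apply cont_minus; [apply cont_const | apply cont_mult; [apply cont_const | apply cont_RtoC, Hh]].
Qed.

Lemma cont_sig2 : cont (fun q => sig2 (h q) (k q) (m q)) t.
Proof.
  eapply cont_ext; [intros q; symmetry; apply sig2_eq|].
  apply cont_plus; [apply cont_RtoC, Hh|]; apply cont_mult; [|apply cont_RtoC, Hm].
  apply cont_mult; apply cont_minus; try apply cont_const.
  - apply cont_mult; [apply cont_const | apply cont_RtoC, Hh].
  - apply cont_RtoC, Hk.
Qed.

End ContLeaves.

Ltac continuous_auto :=
  lazymatch goal with
  | |- continuous (fun q => (1 - @?m q)%R) _ => apply (continuous_1_minus m); continuous_auto
  | |- continuous (fun q => fst (fst q)) _ =>
      apply (continuous_comp fst fst); [apply continuous_fst | apply continuous_fst]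
  | |- continuous (fun q => fst (snd q)) _ =>
      apply (continuous_comp snd fst); [apply continuous_snd | apply continuous_fst]
  | |- continuous (fun q => snd (fst q)) _ =>
      apply (continuous_comp fst snd); [apply continuous_fst | apply continuous_snd]
  | |- continuous (fun q => snd (snd q)) _ =>
      apply (continuous_comp snd snd); [apply continuous_snd | apply continuous_snd]
  | |- continuous (fun q => fst q) _ => apply continuous_fst
  | |- continuous (fun q => snd q) _ => apply continuous_snd
  | |- continuous (Rminus 1) _ => apply (continuous_1_minus (fun x => x)), continuous_id
  | |- continuous fst _ => apply continuous_fst
  | |- continuous snd _ => apply continuous_snd
  | |- continuous (fun q => q) _ => apply continuous_id
  | |- continuous (fun _ => ?c) _ => apply (continuous_const c)
  end.

Ltac cont_auto :=
  lazymatch goal with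
  | |- cont (fun s => @?f s + @?g s) _ => apply (cont_plus f g); cont_auto
  | |- cont (fun s => @?f s - @?g s) _ => apply (cont_minus f g); cont_auto
  | |- cont (fun s => @?f s * @?g s) _ => apply (cont_mult f g); cont_auto
  | |- cont (fun s => @?f s / @?g s) _ => apply (cont_div f g); [ | cont_auto | cont_auto ]
  | |- cont (fun s => / @?f s) _ => apply (cont_inv f); [ | cont_auto ]
  | |- cont (fun s => - @?f s) _ => apply (cont_opp f); cont_auto
  | |- cont (fun s => Cexp (@?f s)) _ => apply (cont_Cexp f); cont_auto
  | |- cont (fun s => Clog (@?f s)) _ => apply (cont_Clog f); [ | cont_auto]
  | |- cont (fun s => RtoC _) _ => apply cont_RtoC; continuous_auto
  | |- cont (fun s => cis _) _ => apply cont_cis; continuous_auto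
  | |- cont (fun s => circ _ _) _ => apply cont_circ; continuous_auto
  | |- cont (fun s => lcirc _ _) _ => apply cont_lcirc; [continuous_auto | continuous_auto | ]
  | |- cont (fun s => seg _ _ _) _ => apply cont_seg; continuous_auto
  | |- cont (fun s => third _ _ _) _ => apply cont_third; continuous_auto
  | |- cont (fun s => sig1 _ _) _ => apply cont_sig1; continuous_auto
  | |- cont (fun s => sig2 _ _ _) _ => apply cont_sig2; continuous_auto
  | |- cont (fun _ => ?c) _ => apply (cont_const c)
  end.

Ltac cont_side :=
  cbn [fst snd]; solve [auto | lra | apply neq_0_Re_pos; auto].

(** [E] is circle times edge, [T] is circle times circle, [S] the shrunken triangle; the
    parameters [p, q, r] are the exponents of the first circle and of the two other forms. *)

Definition wE (p q r : C) (e u v : R) : C :=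
  Cexp (p * lcirc e u + q * Clog (seg e u v) + r * Clog (seg e u (1 - v))).
Definition JE (e u : R) : C := Ci * circ e u * (1 - 2 * RtoC e - circ e u).
Definition wT (p q r : C) (e u v : R) : C :=
  Cexp (p * lcirc e u + q * lcirc e v + r * Clog (third e u v)).
Definition JT (e u v : R) : C := - (circ e u * circ e v).
Definition wS (p q r : C) (e u v : R) : C :=
  Cexp (p * Clog (sig1 e u) + q * Clog (sig2 e u v) + r * Clog (1 - sig1 e u - sig2 e u v)).
Definition JS (e u : R) : C := (1 - 3 * RtoC e) * (1 - 3 * RtoC e) * (1 - RtoC u).

Definition IE (p q r : C) (e : R) : C := CInt2 (2 * PI) 1 (fun u v => wE p q r e u v * JE e u).
Definition IT (p q r : C) (e : R) : C :=
  CInt2 (2 * PI) (2 * PI) (fun u v => wT p q r e u v * JT e u v).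
Definition IS (p q r : C) (e : R) : C := CInt2 1 1 (fun u v => wS p q r e u v * JS e u).

(** The two kinds of boundary integrals in Stokes' formula: [WE] along an edge of the shrunken
    triangle, with the constant speed [1 - 3 e] left out, and [VE] around the circle at an end of an
    edge cell, which is also a side of a torus. *)
Definition WE (p q r : C) (e : R) : C := CInt (wE p q r e 0) 0 1.
Definition VE (p q r : C) (e : R) : C :=
  CInt (fun u => wT p q r e u 0 * (Ci * circ e u)) 0 (2 * PI).

(** The Lie derivative of [w dz1 /\ dz2] along [s d/de + (k1, k2, k3)], pulled back to the cell. *)
Definition DE (s k1 k2 k3 p q r : C) (e u v : R) : C :=
  wE p q r e u v *
  ((p * (s * cis u + k1) / circ e u +
    q * (s * (1 - RtoC v * (2 + cis u)) + k2) / seg e u v +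
    r * (s * (1 - (1 - RtoC v) * (2 + cis u)) + k3) / seg e u (1 - v)) * JE e u +
   s * (Ci * cis u * (1 - 2 * RtoC e - circ e u) - Ci * circ e u * (2 + cis u))).
Definition DT (s k1 k2 k3 p q r : C) (e u v : R) : C :=
  wT p q r e u v *
  ((p * (s * cis u + k1) / circ e u + q * (s * cis v + k2) / circ e v +
    r * (- s * (cis u + cis v) + k3) / third e u v) * JT e u v
   - s * (2 * RtoC e * cis u * cis v)).
Definition DS (s k1 k2 k3 p q r : C) (e u v : R) : C :=
  wS p q r e u v *
  ((p * (s * (1 - 3 * RtoC u) + k1) / sig1 e u +
    q * (s * (1 - 3 * (1 - RtoC u) * RtoC v) + k2) / sig2 e u v +
    r * (s * (1 - 3 * (1 - RtoC u) * (1 - RtoC v)) + k3) / (1 - sig1 e u - sig2 e u v)) * JS e u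
   - s * (6 * (1 - 3 * RtoC e) * (1 - RtoC u))).

Lemma circ_neq_0 (e u : R) : (0 < e)%R -> circ e u <> 0.
Proof. intros He; apply Cmult_neq_0; [apply RtoC_neq_0; lra | apply cis_neq_0]. Qed.

Lemma seg_1_minus (e u v : R) : seg e u (1 - v) = 1 - circ e u - seg e u v.
Proof. rewrite !seg_eq, RtoC_minus; ring. Qed.

Lemma two_PI_ge_0 : (0 <= 2 * PI)%R.
Proof. generalize PI_RGT_0; lra. Qed.

(** * Stokes' formula on each kind of cell *)

Section Stokes.

Variable e : R.
Hypothesis He : (0 < e < 1 / 3)%R.

Let e_neq_0 : RtoC e <> 0.
Proof. apply RtoC_neq_0; lra. Qed.

(** The contraction of [w dz1 dz2] with the field pulls back to [A dv - B du]; its exterior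
    derivative is [(A' + B') du dv]. The relation between the [k] keeps the field tangent to
    [z1 + z2 + z3 = 1] and serves to eliminate [k3]. *)
Lemma green_E (s k1 k2 k3 p q r : C) : k1 + k2 + k3 = 0 ->
  let A u v := wE p q r e u v * (1 - 2 * RtoC e - circ e u) * (s * cis u + k1) in
  let B u v := wE p q r e u v *
    ((s * cis u + k1) * RtoC v + (s * (1 - RtoC v * (2 + cis u)) + k2)) * (Ci * circ e u) in
  CInt2 (2 * PI) 1 (DE s k1 k2 k3 p q r e) =
  CInt (A (2 * PI)%R) 0 1 - CInt (A 0%R) 0 1 + CInt (fun u => B u 1 - B u 0) 0 (2 * PI).
Proof.
  intros Hk A B.
  assert (S1 : forall u v, (0 <= v <= 1)%R -> (0 < Re (seg e u v))%R)
    by (intros; apply Re_seg_pos; assumption).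
  assert (S2 : forall u v, (0 <= v <= 1)%R -> (0 < Re (seg e u (1 - v)))%R)
    by (intros; apply Re_seg_pos; lra).
  pose (A' := fun u v => wE p q r e u v *
    ((p * Ci - q * RtoC v * (Ci * circ e u) / seg e u v
        - r * (1 - RtoC v) * (Ci * circ e u) / seg e u (1 - v)) *
      (1 - 2 * RtoC e - circ e u) * (s * cis u + k1)
     - Ci * circ e u * (s * cis u + k1) + (1 - 2 * RtoC e - circ e u) * (s * (Ci * cis u)))).
  pose (B' := fun u v => wE p q r e u v *
    ((q * (1 - 2 * RtoC e - circ e u) / seg e u v
        - r * (1 - 2 * RtoC e - circ e u) / seg e u (1 - v)) *
      ((s * cis u + k1) * RtoC v + (s * (1 - RtoC v * (2 + cis u)) + k2)) * (Ci * circ e u)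
     + ((s * cis u + k1) - s * (2 + cis u)) * (Ci * circ e u))).
  transitivity (CInt2 (2 * PI) 1 (fun u v => A' u v + B' u v)).
  { apply CInt2_ext; [apply two_PI_ge_0 | lra|]; intros u v _ Hv.
    assert (N1 := neq_0_Re_pos _ (S1 u v Hv)).
    assert (N2 := neq_0_Re_pos _ (S2 u v Hv)).
    assert (N3 := cis_neq_0 u).
    replace k3 with (- k1 - k2) by (transitivity (k1 + k2 + k3 - k1 - k2); [rewrite Hk|]; ring).
    unfold DE, A', B', JE; rewrite circ_cis; field; auto. }
  (* The parametrization is regular for all real [u], so any interval around [[0, 2 PI]] serves as
     the neighbourhood. *)
  apply (green (2 * PI) 1 two_PI_ge_0 Rle_0_1 (-1) (2 * PI + 1) A A' B B'); try lra.
  - intros u v _ Hv; unfold A, wE; eapply der_eq; [der_auto; auto|]; unfold A', wE.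
    rewrite RtoC_minus; field; split; apply neq_0_Re_pos; auto.
  - intros u v _ Hv; unfold A, wE; cont_auto; cont_side.
  - intros u v _ Hv; unfold A', wE; cont_auto; cont_side.
  - intros u v _ Hv; unfold B, wE; eapply der_eq; [der_auto; auto|]; unfold B', wE.
    field; split; apply neq_0_Re_pos; auto.
  - intros u v _ Hv; unfold B', wE; cont_auto; cont_side.
Qed.

Lemma green_T (s k1 k2 k3 p q r : C) : k1 + k2 + k3 = 0 ->
  let A u v := wT p q r e u v * (Ci * circ e v) * (s * cis u + k1) in
  let B u v := wT p q r e u v * (s * cis v + k2) * (Ci * circ e u) in
  CInt2 (2 * PI) (2 * PI) (DT s k1 k2 k3 p q r e) =
  CInt (A (2 * PI)%R) 0 (2 * PI) - CInt (A 0%R) 0 (2 * PI) +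
  CInt (fun u => B u (2 * PI)%R - B u 0%R) 0 (2 * PI).
Proof.
  intros Hk A B.
  assert (S1 : forall u v, (0 < Re (third e u v))%R)
    by (intros; apply Re_third_pos; assumption).
  pose (A' := fun u v => wT p q r e u v * (Ci * circ e v) *
    ((p * Ci - r * (Ci * circ e u) / third e u v) * (s * cis u + k1) + s * (Ci * cis u))).
  pose (B' := fun u v => wT p q r e u v * (Ci * circ e u) *
    ((q * Ci - r * (Ci * circ e v) / third e u v) * (s * cis v + k2) + s * (Ci * cis v))).
  assert (Hi : Ci * Ci = -(1)) by (apply C_ext; simpl; ring).
  transitivity (CInt2 (2 * PI) (2 * PI) (fun u v => A' u v + B' u v)).
  { apply CInt2_ext; [apply two_PI_ge_0 | apply two_PI_ge_0 |]; intros u v _ _.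
    assert (N1 := neq_0_Re_pos _ (S1 u v)).
    assert (N2 := cis_neq_0 u).
    assert (N3 := cis_neq_0 v).
    replace k3 with (- k1 - k2) by (transitivity (k1 + k2 + k3 - k1 - k2); [rewrite Hk|]; ring).
    unfold DT, A', B', JT; rewrite !circ_cis; field_simplify_eq [Hi]; auto. }
  assert (Hpi := PI_RGT_0).
  apply (green (2 * PI) (2 * PI) two_PI_ge_0 two_PI_ge_0 (-1) (2 * PI + 1) A A' B B'); try lra.
  - intros u v _ Hv; unfold A, wT; eapply der_eq; [der_auto; auto|]; unfold A', wT.
    field; apply neq_0_Re_pos; auto.
  - intros u v _ Hv; unfold A, wT; cont_auto; cont_side.
  - intros u v _ Hv; unfold A', wT; cont_auto; cont_side.
  - intros u v _ Hv; unfold B, wT; eapply der_eq; [der_auto; auto|]; unfold B', wT.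
    field; apply neq_0_Re_pos; auto.
  - intros u v _ Hv; unfold B', wT; cont_auto; cont_side.
Qed.

(** The range of [u] exceeds [[0, 1]] by [e] on both sides to provide the neighbourhood demanded by
    [green]; the three forms stay positive because [e - (1 - 3 e) e > 0]. *)
Lemma Re_sig_pos (u v : R) : (- e < u < 1 + e)%R -> (0 <= v <= 1)%R ->
  (0 < Re (sig1 e u))%R /\ (0 < Re (sig2 e u v))%R /\ (0 < Re (1 - sig1 e u - sig2 e u v))%R.
Proof.
  intros Hu Hv; unfold sig1, sig2, RtoC; simpl.
  assert (H1 : (- e <= (1 - u) * v)%R).
  { destruct (Rle_dec u 1); [assert (0 <= (1 - u) * v)%R by nra; lra | nra]. }
  assert (H2 : (- e <= (1 - u) * (1 - v))%R).
  { destruct (Rle_dec u 1); [assert (0 <= (1 - u) * (1 - v))%R by nra; lra | nra]. }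
  repeat split.
  - assert ((1 - 3 * e) * (- e) <= (1 - 3 * e) * u)%R by nra. nra.
  - assert ((1 - 3 * e) * (- e) <= (1 - 3 * e) * ((1 - u) * v))%R by nra. nra.
  - assert ((1 - 3 * e) * (- e) <= (1 - 3 * e) * ((1 - u) * (1 - v)))%R by nra. nra.
Qed.

Lemma green_S (s k1 k2 k3 p q r : C) : k1 + k2 + k3 = 0 ->
  let A u v := wS p q r e u v * ((1 - 3 * RtoC e) * (1 - RtoC u)) *
    (s * (1 - 3 * RtoC u) + k1) in
  let B u v := wS p q r e u v * (1 - 3 * RtoC e) *
    ((s * (1 - 3 * (1 - RtoC u) * RtoC v) + k2) + (s * (1 - 3 * RtoC u) + k1) * RtoC v) in
  CInt2 1 1 (DS s k1 k2 k3 p q r e) =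
  CInt (A 1%R) 0 1 - CInt (A 0%R) 0 1 + CInt (fun u => B u 1%R - B u 0%R) 0 1.
Proof.
  intros Hk A B.
  pose (A' := fun u v => wS p q r e u v * (1 - 3 * RtoC e) *
    ((1 - 3 * RtoC e) * (p / sig1 e u - q * RtoC v / sig2 e u v
        - r * (1 - RtoC v) / (1 - sig1 e u - sig2 e u v)) *
      (1 - RtoC u) * (s * (1 - 3 * RtoC u) + k1)
     - (s * (1 - 3 * RtoC u) + k1) - 3 * s * (1 - RtoC u))).
  pose (B' := fun u v => wS p q r e u v * (1 - 3 * RtoC e) *
    ((1 - 3 * RtoC e) * (1 - RtoC u) *
      (q / sig2 e u v - r / (1 - sig1 e u - sig2 e u v)) *
      ((s * (1 - 3 * (1 - RtoC u) * RtoC v) + k2) + (s * (1 - 3 * RtoC u) + k1) * RtoC v)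
     - 3 * s * (1 - RtoC u) + (s * (1 - 3 * RtoC u) + k1))).
  transitivity (CInt2 1 1 (fun u v => A' u v + B' u v)).
  { apply CInt2_ext; [lra | lra|]; intros u v Hu Hv.
    destruct (Re_sig_pos u v) as (S1 & S2 & S3); [lra | exact Hv|].
    apply neq_0_Re_pos in S1, S2, S3.
    replace k3 with (- k1 - k2) by (transitivity (k1 + k2 + k3 - k1 - k2); [rewrite Hk|]; ring).
    unfold DS, A', B', JS; field; auto. }
  apply (green 1 1 Rle_0_1 Rle_0_1 (- e) (1 + e) A A' B B'); try lra.
  - intros u v Hu Hv; destruct (Re_sig_pos u v Hu Hv) as (S1 & S2 & S3).
    unfold A, wS; eapply der_eq; [der_auto; auto|]; unfold A', wS.
    field; repeat split; apply neq_0_Re_pos; auto.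
  - intros u v Hu Hv; destruct (Re_sig_pos u v Hu Hv) as (S1 & S2 & S3).
    unfold A, wS; cont_auto; cont_side.
  - intros u v Hu Hv; destruct (Re_sig_pos u v Hu Hv) as (S1 & S2 & S3).
    unfold A', wS; cont_auto; cont_side.
  - intros u v Hu Hv; destruct (Re_sig_pos u v) as (S1 & S2 & S3); [lra | exact Hv|].
    unfold B, wS; eapply der_eq; [der_auto; auto|]; unfold B', wS.
    field; repeat split; apply neq_0_Re_pos; auto.
  - intros u v Hu Hv; destruct (Re_sig_pos u v) as (S1 & S2 & S3); [lra | exact Hv|].
    unfold B', wS; cont_auto; cont_side.
Qed.

End Stokes.

(** * The regularized integral *)

Definition mono (p : C) : C := Cexp (2 * RtoC PI * Ci * p).

Definition Dreg (p1 p2 p3 : C) (e : R) : C :=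
  let d p := / (mono p - 1) in
  IS p1 p2 p3 e +
  (d p1 * IE p1 p2 p3 e + d p2 * IE p2 p3 p1 e + d p3 * IE p3 p1 p2 e) +
  (d p1 * d p2 * IT p1 p2 p3 e + d p2 * d p3 * IT p2 p3 p1 e + d p3 * d p1 * IT p3 p1 p2 e).

(** * Monodromy and boundary values of the cells *)

Lemma lcirc_0 (e : R) : lcirc e 0 = RtoC (ln e).
Proof. unfold lcirc; ring. Qed.

Lemma circ_0 (e : R) : circ e 0 = RtoC e.
Proof. rewrite circ_cis, cis_0; ring. Qed.

Lemma circ_2PI (e : R) : circ e (2 * PI) = RtoC e.
Proof. rewrite circ_cis, cis_2PI; ring. Qed.

Lemma seg_2PI (e v : R) : seg e (2 * PI) v = seg e 0 v.
Proof. unfold seg; rewrite circ_2PI, circ_0; reflexivity. Qed.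

Lemma third_sym (e u v : R) : third e u v = third e v u.
Proof. unfold third; ring. Qed.

Lemma third_2PI (e v : R) : third e (2 * PI) v = third e 0 v.
Proof. unfold third; rewrite circ_2PI, circ_0; reflexivity. Qed.

Lemma seg_end (e u : R) : seg e u 1 = third e u 0.
Proof. rewrite seg_eq; unfold third; rewrite circ_0; ring. Qed.

Lemma seg_start (e u : R) : seg e u 0 = RtoC e.
Proof. rewrite seg_eq; ring. Qed.

Lemma lcirc_2PI (e : R) : lcirc e (2 * PI) = lcirc e 0 + 2 * RtoC PI * Ci.
Proof. unfold lcirc; rewrite RtoC_mult; ring. Qed.

Lemma wE_2PI (p q r : C) (e v : R) : wE p q r e (2 * PI) v = mono p * wE p q r e 0 v.
Proof.
  unfold wE, mono; rewrite !seg_2PI, lcirc_2PI, <- Cexp_plus; f_equal; ring.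
Qed.

Lemma wT_2PI_l (p q r : C) (e v : R) : wT p q r e (2 * PI) v = mono p * wT p q r e 0 v.
Proof.
  unfold wT, mono; rewrite third_2PI, lcirc_2PI, <- Cexp_plus; f_equal; ring.
Qed.

Lemma wT_sym (p q r : C) (e u v : R) : wT p q r e u v = wT q p r e v u.
Proof. unfold wT; rewrite third_sym; f_equal; ring. Qed.

Lemma wT_2PI_r (p q r : C) (e u : R) : wT p q r e u (2 * PI) = mono q * wT p q r e u 0.
Proof. rewrite wT_sym, wT_2PI_l, wT_sym; reflexivity. Qed.

Lemma sig1_0 (e : R) : sig1 e 0 = RtoC e.
Proof. rewrite sig1_eq; ring. Qed.

Lemma sig1_seg (e u : R) : sig1 e u = seg e 0 u.
Proof. rewrite sig1_eq, seg_eq, circ_0; ring. Qed.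

Lemma sig2_seg (e v : R) : sig2 e 0 v = seg e 0 v.
Proof. rewrite sig2_eq, seg_eq, circ_0; ring. Qed.

Lemma sig2_end (e u : R) : sig2 e u 1 = seg e 0 (1 - u).
Proof. rewrite sig2_eq, seg_eq, circ_0, RtoC_minus; ring. Qed.

Lemma sig2_start (e u : R) : sig2 e u 0 = RtoC e.
Proof. rewrite sig2_eq; ring. Qed.

Lemma mono_shift (p : C) : mono (p + 1) = mono p.
Proof.
  unfold mono.
  replace (2 * RtoC PI * Ci * (p + 1)) with (2 * RtoC PI * Ci * p + Ci * RtoC (2 * PI))
    by (rewrite RtoC_mult; ring).
  rewrite Cexp_plus; fold (cis (2 * PI)); rewrite cis_2PI; ring.
Qed.

Section Fixed.

Variable e : R.
Hypothesis He : (0 < e < 1 / 3)%R.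

Lemma Clog_e : Clog (RtoC e) = lcirc e 0.
Proof. rewrite lcirc_0; apply Clog_RtoC; lra. Qed.

Lemma cont2_E (p q r : C) : cont2 (2 * PI) 1 (fun u v => wE p q r e u v * JE e u).
Proof.
  apply cont2_of_cont; [apply two_PI_ge_0 | lra|]; intros u v _ Hv.
  unfold wE, JE; cont_auto; cbn [fst snd]; try apply Re_seg_pos; lra.
Qed.

Lemma cont2_T (p q r : C) : cont2 (2 * PI) (2 * PI) (fun u v => wT p q r e u v * JT e u v).
Proof.
  apply cont2_of_cont; [apply two_PI_ge_0 | apply two_PI_ge_0 |]; intros u v _ _.
  unfold wT, JT; cont_auto; cbn [fst snd]; try apply Re_third_pos; lra.
Qed.

Lemma cont2_S (p q r : C) : cont2 1 1 (fun u v => wS p q r e u v * JS e u).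
Proof.
  apply cont2_of_cont; [lra | lra |]; intros u v Hu Hv.
  destruct (Re_sig_pos e He u v) as (S1 & S2 & S3); [lra | exact Hv|].
  unfold wS, JS; cont_auto; cont_side.
Qed.

Lemma contI_WE (p q r : C) : contI 1 (wE p q r e 0).
Proof.
  apply contI_of_cont; [lra|]; intros v Hv.
  unfold wE; cont_auto; cbn [fst snd]; try apply Re_seg_pos; lra.
Qed.

Lemma contI_VE (p q r : C) : contI (2 * PI) (fun u => wT p q r e u 0 * (Ci * circ e u)).
Proof.
  apply contI_of_cont; [apply two_PI_ge_0|]; intros v _.
  unfold wT; cont_auto; cbn [fst snd]; try apply Re_third_pos; lra.
Qed.

(** The sides [u = 0] and [u = 2 PI] differ by the monodromy of the encircled form, whence the
    factor [mono p - 1] that the chain coefficient cancels. At [v = 0] and [v = 1] one of the other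
    forms equals [e], so these sides are circles on the two adjacent tori. *)
Lemma stokes_E (s k1 k2 k3 p q r : C) : k1 + k2 + k3 = 0 ->
  CInt2 (2 * PI) 1 (DE s k1 k2 k3 p q r e) =
  (mono p - 1) * (1 - 3 * RtoC e) * (s + k1) * WE p q r e
  - (s + k3) * VE p r q e - (s + k2) * VE p q r e.
Proof.
  intros Hk; rewrite green_E by assumption.
  assert (Hpi := two_PI_ge_0).
  rewrite (CInt_ext 1 _ (fun v => mono p * (1 - 3 * RtoC e) * (s + k1) * wE p q r e 0 v)).
  2: lra.
  2: { intros v _; rewrite wE_2PI, circ_2PI, cis_2PI; ring. }
  rewrite (CInt_ext 1 (fun v => wE p q r e 0 v * _ * _)
    (fun v => (1 - 3 * RtoC e) * (s + k1) * wE p q r e 0 v)).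
  2: lra.
  2: { intros v _; rewrite circ_0, cis_0; ring. }
  rewrite (CInt_ext (2 * PI) _ (fun u => - (s + k3) * (wT p r q e u 0 * (Ci * circ e u)) -
    (s + k2) * (wT p q r e u 0 * (Ci * circ e u)))); [|exact Hpi|].
  2: { intros u _.
       assert (E1 : wE p q r e u 1 = wT p r q e u 0).
       { unfold wE, wT; rewrite seg_end; replace (1 - 1)%R with 0%R by ring.
         rewrite seg_start, Clog_e; f_equal; ring. }
       assert (E0 : wE p q r e u 0 = wT p q r e u 0).
       { unfold wE, wT; rewrite seg_start, Clog_e; replace (1 - 0)%R with 1%R by ring.
         rewrite seg_end; reflexivity. }
       rewrite E1, E0.
       replace k3 with (- k1 - k2)
         by (transitivity (k1 + k2 + k3 - k1 - k2); [rewrite Hk|]; ring).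
       ring. }
  rewrite CInt_minus; try (exact Hpi); try (apply contI_cmul, contI_VE).
  rewrite !CInt_mult_l by
    (lazymatch goal with
     | |- contI 1 _ => apply contI_WE
     | |- contI _ _ => apply contI_VE
     | |- _ => lra
     end).
  unfold WE, VE; fold (wE p q r e 0).
  change (fun x : R => wE p q r e 0 x) with (wE p q r e 0); ring.
Qed.

(** Here both pairs of opposite sides differ by a monodromy factor; the symmetry [wT_sym] brings all
    sides to the form [VE]. *)
Lemma stokes_T (s k1 k2 k3 p q r : C) : k1 + k2 + k3 = 0 ->
  CInt2 (2 * PI) (2 * PI) (DT s k1 k2 k3 p q r e) =
  (mono p - 1) * (s + k1) * VE q p r e + (mono q - 1) * (s + k2) * VE p q r e.
Proof.
  intros Hk; rewrite green_T by assumption.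
  assert (Hpi := two_PI_ge_0).
  rewrite (CInt_ext (2 * PI) (fun v => wT p q r e (2 * PI) v * _ * _)
    (fun v => mono p * (s + k1) * (wT q p r e v 0 * (Ci * circ e v)))); [|exact Hpi|].
  2: { intros v _; rewrite wT_2PI_l, cis_2PI, wT_sym; ring. }
  rewrite (CInt_ext (2 * PI) (fun v => wT p q r e 0 v * _ * _)
    (fun v => (s + k1) * (wT q p r e v 0 * (Ci * circ e v)))); [|exact Hpi|].
  2: { intros v _; rewrite cis_0, wT_sym; ring. }
  rewrite (CInt_ext (2 * PI) (fun u => _ - _)
    (fun u => (mono q - 1) * (s + k2) * (wT p q r e u 0 * (Ci * circ e u)))); [|exact Hpi|].
  2: { intros u _; rewrite wT_2PI_r, cis_2PI, cis_0; ring. }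
  rewrite !CInt_mult_l by
    (lazymatch goal with |- contI _ _ => apply contI_VE | |- _ => exact Hpi end).
  unfold VE; ring.
Qed.

Lemma stokes_S (s k1 k2 k3 p q r : C) : k1 + k2 + k3 = 0 ->
  CInt2 1 1 (DS s k1 k2 k3 p q r e) =
  - (1 - 3 * RtoC e) *
    ((s + k1) * WE p q r e + (s + k2) * WE q r p e + (s + k3) * WE r p q e).
Proof.
  intros Hk; rewrite green_S by assumption.
  (* The square parametrizes the triangle by collapsing the side [u = 1] to a vertex, so this side
     contributes 0. *)
  rewrite (CInt_ext 1 (fun v => wS p q r e 1 v * _ * _) (fun v => 0)); [|lra|].
  2: { intros v _; ring. }
  rewrite (CInt_ext 1 (fun v => wS p q r e 0 v * _ * _)
    (fun v => (1 - 3 * RtoC e) * (s + k1) * wE p q r e 0 v)); [|lra|].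
  2: { intros v Hv.
       assert (E : wS p q r e 0 v = wE p q r e 0 v).
       { unfold wS, wE; rewrite sig1_0, sig2_seg, Clog_e, seg_1_minus, circ_0.
         reflexivity. }
       rewrite E; ring. }
  rewrite (CInt_ext 1 (fun u => _ - _)
    (fun u => - (1 - 3 * RtoC e) * (s + k3) * wE r p q e 0 u -
      (1 - 3 * RtoC e) * (s + k2) * wE q r p e 0 (1 - u)%R)); [|lra|].
  2: { intros u Hu.
       assert (E1 : wS p q r e u 1 = wE r p q e 0 u).
       { unfold wS, wE; rewrite sig1_seg, sig2_end.
         replace (1 - seg e 0 u - seg e 0 (1 - u)) with (RtoC e)
           by (rewrite seg_1_minus, circ_0; ring).
         rewrite Clog_e; f_equal; ring. }
       assert (E0 : wS p q r e u 0 = wE q r p e 0 (1 - u)).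
       { unfold wS, wE; rewrite sig1_seg, sig2_start, Clog_e.
         replace (1 - (1 - u))%R with u by ring.
         replace (1 - seg e 0 u - RtoC e) with (seg e 0 (1 - u))
           by (rewrite seg_1_minus, circ_0; ring).
         f_equal; ring. }
       rewrite E1, E0.
       replace k3 with (- k1 - k2)
         by (transitivity (k1 + k2 + k3 - k1 - k2); [rewrite Hk|]; ring).
       ring. }
  assert (Hrev : contI 1 (fun u => wE q r p e 0 (1 - u)%R)).
  { apply contI_of_cont; [lra|]; intros v Hv.
    unfold wE; cont_auto; cbn [fst snd]; try apply Re_seg_pos; try lra. }
  rewrite CInt_minus; try lra; try apply contI_cmul; try assumption; try apply contI_WE.
  rewrite !CInt_mult_l; try lra; try assumption; try apply contI_WE.
  rewrite CInt_zero by lra.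
  (* The side [v = 0] runs against the cyclic convention, under which the edge [z2 = e] is directed
     by increasing [z3]. *)
  rewrite (CInt_rev (wE q r p e 0)) by apply contI_WE.
  unfold WE.
  change (fun x : R => wE p q r e 0 x) with (wE p q r e 0).
  change (fun x : R => wE r p q e 0 x) with (wE r p q e 0).
  ring.
Qed.

(** The boundary terms of the seven cells cancel: the chain is a twisted cycle. *)
Lemma stokes_total (s k1 k2 k3 p1 p2 p3 : C) :
  k1 + k2 + k3 = 0 -> mono p1 <> 1 -> mono p2 <> 1 -> mono p3 <> 1 ->
  let d p := / (mono p - 1) in
  CInt2 1 1 (DS s k1 k2 k3 p1 p2 p3 e) +
  (d p1 * CInt2 (2 * PI) 1 (DE s k1 k2 k3 p1 p2 p3 e) +
   d p2 * CInt2 (2 * PI) 1 (DE s k2 k3 k1 p2 p3 p1 e) +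
   d p3 * CInt2 (2 * PI) 1 (DE s k3 k1 k2 p3 p1 p2 e)) +
  (d p1 * d p2 * CInt2 (2 * PI) (2 * PI) (DT s k1 k2 k3 p1 p2 p3 e) +
   d p2 * d p3 * CInt2 (2 * PI) (2 * PI) (DT s k2 k3 k1 p2 p3 p1 e) +
   d p3 * d p1 * CInt2 (2 * PI) (2 * PI) (DT s k3 k1 k2 p3 p1 p2 e)) = 0.
Proof.
  intros Hk H1 H2 H3 d; unfold d.
  assert (N1 : mono p1 - 1 <> 0) by (intros E; apply H1; rewrite <- (Cplus_0_l 1), <- E; ring).
  assert (N2 : mono p2 - 1 <> 0) by (intros E; apply H2; rewrite <- (Cplus_0_l 1), <- E; ring).
  assert (N3 : mono p3 - 1 <> 0) by (intros E; apply H3; rewrite <- (Cplus_0_l 1), <- E; ring).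
  rewrite stokes_S, !stokes_E, !stokes_T; try (rewrite <- Hk; ring).
  field; auto.
Qed.

End Fixed.

(** * Contiguity relations and independence of the radius *)

Lemma Cexp_shift (z l w : C) : Cexp l = w -> Cexp (z + l) = w * Cexp z.
Proof. intros <-; rewrite Cexp_plus; ring. Qed.

Section Shift.

Variable e : R.
Hypothesis He : (0 < e < 1 / 3)%R.
Variables p q r : C.

Lemma wE_shift (u v : R) : (0 <= v <= 1)%R ->
  wE p q r e u v = circ e u * wE (p - 1) q r e u v /\
  wE p q r e u v = seg e u v * wE p (q - 1) r e u v /\
  wE p q r e u v = seg e u (1 - v) * wE p q (r - 1) e u v.
Proof.
  intros Hv; unfold wE; repeat split.
  - rewrite <- (Cexp_shift _ (lcirc e u)) by (apply Cexp_lcirc; lra); f_equal; ring.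
  - rewrite <- (Cexp_shift _ (Clog (seg e u v))) by (apply Cexp_Clog_pos, Re_seg_pos; lra).
    f_equal; ring.
  - rewrite <- (Cexp_shift _ (Clog (seg e u (1 - v)))) by (apply Cexp_Clog_pos, Re_seg_pos; lra).
    f_equal; ring.
Qed.

Lemma wT_shift (u v : R) :
  wT p q r e u v = circ e u * wT (p - 1) q r e u v /\
  wT p q r e u v = circ e v * wT p (q - 1) r e u v /\
  wT p q r e u v = third e u v * wT p q (r - 1) e u v.
Proof.
  unfold wT; repeat split.
  - rewrite <- (Cexp_shift _ (lcirc e u)) by (apply Cexp_lcirc; lra); f_equal; ring.
  - rewrite <- (Cexp_shift _ (lcirc e v)) by (apply Cexp_lcirc; lra); f_equal; ring.
  - rewrite <- (Cexp_shift _ (Clog (third e u v))) by (apply Cexp_Clog_pos, Re_third_pos; lra).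
    f_equal; ring.
Qed.

Lemma wS_shift (u v : R) : (0 <= u <= 1)%R -> (0 <= v <= 1)%R ->
  wS p q r e u v = sig1 e u * wS (p - 1) q r e u v /\
  wS p q r e u v = sig2 e u v * wS p (q - 1) r e u v /\
  wS p q r e u v = (1 - sig1 e u - sig2 e u v) * wS p q (r - 1) e u v.
Proof.
  intros Hu Hv; destruct (Re_sig_pos e He u v) as (S1 & S2 & S3); [lra | exact Hv|].
  apply Cexp_Clog_pos in S1, S2, S3.
  unfold wS; repeat split.
  - rewrite <- (Cexp_shift _ (Clog (sig1 e u))) by exact S1; f_equal; ring.
  - rewrite <- (Cexp_shift _ (Clog (sig2 e u v))) by exact S2; f_equal; ring.
  - rewrite <- (Cexp_shift _ (Clog (1 - sig1 e u - sig2 e u v))) by exact S3; f_equal; ring.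
Qed.

Lemma CInt2_three (a b : R) (c1 c2 c3 : C) (f1 f2 f3 : R -> R -> C) :
  (0 <= a)%R -> (0 <= b)%R -> cont2 a b f1 -> cont2 a b f2 -> cont2 a b f3 ->
  CInt2 a b (fun u v => c1 * f1 u v + c2 * f2 u v + c3 * f3 u v) =
  c1 * CInt2 a b f1 + c2 * CInt2 a b f2 + c3 * CInt2 a b f3.
Proof.
  intros Ha Hb H1 H2 H3.
  assert (M : forall c f, cont2 a b f -> cont2 a b (fun u v => c * f u v)).
  { intros c f Hf; apply cont2_mult; [apply cont2_const | exact Hf]. }
  rewrite !CInt2_plus, !CInt2_mult_l; auto.
  apply cont2_plus; auto.
Qed.

(** With [s = 0] only the weight is differentiated, and dividing the weight by a linear form lowers
    the corresponding exponent by 1. *)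
Lemma DE_const (k1 k2 k3 : C) :
  CInt2 (2 * PI) 1 (DE 0 k1 k2 k3 p q r e) =
  p * k1 * IE (p - 1) q r e + q * k2 * IE p (q - 1) r e + r * k3 * IE p q (r - 1) e.
Proof.
  assert (Hpi := two_PI_ge_0).
  unfold IE; rewrite <- CInt2_three; try apply cont2_E; try lra.
  apply CInt2_ext; try lra; intros u v _ Hv.
  destruct (wE_shift u v Hv) as (E1 & E2 & E3).
  assert (N1 := circ_neq_0 e u (ltac:(lra))).
  assert (N2 : seg e u v <> 0) by (apply neq_0_Re_pos, Re_seg_pos; lra).
  assert (N3 : seg e u (1 - v) <> 0) by (apply neq_0_Re_pos, Re_seg_pos; lra).
  unfold DE.
  replace (wE (p - 1) q r e u v) with (wE p q r e u v / circ e u) by (rewrite E1; field; auto).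
  replace (wE p (q - 1) r e u v) with (wE p q r e u v / seg e u v) by (rewrite E2; field; auto).
  replace (wE p q (r - 1) e u v) with (wE p q r e u v / seg e u (1 - v))
    by (rewrite E3; field; auto).
  field; auto.
Qed.

Lemma DT_const (k1 k2 k3 : C) :
  CInt2 (2 * PI) (2 * PI) (DT 0 k1 k2 k3 p q r e) =
  p * k1 * IT (p - 1) q r e + q * k2 * IT p (q - 1) r e + r * k3 * IT p q (r - 1) e.
Proof.
  assert (Hpi := two_PI_ge_0).
  unfold IT; rewrite <- CInt2_three; try apply cont2_T; try lra.
  apply CInt2_ext; try lra; intros u v _ _.
  destruct (wT_shift u v) as (E1 & E2 & E3).
  assert (N1 := circ_neq_0 e u (ltac:(lra))).
  assert (N2 := circ_neq_0 e v (ltac:(lra))).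
  assert (N3 : third e u v <> 0) by (apply neq_0_Re_pos, Re_third_pos; lra).
  unfold DT.
  replace (wT (p - 1) q r e u v) with (wT p q r e u v / circ e u) by (rewrite E1; field; auto).
  replace (wT p (q - 1) r e u v) with (wT p q r e u v / circ e v) by (rewrite E2; field; auto).
  replace (wT p q (r - 1) e u v) with (wT p q r e u v / third e u v)
    by (rewrite E3; field; auto).
  field; auto.
Qed.

Lemma DS_const (k1 k2 k3 : C) :
  CInt2 1 1 (DS 0 k1 k2 k3 p q r e) =
  p * k1 * IS (p - 1) q r e + q * k2 * IS p (q - 1) r e + r * k3 * IS p q (r - 1) e.
Proof.
  unfold IS; rewrite <- CInt2_three; try apply cont2_S; try lra.
  apply CInt2_ext; try lra; intros u v Hu Hv.
  destruct (wS_shift u v Hu Hv) as (E1 & E2 & E3).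
  destruct (Re_sig_pos e He u v) as (N1 & N2 & N3); [lra | exact Hv|].
  apply neq_0_Re_pos in N1, N2, N3.
  unfold DS.
  replace (wS (p - 1) q r e u v) with (wS p q r e u v / sig1 e u) by (rewrite E1; field; auto).
  replace (wS p (q - 1) r e u v) with (wS p q r e u v / sig2 e u v) by (rewrite E2; field; auto).
  replace (wS p q (r - 1) e u v) with (wS p q r e u v / (1 - sig1 e u - sig2 e u v))
    by (rewrite E3; field; auto).
  field; auto.
Qed.

End Shift.

Lemma succ_pred (p : C) : p + 1 - 1 = p.
Proof. ring. Qed.

Lemma CInt2_three1 (a b : R) (f f1 f2 f3 : R -> R -> C) :
  (0 <= a)%R -> (0 <= b)%R -> cont2 a b f1 -> cont2 a b f2 -> cont2 a b f3 ->
  (forall u v, (0 <= u <= a)%R -> (0 <= v <= b)%R -> f u v = f1 u v + f2 u v + f3 u v) ->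
  CInt2 a b f = CInt2 a b f1 + CInt2 a b f2 + CInt2 a b f3.
Proof.
  intros Ha Hb H1 H2 H3 E; rewrite (CInt2_ext a b Ha Hb _ _ E).
  rewrite !CInt2_plus; auto; apply cont2_plus; auto.
Qed.

(** From [z1 + z2 + z3 = 1]. *)
Lemma Dreg_sum (p1 p2 p3 : C) (e : R) : (0 < e < 1 / 3)%R ->
  Dreg p1 p2 p3 e = Dreg (p1 + 1) p2 p3 e + Dreg p1 (p2 + 1) p3 e + Dreg p1 p2 (p3 + 1) e.
Proof.
  intros He; assert (Hpi := two_PI_ge_0).
  assert (SE : forall p q r, IE p q r e = IE (p + 1) q r e + IE p (q + 1) r e + IE p q (r + 1) e).
  { intros p q r; apply CInt2_three1; try apply cont2_E; try lra; intros u v _ Hv.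
    destruct (wE_shift e He (p + 1) q r u v Hv) as (-> & _).
    destruct (wE_shift e He p (q + 1) r u v Hv) as (_ & -> & _).
    destruct (wE_shift e He p q (r + 1) u v Hv) as (_ & _ & ->).
    rewrite !succ_pred, seg_1_minus; ring. }
  assert (ST : forall p q r, IT p q r e = IT (p + 1) q r e + IT p (q + 1) r e + IT p q (r + 1) e).
  { intros p q r; apply CInt2_three1; try apply cont2_T; try lra; intros u v _ Hv.
    destruct (wT_shift e He (p + 1) q r u v) as (-> & _).
    destruct (wT_shift e He p (q + 1) r u v) as (_ & -> & _).
    destruct (wT_shift e He p q (r + 1) u v) as (_ & _ & ->).
    rewrite !succ_pred; unfold third; ring. }
  assert (SS : forall p q r, IS p q r e = IS (p + 1) q r e + IS p (q + 1) r e + IS p q (r + 1) e).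
  { intros p q r; apply CInt2_three1; try apply cont2_S; try lra; intros u v Hu Hv.
    destruct (wS_shift e He (p + 1) q r u v Hu Hv) as (-> & _).
    destruct (wS_shift e He p (q + 1) r u v Hu Hv) as (_ & -> & _).
    destruct (wS_shift e He p q (r + 1) u v Hu Hv) as (_ & _ & ->).
    rewrite !succ_pred; ring. }
  unfold Dreg; rewrite !mono_shift, (SS p1 p2 p3), (SE p1 p2 p3), (SE p2 p3 p1), (SE p3 p1 p2),
    (ST p1 p2 p3), (ST p2 p3 p1), (ST p3 p1 p2); ring.
Qed.

Lemma mono_pred (p : C) : mono (p - 1) = mono p.
Proof. rewrite <- (mono_shift (p - 1)); f_equal; ring. Qed.

(** Lowering an exponent by 1 leaves its monodromy unchanged, so the shifted integrals recombine
    with the same chain coefficients. *)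
Lemma Dreg_stokes (k1 k2 k3 p1 p2 p3 : C) (e : R) : (0 < e < 1 / 3)%R ->
  k1 + k2 + k3 = 0 -> mono p1 <> 1 -> mono p2 <> 1 -> mono p3 <> 1 ->
  p1 * k1 * Dreg (p1 - 1) p2 p3 e + p2 * k2 * Dreg p1 (p2 - 1) p3 e +
  p3 * k3 * Dreg p1 p2 (p3 - 1) e = 0.
Proof.
  intros He Hk H1 H2 H3.
  generalize (stokes_total e He 0 k1 k2 k3 p1 p2 p3 Hk H1 H2 H3); cbv zeta.
  rewrite DS_const, !DE_const, !DT_const by assumption.
  intros E; rewrite <- E; unfold Dreg; rewrite !mono_pred; ring.
Qed.

Section Contiguity.

Variables (p1 p2 p3 : C) (e : R).
Hypotheses (He : (0 < e < 1 / 3)%R)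
  (H1 : mono p1 <> 1) (H2 : mono p2 <> 1) (H3 : mono p3 <> 1).

(** The field [(1, -1, 0)] at the raised exponents [p1 + 1], [p2 + 1]; the two lemmas that follow
    use the other pairs of coordinates. *)
Lemma Dreg_12 : (p1 + 1) * Dreg p1 (p2 + 1) p3 e = (p2 + 1) * Dreg (p1 + 1) p2 p3 e.
Proof.
  generalize (Dreg_stokes 1 (-(1)) 0 (p1 + 1) (p2 + 1) p3 e He (ltac:(ring))).
  rewrite !mono_shift; intros E; specialize (E H1 H2 H3).
  rewrite !succ_pred in E.
  transitivity ((p1 + 1) * Dreg p1 (p2 + 1) p3 e - 0); [ring|]; rewrite <- E; ring.
Qed.

Lemma Dreg_13 : (p1 + 1) * Dreg p1 p2 (p3 + 1) e = (p3 + 1) * Dreg (p1 + 1) p2 p3 e.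
Proof.
  generalize (Dreg_stokes 1 0 (-(1)) (p1 + 1) p2 (p3 + 1) e He (ltac:(ring))).
  rewrite !mono_shift; intros E; specialize (E H1 H2 H3).
  rewrite !succ_pred in E.
  transitivity ((p1 + 1) * Dreg p1 p2 (p3 + 1) e - 0); [ring|]; rewrite <- E; ring.
Qed.

Lemma Dreg_23 : (p2 + 1) * Dreg p1 p2 (p3 + 1) e = (p3 + 1) * Dreg p1 (p2 + 1) p3 e.
Proof.
  generalize (Dreg_stokes 0 1 (-(1)) p1 (p2 + 1) (p3 + 1) e He (ltac:(ring))).
  rewrite !mono_shift; intros E; specialize (E H1 H2 H3).
  rewrite !succ_pred in E.
  transitivity ((p2 + 1) * Dreg p1 p2 (p3 + 1) e - 0); [ring|]; rewrite <- E; ring.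
Qed.

(** Multiplied by [p1 + 1], each of the three terms of [Dreg_sum] becomes a multiple of
    [Dreg (p1 + 1) p2 p3], and the multipliers [p1 + 1], [p2 + 1], [p3 + 1] add up. *)
Lemma Dreg_up1 : (p1 + p2 + p3 + 3) * Dreg (p1 + 1) p2 p3 e = (p1 + 1) * Dreg p1 p2 p3 e.
Proof.
  rewrite (Dreg_sum p1 p2 p3 e He), !Cmult_plus_distr_l, Dreg_12, Dreg_13; ring.
Qed.

Lemma Dreg_up2 : (p1 + p2 + p3 + 3) * Dreg p1 (p2 + 1) p3 e = (p2 + 1) * Dreg p1 p2 p3 e.
Proof.
  rewrite (Dreg_sum p1 p2 p3 e He), !Cmult_plus_distr_l, <- Dreg_12, Dreg_23; ring.
Qed.

Lemma Dreg_up3 : (p1 + p2 + p3 + 3) * Dreg p1 p2 (p3 + 1) e = (p3 + 1) * Dreg p1 p2 p3 e.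
Proof.
  rewrite (Dreg_sum p1 p2 p3 e He), !Cmult_plus_distr_l, <- Dreg_13, <- Dreg_23; ring.
Qed.

End Contiguity.

(** * Differentiation with respect to the radius *)

Lemma der_IE (p q r : C) (e : R) : (0 < e < 1 / 3)%R ->
  der (IE p q r) e (CInt2 (2 * PI) 1 (DE 1 0 0 0 p q r e)).
Proof.
  intros He.
  apply (der_CInt2 (2 * PI) 1 two_PI_ge_0 Rle_0_1 0 (1 / 3) e
    (fun e u v => wE p q r e u v * JE e u) (DE 1 0 0 0 p q r)); [exact He| | |].
  - intros t u v Ht _ Hv.
    assert (S1 : (0 < Re (seg t u v))%R) by (apply Re_seg_pos; lra).
    assert (S2 : (0 < Re (seg t u (1 - v)))%R) by (apply Re_seg_pos; lra).
    assert (N := cis_neq_0 u); assert (Nt : RtoC t <> 0) by (apply RtoC_neq_0; lra).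
    unfold wE, JE; eapply der_eq; [der_auto; auto; lra|]; unfold DE, wE, JE.
    rewrite RtoC_minus, circ_cis; field; repeat split; auto; apply neq_0_Re_pos; auto.
  - intros t u v Ht _ Hv.
    assert (S1 : (0 < Re (seg t u v))%R) by (apply Re_seg_pos; lra).
    assert (S2 : (0 < Re (seg t u (1 - v)))%R) by (apply Re_seg_pos; lra).
    unfold wE, JE; cont_auto; cont_side.
  - intros t u v Ht _ Hv.
    assert (S1 : (0 < Re (seg t u v))%R) by (apply Re_seg_pos; lra).
    assert (S2 : (0 < Re (seg t u (1 - v)))%R) by (apply Re_seg_pos; lra).
    assert (N := circ_neq_0 t u (ltac:(lra))).
    unfold DE, wE, JE; cont_auto; cont_side.
Qed.

Lemma der_IT (p q r : C) (e : R) : (0 < e < 1 / 3)%R ->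
  der (IT p q r) e (CInt2 (2 * PI) (2 * PI) (DT 1 0 0 0 p q r e)).
Proof.
  intros He.
  apply (der_CInt2 (2 * PI) (2 * PI) two_PI_ge_0 two_PI_ge_0 0 (1 / 3) e
    (fun e u v => wT p q r e u v * JT e u v) (DT 1 0 0 0 p q r)); [exact He| | |].
  - intros t u v Ht _ _.
    assert (S1 : (0 < Re (third t u v))%R) by (apply Re_third_pos; lra).
    assert (Nu := cis_neq_0 u); assert (Nv := cis_neq_0 v).
    assert (Nt : RtoC t <> 0) by (apply RtoC_neq_0; lra).
    unfold wT, JT; eapply der_eq; [der_auto; auto; lra|]; unfold DT, wT, JT.
    rewrite !circ_cis; field; repeat split; auto; apply neq_0_Re_pos; auto.
  - intros t u v Ht _ _.
    assert (S1 : (0 < Re (third t u v))%R) by (apply Re_third_pos; lra).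
    unfold wT, JT; cont_auto; cont_side.
  - intros t u v Ht _ _.
    assert (S1 : (0 < Re (third t u v))%R) by (apply Re_third_pos; lra).
    assert (N1 := circ_neq_0 t u (ltac:(lra))); assert (N2 := circ_neq_0 t v (ltac:(lra))).
    unfold DT, wT, JT; cont_auto; cont_side.
Qed.

Lemma der_IS (p q r : C) (e : R) : (0 < e < 1 / 3)%R ->
  der (IS p q r) e (CInt2 1 1 (DS 1 0 0 0 p q r e)).
Proof.
  intros He.
  apply (der_CInt2 1 1 Rle_0_1 Rle_0_1 0 (1 / 3) e
    (fun e u v => wS p q r e u v * JS e u) (DS 1 0 0 0 p q r)); [exact He| | |].
  - intros t u v Ht Hu Hv.
    destruct (Re_sig_pos t Ht u v) as (S1 & S2 & S3); [lra | exact Hv|].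
    unfold wS, JS; eapply der_eq; [der_auto; auto|]; unfold DS, wS, JS.
    field; repeat split; apply neq_0_Re_pos; auto.
  - intros t u v Ht Hu Hv.
    destruct (Re_sig_pos t Ht u v) as (S1 & S2 & S3); [lra | exact Hv|].
    unfold wS, JS; cont_auto; cont_side.
  - intros t u v Ht Hu Hv.
    destruct (Re_sig_pos t Ht u v) as (S1 & S2 & S3); [lra | exact Hv|].
    unfold DS, wS, JS; cont_auto; cont_side.
Qed.

Lemma der_zero_const (lo hi : R) (f : R -> C) :
  (forall t, (lo < t < hi)%R -> der f t 0) ->
  forall a b, (lo < a < hi)%R -> (lo < b < hi)%R -> f a = f b.
Proof.
  intros Hf.
  assert (H : forall a b, (lo < a < hi)%R -> (lo < b < hi)%R -> (a < b)%R -> f a = f b).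
  { intros a b Ha Hb Hab; apply C_ext.
    - apply (eq_is_derive (V := R_NormedModule) (fun t => Re (f t)));
        [intros t Ht; apply Hf; lra | exact Hab].
    - apply (eq_is_derive (V := R_NormedModule) (fun t => Im (f t)));
        [intros t Ht; apply Hf; lra | exact Hab]. }
  intros a b Ha Hb; destruct (Rtotal_order a b) as [L|[<-|L]]; [apply H | | symmetry; apply H];
    auto.
Qed.

(** The derivative is the total of [stokes_total] for the field [d/de] alone, that is [s = 1] and
    [k = 0]; the chain coefficients do not depend on [e]. *)
Lemma Dreg_radius (p1 p2 p3 : C) (e e' : R) :
  (0 < e < 1 / 3)%R -> (0 < e' < 1 / 3)%R -> mono p1 <> 1 -> mono p2 <> 1 -> mono p3 <> 1 ->
  Dreg p1 p2 p3 e = Dreg p1 p2 p3 e'.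
Proof.
  intros He He' H1 H2 H3.
  apply (der_zero_const 0 (1 / 3) (Dreg p1 p2 p3)); try assumption.
  intros t Ht.
  eapply der_eq; [|apply (stokes_total t Ht 1 0 0 0 p1 p2 p3); auto; ring].
  cbv zeta; eapply der_eq.
  - unfold Dreg.
    repeat lazymatch goal with
    | |- der (fun s => @?f s + @?g s) _ _ => apply (der_plus f g)
    | |- der (fun s => @?f s * @?g s) _ _ => apply (der_mult f g)
    | |- der (fun s => IE _ _ _ s) _ _ => apply der_IE, Ht
    | |- der (fun s => IT _ _ _ s) _ _ => apply der_IT, Ht
    | |- der (fun s => IS _ _ _ s) _ _ => apply der_IS, Ht
    | |- der (fun _ => ?c) _ _ => apply (der_const c)
    end.
  - ring.
Qed.

(** * The limit of vanishing radius *)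

(** The value 0 for [t <= 0] makes [t^p] differentiable on [R] when [Re p >= 2]. *)
Definition pw (p : C) (t : R) : C :=
  if Rle_dec t 0 then 0 else Cexp (p * RtoC (ln t)).

Lemma pw_pos (p : C) (t : R) : (0 < t)%R -> pw p t = Cexp (p * RtoC (ln t)).
Proof. intros Ht; unfold pw; destruct (Rle_dec t 0); [lra | reflexivity]. Qed.

Lemma pw_neg (p : C) (t : R) : (t <= 0)%R -> pw p t = 0.
Proof. intros Ht; unfold pw; destruct (Rle_dec t 0); [reflexivity | lra]. Qed.

Lemma pw_Clog (p : C) (t : R) : (0 < t)%R -> pw p t = Cexp (p * Clog (RtoC t)).
Proof. intros Ht; rewrite Clog_RtoC, pw_pos by exact Ht; reflexivity. Qed.

Lemma pw_mult (p : C) (s t : R) : (0 <= s)%R -> (0 <= t)%R -> pw p (s * t) = pw p s * pw p t.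
Proof.
  intros [Hs|<-] [Ht|<-].
  - rewrite !pw_pos, ln_mult, RtoC_plus, Cmult_plus_distr_l by nra; apply Cexp_plus.
  - rewrite Rmult_0_r, pw_neg by lra; ring.
  - rewrite Rmult_0_l, pw_neg by lra; ring.
  - rewrite Rmult_0_l, pw_neg by lra; ring.
Qed.

Lemma pw_plus (p q : C) (t : R) : pw (p + q) t = pw p t * pw q t.
Proof.
  destruct (Rle_dec t 0) as [H|H].
  - rewrite !pw_neg by exact H; ring.
  - rewrite !pw_pos by lra; rewrite <- Cexp_plus; f_equal; ring.
Qed.

Lemma pw_1 (t : R) : (0 <= t)%R -> pw 1 t = RtoC t.
Proof.
  intros [H|<-]; [|rewrite pw_neg by lra; reflexivity].
  rewrite pw_Clog, Cmult_1_l by exact H; apply Cexp_Clog_pos; exact H.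
Qed.

Lemma pw_succ (p : C) (t : R) : (0 <= t)%R -> pw (p + 1) t = pw p t * RtoC t.
Proof. intros H; rewrite pw_plus, pw_1 by exact H; reflexivity. Qed.

Lemma pw_at_1 (p : C) : pw p 1 = 1.
Proof. rewrite pw_pos, ln_1, Cmult_0_r by lra; apply Cexp_0. Qed.

Lemma Cmod_pw (p : C) (t : R) : (0 < t)%R -> Cmod (pw p t) = exp (Re p * ln t).
Proof.
  intros H; rewrite pw_pos, Cmod_Cexp by exact H; f_equal; destruct p; simpl; ring.
Qed.

(** With this, the majorant of a Beta integrand is again a Beta integrand, with real exponents. *)
Lemma Cmod_pw_real (p : C) (t : R) : RtoC (Cmod (pw p t)) = pw (RtoC (Re p)) t.
Proof.
  destruct (Rle_dec t 0) as [H|H].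
  - rewrite !pw_neg by exact H; rewrite Cmod_0; reflexivity.
  - rewrite Cmod_pw, pw_pos by lra; unfold Cexp, RtoC; simpl.
    replace (Re p * 0 + 0 * ln t)%R with 0%R by ring; rewrite cos_0, sin_0.
    apply C_ext; simpl; [f_equal|]; ring_simplify; try reflexivity.
    f_equal; ring.
Qed.

Lemma ln_le_0 (t : R) : (0 < t <= 1)%R -> (ln t <= 0)%R.
Proof. intros H; rewrite <- ln_1; apply ln_le; lra. Qed.

Lemma Cmod_pw_le (p : C) (n : nat) (t : R) :
  (INR n <= Re p)%R -> (0 <= t <= 1)%R -> (Cmod (pw p t) <= t ^ n)%R.
Proof.
  intros Hp [[H|<-] H1].
  - rewrite Cmod_pw by exact H.
    assert (L := ln_le_0 t (conj H H1)).
    rewrite <- Rpower_pow by exact H; unfold Rpower.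
    destruct (Req_dec (Re p * ln t) (INR n * ln t)) as [->|N]; [lra|].
    left; apply exp_increasing; nra.
  - rewrite pw_neg, Cmod_0 by lra; apply pow_le; lra.
Qed.

Lemma Cmod_pw_le_1 (p : C) (t : R) : (0 <= Re p)%R -> (t <= 1)%R -> (Cmod (pw p t) <= 1)%R.
Proof.
  intros Hp H1; destruct (Rle_dec t 0) as [H|H].
  - rewrite pw_neg, Cmod_0 by exact H; lra.
  - apply (Cmod_pw_le p 0 t); simpl; lra.
Qed.

Lemma der_ext_loc (f g : R -> C) (t : R) (l : C) :
  locally t (fun s => f s = g s) -> der f t l -> der g t l.
Proof.
  intros E [H1 H2]; split.
  - eapply is_derive_ext_loc; [|exact H1]; revert E; apply filter_imp; intros s ->; reflexivity.
  - eapply is_derive_ext_loc; [|exact H2]; revert E; apply filter_imp; intros s ->; reflexivity.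
Qed.

Lemma is_derive_0_square (f : R -> R) :
  f 0%R = 0%R -> (forall h, (Rabs h <= 1)%R -> (Rabs (f h) <= h ^ 2)%R) -> is_derive f 0 0%R.
Proof.
  intros H0 Hf; apply is_derive_Reals; intros eps Heps.
  assert (Hd : (0 < Rmin eps 1)%R) by (apply Rmin_pos; lra).
  exists (mkposreal _ Hd); intros h Hh Hlt; simpl in Hlt.
  assert (Rabs h < eps /\ Rabs h < 1)%R as [L1 L2].
  { split; eapply Rlt_le_trans; try exact Hlt; [apply Rmin_l | apply Rmin_r]. }
  rewrite Rplus_0_l, H0, !Rminus_0_r.
  unfold Rdiv; rewrite Rabs_mult, Rabs_inv.
  assert (P : (0 < Rabs h)%R) by (apply Rabs_pos_lt; exact Hh).
  eapply Rle_lt_trans; [|exact L1].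
  apply (Rmult_le_reg_r (Rabs h)); [exact P|].
  rewrite Rmult_assoc, Rinv_l, Rmult_1_r by lra.
  eapply Rle_trans; [apply Hf; lra|].
  rewrite <- pow2_abs; right; ring.
Qed.

(** Away from 0 this is the chain rule; at 0 the bound [|t^p| <= t^2] forces the derivative to
    vanish. *)
Lemma der_pw (p : C) (t : R) : (2 <= Re p)%R -> der (pw p) t (p * pw (p - 1) t).
Proof.
  intros Hp; destruct (Rtotal_order t 0) as [L|[->|G]].
  - apply (der_ext_loc (fun _ => 0)).
    { generalize (open_lt 0 t L); apply filter_imp; intros s Hs; rewrite pw_neg by lra; reflexivity. }
    rewrite pw_neg by lra; eapply der_eq; [apply der_const | ring].
  - rewrite (pw_neg (p - 1)), Cmult_0_r by lra.
    assert (B : forall h, (Rabs h <= 1)%R -> (Cmod (pw p h) <= h ^ 2)%R).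
    { intros h Hh; apply Rabs_le_between in Hh; destruct (Rle_dec h 0) as [N|N].
      - rewrite pw_neg, Cmod_0 by exact N; nra.
      - apply Cmod_pw_le; simpl; lra. }
    split; apply is_derive_0_square.
    + rewrite pw_neg by lra; reflexivity.
    + intros h Hh; eapply Rle_trans; [apply re_le_Cmod | apply B, Hh].
    + rewrite pw_neg by lra; reflexivity.
    + intros h Hh; eapply Rle_trans; [apply im_le_Cmod | apply B, Hh].
  - apply (der_ext_loc (fun s => Cexp (p * RtoC (ln s)))).
    { generalize (open_gt 0 t G); apply filter_imp; intros s Hs; rewrite pw_pos by lra; reflexivity. }
    eapply der_eq.
    + apply (der_Cexp (fun s => p * RtoC (ln s))), (der_mult (fun _ => p) (fun s => RtoC (ln s)));
        [apply der_const | apply der_RtoC, is_derive_Reals, derivable_pt_lim_ln, G].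
    + rewrite <- (pw_pos p t G).
      assert (E : pw p t = pw (p - 1) t * RtoC t)
        by (rewrite <- pw_succ by lra; f_equal; ring).
      rewrite E, RtoC_inv by lra; field; apply RtoC_neq_0; lra.
Qed.

Lemma cont_pw (p : C) (t : R) : (2 <= Re p)%R -> cont (pw p) t.
Proof. intros Hp; eapply der_cont, der_pw, Hp. Qed.

Lemma is_derive_Lipschitz (f f' : R -> R) (M s t : R) :
  (forall x, (0 <= x <= 1)%R -> is_derive f x (f' x)) ->
  (forall x, (0 <= x <= 1)%R -> (Rabs (f' x) <= M)%R) ->
  (0 <= s <= 1)%R -> (0 <= t <= 1)%R -> (Rabs (f s - f t) <= M * Rabs (s - t))%R.
Proof.
  intros Hd HM Hs Ht.
  assert (Hmin : (0 <= Rmin t s)%R) by (apply Rmin_glb; lra).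
  assert (Hmax : (Rmax t s <= 1)%R) by (apply Rmax_lub; lra).
  destruct (MVT_gen f t s f') as (c & Hc & ->).
  - intros x Hx; apply Hd; lra.
  - intros x Hx; apply continuity_pt_filterlim.
    apply (ex_derive_continuous (V := R_NormedModule)); eexists; apply Hd; lra.
  - rewrite Rabs_mult; apply Rmult_le_compat_r; [apply Rabs_pos | apply HM; lra].
Qed.

(** The derivative [p t^(p-1)] is bounded by [|p|] on [[0, 1]]; the mean value theorem applies to
    each component, and the factor 2 accounts for adding the two. *)
Lemma pw_Lipschitz (p : C) (s t : R) : (2 <= Re p)%R -> (0 <= s <= 1)%R -> (0 <= t <= 1)%R ->
  (Cmod (pw p s - pw p t) <= 2 * Cmod p * Rabs (s - t))%R.
Proof.
  intros Hp Hs Ht.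
  assert (B : forall x, (0 <= x <= 1)%R -> (Cmod (p * pw (p - 1) x) <= Cmod p)%R).
  { intros x Hx; rewrite Cmod_mult.
    assert (Cmod (pw (p - 1) x) <= 1)%R
      by (apply Cmod_pw_le_1; [destruct p; simpl in *; lra | lra]).
    generalize (Cmod_ge_0 p); nra. }
  assert (B1 : (Rabs (Re (pw p s) - Re (pw p t)) <= Cmod p * Rabs (s - t))%R).
  { apply (is_derive_Lipschitz (fun x => Re (pw p x)) (fun x => Re (p * pw (p - 1) x)));
      try assumption; intros x Hx; [apply (der_pw p x Hp)|].
    eapply Rle_trans; [apply re_le_Cmod | apply B, Hx]. }
  assert (B2 : (Rabs (Im (pw p s) - Im (pw p t)) <= Cmod p * Rabs (s - t))%R).
  { apply (is_derive_Lipschitz (fun x => Im (pw p x)) (fun x => Im (p * pw (p - 1) x)));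
      try assumption; intros x Hx; [apply (der_pw p x Hp)|].
    eapply Rle_trans; [apply im_le_Cmod | apply B, Hx]. }
  eapply Rle_trans; [apply Cmod_le_abs|].
  change (Rabs (Re (pw p s) - Re (pw p t)) + Rabs (Im (pw p s) - Im (pw p t)) <=
    2 * Cmod p * Rabs (s - t))%R; lra.
Qed.

Lemma Rabs_Carg (z : C) : (Rabs (Carg z) <= PI)%R.
Proof.
  unfold Carg; apply Rabs_le; generalize (atan_bound (Im z / (Cmod z + Re z))); lra.
Qed.

Lemma Re_mult_le (p l : C) (B : R) : (Rabs (Im l) <= B)%R ->
  (Re (p * l) <= Re p * Re l + Rabs (Im p) * B)%R.
Proof.
  intros H; rewrite Re_mult.
  assert (- (Im p * Im l) <= Rabs (Im p) * Rabs (Im l))%R.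
  { rewrite <- Rabs_mult, <- Rabs_Ropp; apply Rle_abs. }
  assert (Rabs (Im p) * Rabs (Im l) <= Rabs (Im p) * B)%R
    by (apply Rmult_le_compat_l; [apply Rabs_pos | exact H]).
  lra.
Qed.

Lemma ln_le_id (x y : R) : (0 < x <= y)%R -> (ln x <= y)%R.
Proof.
  intros H; apply Rle_trans with (ln (exp y)); [|rewrite ln_exp; lra].
  apply ln_le; [lra|]; generalize (exp_ineq1_le y); lra.
Qed.

Lemma exp_le (x y : R) : (x <= y)%R -> (exp x <= exp y)%R.
Proof. intros [H| ->]; [left; apply exp_increasing, H | lra]. Qed.

(** * The cells around the edges and vertices are of order [e] *)

Section Bounds.

Variables p q r : C.
Hypotheses (Hp : (2 <= Re p)%R) (Hq : (2 <= Re q)%R) (Hr : (2 <= Re r)%R).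

(** The terms [2 Re q] and [2 Re r] come from [ln |z| <= 2] for forms of modulus at most 2, the
    others from arguments of size at most [2 PI]. *)
Let M : R := exp (2 * Re q + 2 * Re r + (Rabs (Im p) + Rabs (Im q) + Rabs (Im r)) * (2 * PI)).

Lemma Re_Clog_le (s z : C) : (2 <= Re s)%R -> (0 < Re z)%R -> (Cmod z <= 2)%R ->
  (Re (s * Clog z) <= 2 * Re s + Rabs (Im s) * (2 * PI))%R.
Proof.
  intros Hs Hz Hz2; eapply Rle_trans; [apply Re_mult_le with (B := (2 * PI)%R)|].
  - eapply Rle_trans; [apply Rabs_Carg | generalize PI_RGT_0; lra].
  - assert (ln (Cmod z) <= 2)%R.
    { apply ln_le_id; split; [apply Cmod_gt_0, neq_0_Re_pos, Hz | exact Hz2]. }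
    simpl; nra.
Qed.

(** Since [ln e <= 0] and [Re s >= 1], the factor [e^(Re s)] is at most [e]; a single power of the
    radius is all that is kept. *)
Lemma Re_lcirc_le (s : C) (e u : R) : (0 < e < 1 / 3)%R -> (2 <= Re s)%R ->
  (0 <= u <= 2 * PI)%R -> (Re (s * lcirc e u) <= ln e + Rabs (Im s) * (2 * PI))%R.
Proof.
  intros He Hs Hu; eapply Rle_trans; [apply Re_mult_le with (B := (2 * PI)%R)|].
  - simpl; rewrite Rabs_pos_eq; lra.
  - assert (ln e <= 0)%R by (apply ln_le_0; lra).
    simpl; assert (0 * u - 1 * 0 = 0)%R as -> by ring; nra.
Qed.

Lemma Cmod_circ (e u : R) : (0 < e)%R -> Cmod (circ e u) = e.
Proof. intros He; rewrite circ_cis, Cmod_mult, Cmod_cis, Cmod_R, Rabs_pos_eq; lra. Qed.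

Lemma Cmod_JE_factor (e u : R) : (0 < e < 1 / 3)%R ->
  (Cmod (1 - 2 * RtoC e - circ e u) <= 2)%R.
Proof.
  intros He.
  replace (1 - 2 * RtoC e - circ e u) with (RtoC (1 - 2 * e) + - circ e u)
    by (rewrite RtoC_minus, RtoC_mult; ring).
  eapply Rle_trans; [apply Cmod_triangle|].
  rewrite Cmod_opp, Cmod_circ, Cmod_R, Rabs_pos_eq; lra.
Qed.

Lemma Cmod_seg_le (e u v : R) : (0 < e < 1 / 3)%R -> (0 <= v <= 1)%R ->
  (Cmod (seg e u v) <= 2)%R.
Proof.
  intros He Hv.
  replace (seg e u v) with (RtoC (e * (1 - v) + v * (1 - e)) + - (RtoC v * circ e u)).
  - eapply Rle_trans; [apply Cmod_triangle|].
    rewrite Cmod_opp, Cmod_mult, Cmod_circ, !Cmod_R, !Rabs_pos_eq; nra.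
  - rewrite seg_eq, RtoC_plus, !RtoC_mult, !RtoC_minus; ring.
Qed.

Lemma Cmod_third_le (e u v : R) : (0 < e < 1 / 3)%R -> (Cmod (third e u v) <= 2)%R.
Proof.
  intros He; unfold third, Cminus.
  eapply Rle_trans; [apply Cmod_triangle|].
  eapply Rle_trans; [apply Rplus_le_compat_r, Cmod_triangle|].
  rewrite !Cmod_opp, !Cmod_circ, Cmod_1; lra.
Qed.

Lemma Cmod_wE_le (e u v : R) : (0 < e < 1 / 3)%R -> (0 <= u <= 2 * PI)%R -> (0 <= v <= 1)%R ->
  (Cmod (wE p q r e u v) <= e * M)%R.
Proof.
  intros He Hu Hv; unfold wE, M; rewrite Cmod_Cexp.
  rewrite <- (exp_ln e) at 4 by lra; rewrite <- exp_plus; apply exp_le.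
  assert (B1 := Re_lcirc_le p e u He Hp Hu).
  assert (B2 := Re_Clog_le q (seg e u v) Hq (Re_seg_pos e u v He Hv) (Cmod_seg_le e u v He Hv)).
  assert (Hv' : (0 <= 1 - v <= 1)%R) by lra.
  assert (B3 := Re_Clog_le r (seg e u (1 - v)) Hr (Re_seg_pos e u _ He Hv')
    (Cmod_seg_le e u _ He Hv')).
  rewrite !re_plus; lra.
Qed.

Lemma Cmod_wT_le (e u v : R) : (0 < e < 1 / 3)%R -> (0 <= u <= 2 * PI)%R ->
  (0 <= v <= 2 * PI)%R -> (Cmod (wT p q r e u v) <= e * M)%R.
Proof.
  intros He Hu Hv; unfold wT, M; rewrite Cmod_Cexp.
  rewrite <- (exp_ln e) at 4 by lra; rewrite <- exp_plus; apply exp_le.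
  assert (B1 := Re_lcirc_le p e u He Hp Hu).
  assert (B2 := Re_lcirc_le q e v He Hq Hv).
  assert (B3 := Re_Clog_le r (third e u v) Hr (Re_third_pos e u v He) (Cmod_third_le e u v He)).
  assert (ln e <= 0)%R by (apply ln_le_0; lra).
  rewrite !re_plus; lra.
Qed.

Lemma Cmod_IE_le (e : R) : (0 < e < 1 / 3)%R -> (Cmod (IE p q r e) <= e * (4 * PI * M))%R.
Proof.
  intros He; assert (Hpi := PI_RGT_0); assert (HM : (0 < M)%R) by apply exp_pos.
  replace (e * (4 * PI * M))%R with (2 * PI * (1 * (e * M * 2)))%R by ring.
  apply Cmod_CInt2_le; [lra | lra | apply cont2_E, He|].
  intros u v Hu Hv; rewrite Cmod_mult.
  apply Rmult_le_compat; try apply Cmod_ge_0; [apply Cmod_wE_le; assumption|].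
  unfold JE; rewrite !Cmod_mult, Cmod_Ci, Cmod_circ by lra.
  generalize (Cmod_JE_factor e u He) (Cmod_ge_0 (1 - 2 * RtoC e - circ e u)); nra.
Qed.

Lemma Cmod_IT_le (e : R) : (0 < e < 1 / 3)%R -> (Cmod (IT p q r e) <= e * (4 * PI * PI * M))%R.
Proof.
  intros He; assert (Hpi := PI_RGT_0); assert (HM : (0 < M)%R) by apply exp_pos.
  replace (e * (4 * PI * PI * M))%R with (2 * PI * (2 * PI * (e * M * 1)))%R by ring.
  apply Cmod_CInt2_le; [lra | lra | apply cont2_T, He|].
  intros u v Hu Hv; rewrite Cmod_mult.
  apply Rmult_le_compat; try apply Cmod_ge_0; [apply Cmod_wT_le; assumption|].
  unfold JT; rewrite Cmod_opp, Cmod_mult, !Cmod_circ by lra; nra.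
Qed.

End Bounds.

(** * The limit of the shrunken triangle *)

(** Euler's [B(p + 1, q + 1)]: the exponents are those of the integrand, without the usual shift by
    1. *)
Definition Beta (p q : C) : C := CInt (fun t => pw p t * pw q (1 - t)) 0 1.

Lemma Cmod_mult_diff (a b a' b' : C) (d d' : R) :
  (Cmod a <= 1)%R -> (Cmod b' <= 1)%R -> (Cmod (a - a') <= d)%R -> (Cmod (b - b') <= d')%R ->
  (Cmod (a * b - a' * b') <= d + d')%R.
Proof.
  intros Ha Hb Hd Hd'.
  replace (a * b - a' * b') with ((a - a') * b' + a * (b - b')) by ring.
  eapply Rle_trans; [apply Cmod_triangle|]; rewrite !Cmod_mult.
  generalize (Cmod_ge_0 (a - a')) (Cmod_ge_0 (b - b')) (Cmod_ge_0 a) (Cmod_ge_0 b'); nra.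
Qed.

Lemma Cmod_mult_le_1 (a b : C) : (Cmod a <= 1)%R -> (Cmod b <= 1)%R -> (Cmod (a * b) <= 1)%R.
Proof.
  intros Ha Hb; rewrite Cmod_mult; generalize (Cmod_ge_0 a) (Cmod_ge_0 b); nra.
Qed.

Lemma contI_Beta (p q : C) : (2 <= Re p)%R -> (2 <= Re q)%R ->
  contI 1 (fun t => pw p t * pw q (1 - t)).
Proof.
  intros Hp Hq; apply contI_of_cont; [lra|]; intros t _.
  apply cont_mult; [apply cont_pw, Hp|].
  apply (cont_comp (fun t => (1 - t)%R) (pw q)); [|apply cont_pw, Hq].
  apply (continuous_1_minus (fun x => x)), continuous_id.
Qed.

Section Limit.

Variables p q r : C.
Hypotheses (Hp : (2 <= Re p)%R) (Hq : (2 <= Re q)%R) (Hr : (2 <= Re r)%R).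

(** The integrand at [e = 0], in the coordinates [z1 = u], [z2 = (1-u) v], [z3 = (1-u)(1-v)] with
    Jacobian [1 - u]. The variables separate, and the powers of [1 - u] collect to the exponent
    [q + r + 1]. *)
Let w0 (u v : R) : C :=
  pw p u * pw q ((1 - u) * v) * pw r ((1 - u) * (1 - v)) * RtoC (1 - u).

Lemma cont2_w0 : cont2 1 1 w0.
Proof.
  apply cont2_of_cont; [lra | lra|]; intros u v _ _.
  assert (C1 : continuous (fun q : R * R => 1 - fst q)%R (u, v))
    by (apply continuous_1_minus, continuous_fst).
  assert (C2 : continuous (fun q : R * R => 1 - snd q)%R (u, v))
    by (apply continuous_1_minus, continuous_snd).
  unfold w0; apply cont_mult; [|apply cont_RtoC, C1].
  apply cont_mult; [apply cont_mult|].
  - apply (cont_comp fst (pw p)); [apply continuous_fst | apply cont_pw, Hp].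
  - apply (cont_comp (fun q : R * R => (1 - fst q) * snd q)%R (pw q)); [|apply cont_pw, Hq].
    apply (continuous_mult (K := R_AbsRing)); [exact C1 | apply continuous_snd].
  - apply (cont_comp (fun q : R * R => (1 - fst q) * (1 - snd q))%R (pw r)); [|apply cont_pw, Hr].
    apply (continuous_mult (K := R_AbsRing)); assumption.
Qed.

Lemma CInt2_w0 : CInt2 1 1 w0 = Beta p (q + r + 1) * Beta q r.
Proof.
  unfold Beta; rewrite <- CInt2_separate; try lra; try (apply contI_Beta; try assumption).
  - apply CInt2_ext; try lra; intros u v Hu Hv; unfold w0.
    rewrite !pw_mult, pw_succ, pw_plus by lra; ring.
  - rewrite !re_plus; simpl; lra.
Qed.

Lemma IS_limit (e : R) : (0 < e < 1 / 3)%R ->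
  (Cmod (IS p q r e - Beta p (q + r + 1) * Beta q r) <=
   e * (6 * (Cmod p + Cmod q + Cmod r) + 15))%R.
Proof.
  intros He; rewrite <- CInt2_w0; unfold IS.
  assert (Hc := cont2_S e He p q r).
  rewrite <- CInt2_minus; try lra; try assumption; try apply cont2_w0.
  (* The 6 is the Lipschitz factor 2 times the displacement bound [3 e] of each form, divided by
     [e]; [15 e] generously covers the change of the Jacobian, which is at most [6 e]. *)
  set (K := (6 * (Cmod p + Cmod q + Cmod r) + 15)%R).
  replace (e * K)%R with (1 * (1 * (e * K)))%R by ring.
  apply Cmod_CInt2_le; try lra.
  { intros x; apply cont_minus; [apply Hc | apply cont2_w0]. }
  intros u v Hu Hv.
  pose (s1 := (e + (1 - 3 * e) * u)%R).
  pose (s2 := (e + (1 - 3 * e) * (1 - u) * v)%R).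
  pose (s3 := (e + (1 - 3 * e) * (1 - u) * (1 - v))%R).
  assert (U1 : (0 <= (1 - u) * v <= 1)%R) by nra.
  assert (U2 : (0 <= (1 - u) * (1 - v) <= 1)%R) by nra.
  assert (S1 : (0 < s1 <= 1)%R) by (unfold s1; nra).
  assert (S2 : (0 < s2 <= 1)%R) by (unfold s2; rewrite Rmult_assoc; nra).
  assert (S3 : (0 < s3 <= 1)%R) by (unfold s3; rewrite Rmult_assoc; nra).
  assert (Ew : wS p q r e u v = pw p s1 * pw q s2 * pw r s3).
  { unfold wS; rewrite !pw_Clog, <- !Cexp_plus by lra.
    replace (1 - sig1 e u - sig2 e u v) with (RtoC s3); [reflexivity|].
    unfold sig1, sig2, s3; rewrite <- !RtoC_minus; f_equal; ring. }
  assert (EJ : JS e u = RtoC ((1 - 3 * e) * (1 - 3 * e) * (1 - u))).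
  { unfold JS; rewrite !RtoC_mult, !RtoC_minus, RtoC_mult; reflexivity. }
  rewrite Ew, EJ; unfold w0.
  assert (L1 := pw_Lipschitz p s1 u Hp (ltac:(lra)) Hu).
  assert (L2 := pw_Lipschitz q s2 ((1 - u) * v) Hq (ltac:(lra)) U1).
  assert (L3 := pw_Lipschitz r s3 ((1 - u) * (1 - v)) Hr (ltac:(lra)) U2).
  assert (A1 : (Rabs (s1 - u) <= 3 * e)%R) by (apply Rabs_le; unfold s1; nra).
  assert (A2 : (Rabs (s2 - (1 - u) * v) <= 3 * e)%R)
    by (apply Rabs_le; unfold s2; rewrite Rmult_assoc; nra).
  assert (A3 : (Rabs (s3 - (1 - u) * (1 - v)) <= 3 * e)%R)
    by (apply Rabs_le; unfold s3; rewrite Rmult_assoc; nra).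
  assert (Gp := Cmod_ge_0 p); assert (Gq := Cmod_ge_0 q); assert (Gr := Cmod_ge_0 r).
  replace (e * K)%R with
    (((2 * Cmod p * (3 * e) + 2 * Cmod q * (3 * e)) + 2 * Cmod r * (3 * e)) + 15 * e)%R
    by (unfold K; ring).
  (* The product is telescoped factor by factor; all factors have modulus at most 1. *)
  repeat apply Cmod_mult_diff; repeat apply Cmod_mult_le_1;
    first
    [ apply Cmod_pw_le_1; lra
    | eapply Rle_trans; [exact L1|]; apply Rmult_le_compat_l; lra
    | eapply Rle_trans; [exact L2|]; apply Rmult_le_compat_l; lra
    | eapply Rle_trans; [exact L3|]; apply Rmult_le_compat_l; lra
    | rewrite Cmod_R; apply Rabs_le; lra
    | idtac ].
  rewrite <- RtoC_minus, Cmod_R; apply Rabs_le.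
  replace ((1 - 3 * e) * (1 - 3 * e) * (1 - u) - (1 - u))%R
    with (- (1 - u) * (e * (6 - 9 * e)))%R by ring.
  assert (0 <= e * (6 - 9 * e) <= 6 * e)%R by nra. nra.
Qed.

End Limit.

Definition small (f : R -> C) : Prop :=
  exists K, forall e, (0 < e < 1 / 3)%R -> (Cmod (f e) <= e * K)%R.

Lemma small_plus (f g : R -> C) : small f -> small g -> small (fun e => f e + g e).
Proof.
  intros [K HK] [L HL]; exists (K + L)%R; intros e He.
  eapply Rle_trans; [apply Cmod_triangle|].
  specialize (HK e He); specialize (HL e He); lra.
Qed.

Lemma small_cmul (c : C) (f : R -> C) : small f -> small (fun e => c * f e).
Proof.
  intros [K HK]; exists (Cmod c * K)%R; intros e He; rewrite Cmod_mult.
  specialize (HK e He); generalize (Cmod_ge_0 c); nra.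
Qed.

Lemma small_const (c : C) : small (fun _ => c) -> c = 0.
Proof.
  intros [K H]; apply Cmod_eq_0, Rle_antisym; [|apply Cmod_ge_0].
  apply le_epsilon; intros eps Heps; rewrite Rplus_0_l.
  assert (HK : (0 < Rabs K + 1)%R) by (generalize (Rabs_pos K); lra).
  pose (e := Rmin (1 / 4) (eps / (Rabs K + 1))).
  assert (P : (0 < eps / (Rabs K + 1))%R) by (apply Rdiv_lt_0_compat; assumption).
  assert (He : (0 < e < 1 / 3)%R).
  { split; [apply Rmin_pos; lra|]; eapply Rle_lt_trans; [apply Rmin_l | lra]. }
  eapply Rle_trans; [apply (H e He)|].
  apply Rle_trans with (e * (Rabs K + 1))%R.
  - apply Rmult_le_compat_l; [lra|]; generalize (Rle_abs K); lra.
  - replace eps with (eps / (Rabs K + 1) * (Rabs K + 1))%R at 1 by (field; lra).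
    apply Rmult_le_compat_r; [lra | apply Rmin_r].
Qed.

(** By independence of the radius the difference of the two sides is a constant in [e], and each of
    its parts is of order [e]; a constant of order [e] vanishes. *)
Lemma Dreg_Beta (p1 p2 p3 : C) (e : R) : (0 < e < 1 / 3)%R ->
  mono p1 <> 1 -> mono p2 <> 1 -> mono p3 <> 1 ->
  (2 <= Re p1)%R -> (2 <= Re p2)%R -> (2 <= Re p3)%R ->
  Dreg p1 p2 p3 e = Beta p1 (p2 + p3 + 1) * Beta p2 p3.
Proof.
  intros He N1 N2 N3 H1 H2 H3.
  assert (BE : forall p q r, (2 <= Re p)%R -> (2 <= Re q)%R -> (2 <= Re r)%R ->
    small (IE p q r)).
  { intros p q r Hp Hq Hr; eexists; intros t Ht; apply Cmod_IE_le; assumption. }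
  assert (BT : forall p q r, (2 <= Re p)%R -> (2 <= Re q)%R -> (2 <= Re r)%R ->
    small (IT p q r)).
  { intros p q r Hp Hq Hr; eexists; intros t Ht; apply Cmod_IT_le; assumption. }
  assert (BS : small (fun t => IS p1 p2 p3 t - Beta p1 (p2 + p3 + 1) * Beta p2 p3)).
  { eexists; intros t Ht; apply IS_limit; assumption. }
  set (B := Beta p1 (p2 + p3 + 1) * Beta p2 p3) in *.
  assert (E : Dreg p1 p2 p3 e - B = 0); [|transitivity (Dreg p1 p2 p3 e - B + B);
    [ring | rewrite E; ring]].
  apply small_const.
  pose (d := fun p => / (mono p - 1)).
  assert (S : small (fun t => (IS p1 p2 p3 t - B) +
    (d p1 * IE p1 p2 p3 t + d p2 * IE p2 p3 p1 t + d p3 * IE p3 p1 p2 t) +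
    (d p1 * d p2 * IT p1 p2 p3 t + d p2 * d p3 * IT p2 p3 p1 t + d p3 * d p1 * IT p3 p1 p2 t))).
  { repeat lazymatch goal with
    | |- small (fun t => @?f t + @?g t) => apply (small_plus f g)
    | |- small (fun t => @?f t - _) => exact BS
    | |- small (fun t => ?c * @?f t) => apply (small_cmul c f)
    | |- small (fun t => IE ?p ?q ?r t) => apply (BE p q r)
    | |- small (fun t => IT ?p ?q ?r t) => apply (BT p q r)
    | |- (2 <= _)%R => assumption
    | |- small (IE _ _ _) => apply BE; assumption
    | |- small (IT _ _ _) => apply BT; assumption
    end. }
  destruct S as [K HK]; exists K; intros t Ht.
  rewrite (Dreg_radius p1 p2 p3 e t He Ht N1 N2 N3).
  eapply Rle_trans; [|apply (HK t Ht)]; right; f_equal.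
  unfold Dreg; fold (d p1) (d p2) (d p3); ring.
Qed.

(** * Gauss's limit *)

Definition Clim (u : nat -> C) (l : C) : Prop :=
  is_lim_seq (fun n => Re (u n)) (Re l) /\ is_lim_seq (fun n => Im (u n)) (Im l).

Lemma Clim_CLim_seq (u : nat -> C) (l : C) : Clim u l -> CLim_seq u = l.
Proof.
  intros [H1 H2]; unfold CLim_seq.
  rewrite (is_lim_seq_unique _ _ H1), (is_lim_seq_unique _ _ H2); destruct l; reflexivity.
Qed.

Lemma Clim_unique (u : nat -> C) (l m : C) : Clim u l -> Clim u m -> l = m.
Proof. intros H1 H2; rewrite <- (Clim_CLim_seq u l H1); apply Clim_CLim_seq, H2. Qed.

Lemma Clim_const (c : C) : Clim (fun _ => c) c.
Proof. split; apply is_lim_seq_const. Qed.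

Lemma Clim_plus (u v : nat -> C) (l m : C) :
  Clim u l -> Clim v m -> Clim (fun n => u n + v n) (l + m).
Proof. intros [] []; split; simpl; apply is_lim_seq_plus'; assumption. Qed.

Lemma Clim_mult (u v : nat -> C) (l m : C) :
  Clim u l -> Clim v m -> Clim (fun n => u n * v n) (l * m).
Proof.
  intros [] []; split; simpl.
  - apply is_lim_seq_minus'; apply is_lim_seq_mult'; assumption.
  - apply is_lim_seq_plus'; apply is_lim_seq_mult'; assumption.
Qed.

Lemma Clim_ext_loc (N : nat) (u v : nat -> C) (l : C) :
  (forall n, (N <= n)%nat -> u n = v n) -> Clim u l -> Clim v l.
Proof.
  intros E [H1 H2]; split.
  - eapply is_lim_seq_ext_loc; [|exact H1]; exists N; intros n Hn; rewrite E by exact Hn; reflexivity.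
  - eapply is_lim_seq_ext_loc; [|exact H2]; exists N; intros n Hn; rewrite E by exact Hn; reflexivity.
Qed.

Lemma Clim_incr (u : nat -> C) (l : C) (N : nat) :
  Clim (fun n => u (n + N)%nat) l -> Clim u l.
Proof.
  intros [H1 H2]; split.
  - apply (is_lim_seq_incr_n (fun n => Re (u n)) N), H1.
  - apply (is_lim_seq_incr_n (fun n => Im (u n)) N), H2.
Qed.

Lemma Clim_Cmod (u : nat -> C) (l : C) : Clim u l -> is_lim_seq (fun n => Cmod (u n)) (Cmod l).
Proof.
  intros [H1 H2]; unfold Cmod.
  apply (is_lim_seq_continuous sqrt (fun n => fst (u n) ^ 2 + snd (u n) ^ 2)%R).
  - apply continuity_pt_sqrt; simpl; nra.
  - simpl; apply is_lim_seq_plus';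
      (apply is_lim_seq_mult'; [assumption|];
       apply is_lim_seq_mult'; [assumption | apply is_lim_seq_const]).
Qed.

Lemma Clim_dominated (N : nat) (u : nat -> C) (l : C) (b : nat -> R) :
  (forall n, (N <= n)%nat -> (Cmod (u n - l) <= b n)%R) -> is_lim_seq b 0%R -> Clim u l.
Proof.
  intros Hb H0.
  assert (A : forall (x : nat -> R) (y : R),
    (forall n, (N <= n)%nat -> (Rabs (x n - y) <= b n)%R) -> is_lim_seq x y).
  { intros x y Hx.
    apply is_lim_seq_ext with (fun n => y + (x n - y))%R; [intros; ring|].
    replace (Finite y) with (Finite (y + 0)%R) by (f_equal; ring).
    apply is_lim_seq_plus'; [apply is_lim_seq_const|].
    apply is_lim_seq_abs_0.
    apply (is_lim_seq_le_le_loc (fun _ => 0%R) _ b); [| apply is_lim_seq_const | exact H0].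
    exists N; intros n Hn; split; [apply Rabs_pos | apply Hx, Hn]. }
  split; apply A; intros n Hn; (eapply Rle_trans; [|apply (Hb n Hn)]).
  - apply (re_le_Cmod (u n - l)).
  - apply (im_le_Cmod (u n - l)).
Qed.

Lemma INR_lt_up (x : R) : exists N : nat, forall n, (N <= n)%nat -> (x < INR n)%R.
Proof.
  destruct (INR_unbounded x) as [N HN]; exists N; intros n Hn.
  eapply Rlt_le_trans; [exact HN | apply le_INR, Hn].
Qed.

Lemma Cmod_plus_INR_ge (z : C) (n : nat) : (INR n - Cmod z <= Cmod (z + RtoC (INR n)))%R.
Proof.
  assert (H := Cmod_triangle (z + RtoC (INR n)) (- z)).
  rewrite Cmod_opp in H; replace (z + RtoC (INR n) + - z) with (RtoC (INR n)) in H by ring.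
  rewrite Cmod_R, Rabs_pos_eq in H by apply pos_INR; lra.
Qed.

Lemma Clim_inv_INR (c z : C) : Clim (fun n => c / (z + RtoC (INR n))) 0.
Proof.
  destruct (INR_lt_up (2 * Cmod z + 1)) as [N HN].
  apply (Clim_dominated N _ _ (fun n => 2 * Cmod c * / INR n)%R).
  - intros n Hn; specialize (HN n Hn).
    assert (G := Cmod_plus_INR_ge z n); assert (G0 := Cmod_ge_0 z).
    replace (c / (z + RtoC (INR n)) - 0) with (c / (z + RtoC (INR n))) by ring.
    assert (Hz : z + RtoC (INR n) <> 0) by (apply Cmod_gt_0; lra).
    rewrite Cmod_div by exact Hz.
    replace (2 * Cmod c * / INR n)%R with (Cmod c * / (INR n / 2))%R by (field; lra).
    apply Rmult_le_compat_l; [apply Cmod_ge_0|].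
    apply Rinv_le_contravar; lra.
  - replace (Finite 0) with (Rbar_mult (2 * Cmod c)%R 0%R) by (simpl; f_equal; ring).
    apply is_lim_seq_scal_l.
    replace (Finite 0) with (Rbar_inv p_infty) by reflexivity.
    apply is_lim_seq_inv; [apply is_lim_seq_INR | discriminate].
Qed.

(** * Summable increments and infinite products *)

Lemma ex_series_telescope : ex_series (fun n => / INR (S n) - / INR (S (S n)))%R.
Proof.
  exists 1%R.
  change (is_lim_seq (sum_n (fun n => / INR (S n) - / INR (S (S n)))%R) 1%R).
  apply (is_lim_seq_ext (fun n => 1 - / INR (S (S n)))%R).
  - intros n; induction n as [|n IH].
    + rewrite sum_O; simpl; field.
    + rewrite sum_Sn, <- IH.
      change (1 - / INR (S (S (S n))) =
        1 - / INR (S (S n)) + (/ INR (S (S n)) - / INR (S (S (S n)))))%R; ring.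
  - replace (Finite 1) with (Finite (1 - 0)%R) by (f_equal; ring).
    apply is_lim_seq_minus'; [apply is_lim_seq_const|].
    replace (Finite 0) with (Rbar_inv p_infty) by reflexivity.
    apply is_lim_seq_inv; [|discriminate].
    apply (is_lim_seq_ext (fun n => INR (n + 2))); [intros n; f_equal; lia|].
    apply (is_lim_seq_incr_n INR 2), is_lim_seq_INR.
Qed.

Lemma Clim_increments (u : nat -> C) (K : R) :
  (forall n, (Cmod (u (S n) - u n) <= K * (/ INR (S n) - / INR (S (S n))))%R) ->
  exists l, Clim u l.
Proof.
  intros H.
  assert (A : forall x : nat -> R,
    (forall n, (Rabs (x (S n) - x n) <= K * (/ INR (S n) - / INR (S (S n))))%R) ->
    exists y : R, is_lim_seq x y).
  { intros x Hx.
    assert (S0 : ex_series (fun n => x (S n) - x n)%R).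
    { apply (ex_series_le (V := R_CompleteNormedModule) _ _ Hx).
      apply (ex_series_scal (V := R_NormedModule) K), ex_series_telescope. }
    destruct S0 as [s Hs]; exists (s + x O)%R.
    apply is_lim_seq_incr_1.
    apply (is_lim_seq_ext (fun n => sum_n (fun n => x (S n) - x n)%R n + x O)%R).
    - intros n; induction n as [|n IH].
      + rewrite sum_O; ring.
      + rewrite sum_Sn; unfold plus; simpl; rewrite <- IH; ring.
    - apply is_lim_seq_plus'; [exact Hs | apply is_lim_seq_const]. }
  destruct (A (fun n => Re (u n))) as [x Hx].
  { intros n; eapply Rle_trans; [|apply H]; apply (re_le_Cmod (u (S n) - u n)). }
  destruct (A (fun n => Im (u n))) as [y Hy].
  { intros n; eapply Rle_trans; [|apply H]; apply (im_le_Cmod (u (S n) - u n)). }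
  exists (x, y); split; assumption.
Qed.

Lemma inv_sq_le (n m : nat) : (2 <= m)%nat ->
  (/ (INR (n + m) * INR (n + m)) <= / INR (S n) - / INR (S (S n)))%R.
Proof.
  intros Hm.
  assert (Hn := pos_INR n).
  assert (Hm' : (2 <= INR m)%R) by (apply (le_INR 2), Hm).
  rewrite plus_INR, !S_INR.
  replace (/ (INR n + 1) - / (INR n + 1 + 1))%R with (/ ((INR n + 1) * (INR n + 1 + 1)))%R
    by (field; lra).
  apply Rinv_le_contravar; nra.
Qed.

(** The inequality [1 + x <= exp x] bounds the partial products, with the telescoping sum of
    [inv_sq_le] in the exponent; the increments [u n * eps n] are then dominated by the same
    telescoping series. *)
Lemma Clim_product (u eps : nat -> C) (K : R) (m : nat) : (0 <= K)%R -> (2 <= m)%nat ->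
  (forall n, (m <= n)%nat -> u (S n) = u n * (1 + eps n)) ->
  (forall n, (m <= n)%nat -> (Cmod (eps n) <= K * / (INR n * INR n))%R) ->
  exists l, Clim u l.
Proof.
  intros HK Hm Hu He.
  assert (B : forall n, (Cmod (u (n + m)%nat) <=
    Cmod (u m) * exp (K * (1 - / INR (S n))))%R).
  { intros n; induction n as [|n IH].
    - simpl; rewrite Rinv_1; replace (K * (1 - 1))%R with 0%R by ring; rewrite exp_0; lra.
    - simpl Nat.add; rewrite Hu, Cmod_mult by lia.
      apply Rle_trans with (Cmod (u m) * exp (K * (1 - / INR (S n))) *
        exp (K * (/ INR (S n) - / INR (S (S n)))))%R.
      + apply Rmult_le_compat; try apply Cmod_ge_0; [exact IH|].
        eapply Rle_trans; [apply Cmod_triangle|]; rewrite Cmod_1.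
        eapply Rle_trans; [|apply exp_ineq1_le].
        apply Rplus_le_compat_l; eapply Rle_trans; [apply He; lia|].
        apply Rmult_le_compat_l; [exact HK | apply inv_sq_le, Hm].
      + rewrite Rmult_assoc, <- exp_plus; right; f_equal; f_equal; ring. }
  pose (M := (Cmod (u m) * exp K)%R).
  assert (BM : forall n, (Cmod (u (n + m)%nat) <= M)%R).
  { intros n; eapply Rle_trans; [apply B|].
    apply Rmult_le_compat_l; [apply Cmod_ge_0|]; apply exp_le.
    assert (0 < / INR (S n))%R by (apply Rinv_0_lt_compat, lt_0_INR; lia). nra. }
  destruct (Clim_increments (fun n => u (n + m)%nat) (M * K)) as [l Hl].
  - intros n; simpl Nat.add; rewrite Hu by lia.
    replace (u (n + m)%nat * (1 + eps (n + m)%nat) - u (n + m)%nat)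
      with (u (n + m)%nat * eps (n + m)%nat) by ring.
    rewrite Cmod_mult, (Rmult_assoc M).
    apply Rmult_le_compat; try apply Cmod_ge_0; [apply BM|].
    eapply Rle_trans; [apply He; lia|].
    apply Rmult_le_compat_l; [exact HK | apply inv_sq_le, Hm].
  - exists l; apply (Clim_incr u l m), Hl.
Qed.

(** The reciprocals form a product of the same kind, with [1 / (1 + eps) = 1 - eps / (1 + eps)] and
    constant [2 K] once [|eps| <= 1/2]. So they converge too, and the two limits multiply to 1. *)
Lemma Clim_product_neq_0 (u eps : nat -> C) (K : R) (m : nat) : (0 <= K)%R -> (2 <= m)%nat ->
  (forall n, (m <= n)%nat -> u (S n) = u n * (1 + eps n)) ->
  (forall n, (m <= n)%nat -> (Cmod (eps n) <= K * / (INR n * INR n))%R) ->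
  (forall n, (m <= n)%nat -> u n <> 0) ->
  exists l, Clim u l /\ l <> 0.
Proof.
  intros HK Hm Hu He Hn0.
  destruct (Clim_product u eps K m HK Hm Hu He) as [l Hl]; exists l; split; [exact Hl|].
  destruct (INR_lt_up (2 * K + 1)) as [N HN].
  assert (Hhalf : forall n, (Nat.max m N <= n)%nat -> (Cmod (eps n) <= 1 / 2)%R).
  { intros n Hn; eapply Rle_trans; [apply He; lia|].
    assert (H := HN n ltac:(lia)).
    apply (Rmult_le_reg_r (INR n * INR n)); [nra|].
    rewrite Rmult_assoc, Rinv_l, Rmult_1_r by nra; nra. }
  destruct (Clim_product (fun n => / u n) (fun n => - eps n / (1 + eps n)) (2 * K)
    (Nat.max m N)) as [l' Hl']; [lra | lia | | |].
  - intros n Hn; rewrite Hu by lia.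
    assert (E1 : 1 + eps n <> 0).
    { intros E; assert (F : eps n = - (1)) by (rewrite <- (Cplus_0_r (- (1))), <- E; ring).
      generalize (Hhalf n Hn); rewrite F, Cmod_opp, Cmod_1; lra. }
    field; split; [exact E1 | apply Hn0; lia].
  - intros n Hn.
    assert (G : (1 / 2 <= Cmod (1 + eps n))%R).
    { assert (T := Cmod_triangle (1 + eps n) (- eps n)).
      rewrite Cmod_opp in T; replace (1 + eps n + - eps n) with (RtoC 1) in T by ring.
      rewrite Cmod_1 in T; generalize (Hhalf n Hn); lra. }
    rewrite Cmod_div, Cmod_opp by (apply Cmod_gt_0; lra).
    apply Rle_trans with (Cmod (eps n) * 2)%R.
    + apply Rmult_le_compat_l; [apply Cmod_ge_0|].
      replace 2%R with (/ (1 / 2))%R at 1 by field; apply Rinv_le_contravar; lra.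
    + assert (L := He n ltac:(lia)); lra.
  - intros E; rewrite E in Hl.
    assert (P := Clim_mult _ _ _ _ Hl Hl').
    assert (P1 : Clim (fun _ => RtoC 1) (0 * l')).
    { eapply (Clim_ext_loc m); [|exact P]; intros n Hn; simpl; field; apply Hn0, Hn. }
    assert (F := Clim_unique _ _ _ P1 (Clim_const 1)).
    rewrite Cmult_0_l in F; apply (f_equal Re) in F; simpl in F; lra.
Qed.

(** * Taylor estimates for the exponential *)

Lemma Cexp_RtoC_mult_der (w : C) (t : R) :
  der (fun t => Cexp (RtoC t * w)) t (w * Cexp (RtoC t * w)).
Proof.
  eapply der_eq.
  - apply (der_Cexp (fun t => RtoC t * w)), (der_mult RtoC (fun _ => w));
      [apply der_id | apply der_const].
  - ring.
Qed.

Lemma Cmod_Cexp_le (w : C) (t : R) : (0 <= t <= 1)%R ->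
  (Cmod (Cexp (RtoC t * w)) <= exp (Cmod w))%R.
Proof.
  intros Ht; rewrite Cmod_Cexp; apply exp_le; rewrite Re_scale.
  assert (H := re_le_Cmod w); assert (H1 := Rle_abs (Re w)).
  assert (G := Cmod_ge_0 w); assert (t * Re w <= t * Cmod w)%R by (apply Rmult_le_compat_l; lra).
  nra.
Qed.

Lemma Cexp_taylor_1 (w : C) : (Cmod (Cexp w - 1) <= Cmod w * exp (Cmod w))%R.
Proof.
  assert (Hc : contI 1 (fun t => w * Cexp (RtoC t * w))).
  { apply contI_of_cont; [lra|]; intros t _; apply cont_mult; [apply cont_const|].
    eapply der_cont, Cexp_RtoC_mult_der. }
  assert (E := CInt_der 1 (fun t => Cexp (RtoC t * w)) _ Rle_0_1
    (fun t _ => Cexp_RtoC_mult_der w t) Hc).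
  simpl in E; rewrite Cmult_1_l, Cmult_0_l, Cexp_0 in E; rewrite <- E.
  rewrite <- (Rmult_1_l (Cmod w * _)).
  apply Cmod_CInt_le; [lra | exact Hc|]; intros t Ht; rewrite Cmod_mult.
  apply Rmult_le_compat_l; [apply Cmod_ge_0 | apply Cmod_Cexp_le, Ht].
Qed.

(** The derivative of [exp(t w) - t w] in [t] is [w (exp(t w) - 1)], to which the first-order
    estimate applies. *)
Lemma Cexp_taylor_2 (w : C) :
  (Cmod (Cexp w - 1 - w) <= Cmod w * Cmod w * exp (Cmod w))%R.
Proof.
  assert (Hd : forall t, der (fun t => Cexp (RtoC t * w) - RtoC t * w) t
    (w * (Cexp (RtoC t * w) - 1))).
  { intros t; eapply der_eq.
    - apply (der_minus (fun t => Cexp (RtoC t * w)) (fun t => RtoC t * w));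
        [apply Cexp_RtoC_mult_der|].
      apply (der_mult RtoC (fun _ => w)); [apply der_id | apply der_const].
    - ring. }
  assert (Hc : contI 1 (fun t => w * (Cexp (RtoC t * w) - 1))).
  { apply contI_of_cont; [lra|]; intros t _; apply cont_mult; [apply cont_const|].
    apply cont_minus; [eapply der_cont, Cexp_RtoC_mult_der | apply cont_const]. }
  assert (E := CInt_der 1 _ _ Rle_0_1 (fun t _ => Hd t) Hc).
  simpl in E; rewrite Cmult_1_l, Cmult_0_l, Cexp_0 in E.
  replace (Cexp w - 1 - w) with (Cexp w - w - (1 - 0)) by ring; rewrite <- E.
  rewrite <- (Rmult_1_l (Cmod w * _ * _)).
  apply Cmod_CInt_le; [lra | exact Hc|]; intros t Ht; rewrite Cmod_mult, Rmult_assoc.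
  apply Rmult_le_compat_l; [apply Cmod_ge_0|].
  eapply Rle_trans; [apply Cexp_taylor_1|].
  rewrite Cmod_mult, Cmod_R, Rabs_pos_eq by lra.
  assert (H0 := Cmod_ge_0 w); apply Rmult_le_compat; try nra.
  - left; apply exp_pos.
  - apply exp_le; nra.
Qed.

(** Convertible to the sequence inside [CGamma]. *)
Definition gauss (z : C) (n : nat) : C :=
  RtoC (INR (fact n)) * Cexp (z * RtoC (ln (INR n))) / poch z (S n).

Lemma poch_neq_0 (z : C) (n : nat) : ~ Cis_nonpos_int z -> poch z n <> 0.
Proof.
  intros Hz; induction n as [|n IH]; simpl; [apply RtoC_neq_0; lra|].
  apply Cmult_neq_0; [exact IH|]; intros E; apply Hz; exists n.
  transitivity (z + RtoC (INR n) - RtoC (INR n)); [ring | rewrite E; ring].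
Qed.

Lemma nonpos_shift (z : C) : ~ Cis_nonpos_int z -> ~ Cis_nonpos_int (z + 1).
Proof.
  intros Hz [n Hn]; apply Hz; exists (S n); rewrite S_INR, RtoC_plus.
  transitivity (z + 1 - 1); [ring | rewrite Hn; ring].
Qed.

Lemma poch_shift (z : C) (n : nat) : poch z (S n) = z * poch (z + 1) n.
Proof.
  induction n as [|n IH]; [simpl; ring|].
  change (poch z (S (S n))) with (poch z (S n) * (z + RtoC (INR (S n)))).
  rewrite IH; simpl poch; rewrite S_INR, RtoC_plus; ring.
Qed.

Lemma ln_ratio_bounds (n : nat) : (1 <= n)%nat ->
  (/ (INR n + 1) <= ln (INR n + 1) - ln (INR n) <= / INR n)%R.
Proof.
  intros Hn; assert (P : (0 < INR n)%R) by (apply lt_0_INR; lia).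
  assert (U : forall x, (0 < x)%R -> (ln x <= x - 1)%R).
  { intros x Hx; generalize (exp_ineq1_le (ln x)); rewrite exp_ln by exact Hx; lra. }
  split.
  - assert (H := U (INR n / (INR n + 1))%R (Rdiv_lt_0_compat (INR n) (INR n + 1) P (ltac:(lra)))).
    rewrite ln_div in H by lra.
    replace (INR n / (INR n + 1) - 1)%R with (- / (INR n + 1))%R in H by (field; lra). lra.
  - assert (H := U ((INR n + 1) / INR n)%R (Rdiv_lt_0_compat (INR n + 1) (INR n) (ltac:(lra)) P)).
    rewrite ln_div in H by lra.
    replace ((INR n + 1) / INR n - 1)%R with (/ INR n)%R in H by (field; lra). lra.
Qed.

(** The quotient of consecutive terms is [((n+1)/n)^z (n+1) / (z+n+1) = 1 + O(1/n^2)], which makes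
    the sequence a convergent infinite product with nonzero limit. *)
Lemma gauss_conv (z : C) : ~ Cis_nonpos_int z -> exists l, Clim (gauss z) l /\ l <> 0.
Proof.
  intros Hz.
  pose (eps := fun n : nat =>
    RtoC (INR n + 1) * Cexp (z * RtoC (ln (INR n + 1) - ln (INR n))) / (z + RtoC (INR n + 1)) - 1).
  destruct (INR_lt_up (2 * Cmod z + 1)) as [N HN].
  (* The outer 2 bounds [(n+1) / |z+n+1|], by the choice of [N]; the two summands bound the
     second-order Taylor remainder and the error of replacing [ln((n+1)/n)] by [1/(n+1)]. *)
  pose (K := (2 * (Cmod z * Cmod z * exp (Cmod z) + Cmod z))%R).
  assert (G0 := Cmod_ge_0 z).
  apply (Clim_product_neq_0 (gauss z) eps K (Nat.max 2 N)); [| lia | | |].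
  - assert (0 < exp (Cmod z))%R by apply exp_pos. unfold K; nra.
  - intros n Hn; unfold gauss, eps.
    change (poch z (S (S n))) with (poch z (S n) * (z + RtoC (INR (S n)))).
    assert (P := poch_neq_0 z (S n) Hz).
    assert (P2 := poch_neq_0 z (S (S n)) Hz).
    assert (Q : z + RtoC (INR n + 1) <> 0).
    { intros E; apply P2; change (poch z (S n) * (z + RtoC (INR (S n))) = 0).
      rewrite S_INR, E; ring. }
    rewrite fact_simpl, mult_INR, S_INR, RtoC_mult.
    replace (z * RtoC (ln (INR n + 1))) with
      (z * RtoC (ln (INR n)) + z * RtoC (ln (INR n + 1) - ln (INR n)))
      by (rewrite RtoC_minus; ring).
    rewrite Cexp_plus; field; split; assumption.
  - intros n Hn; unfold eps.
    assert (Hn1 : (1 <= n)%nat) by lia.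
    destruct (ln_ratio_bounds n Hn1) as [L1 L2].
    set (L := (ln (INR n + 1) - ln (INR n))%R) in *.
    assert (HNn := HN n ltac:(lia)).
    assert (P : (0 < INR n)%R) by lra.
    assert (Pi1 : (0 < / (INR n + 1))%R) by (apply Rinv_0_lt_compat; lra).
    assert (Pin : (0 < / INR n)%R) by (apply Rinv_0_lt_compat; lra).
    assert (Pin1 : (/ INR n <= 1)%R).
    { rewrite <- Rinv_1; apply Rinv_le_contravar; lra. }
    assert (D : ((INR n + 1) / 2 <= Cmod (z + RtoC (INR n + 1)))%R).
    { rewrite <- S_INR; generalize (Cmod_plus_INR_ge z (S n)); rewrite S_INR; lra. }
    assert (Q : z + RtoC (INR n + 1) <> 0) by (apply Cmod_gt_0; lra).
    (* After subtraction of 1 the numerator is [(n+1) (exp(z L) - 1 - z/(n+1))]; the term [z L] is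
       subtracted and added, which leaves two errors of order [1/n^2]. *)
    replace (RtoC (INR n + 1) * Cexp (z * RtoC L) / (z + RtoC (INR n + 1)) - 1)
      with (RtoC (INR n + 1) * ((Cexp (z * RtoC L) - 1 - z * RtoC L) +
        z * RtoC (L - / (INR n + 1))) / (z + RtoC (INR n + 1))).
    2: { rewrite RtoC_minus, RtoC_inv by lra; field; split; [exact Q | apply RtoC_neq_0; lra]. }
    rewrite Cmod_div, Cmod_mult, Cmod_R, Rabs_pos_eq by (try exact Q; lra).
    assert (T := Cexp_taylor_2 (z * RtoC L)).
    rewrite Cmod_mult, Cmod_R, (Rabs_pos_eq L) in T by lra.
    assert (T1 : (Cmod z * L * (Cmod z * L) * exp (Cmod z * L) <=
      Cmod z * Cmod z * exp (Cmod z) * (/ INR n * / INR n))%R).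
    { assert (exp (Cmod z * L) <= exp (Cmod z))%R by (apply exp_le; nra).
      assert (0 < exp (Cmod z * L))%R by apply exp_pos.
      assert (L * L <= / INR n * / INR n)%R by nra.
      assert (0 <= Cmod z * Cmod z)%R by nra.
      replace (Cmod z * L * (Cmod z * L) * exp (Cmod z * L))%R
        with (Cmod z * Cmod z * exp (Cmod z * L) * (L * L))%R by ring.
      apply Rmult_le_compat; nra. }
    assert (T2 : (Cmod (z * RtoC (L - / (INR n + 1))) <= Cmod z * (/ INR n * / (INR n + 1)))%R).
    { rewrite Cmod_mult, Cmod_R, Rabs_pos_eq by lra; apply Rmult_le_compat_l; [lra|].
      replace (/ INR n * / (INR n + 1))%R with (/ INR n - / (INR n + 1))%R by (field; lra). lra. }
    assert (T3 := Cmod_triangle (Cexp (z * RtoC L) - 1 - z * RtoC L)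
      (z * RtoC (L - / (INR n + 1)))).
    set (X := Cexp (z * RtoC L) - 1 - z * RtoC L) in *.
    set (Y := z * RtoC (L - / (INR n + 1))) in *.
    assert (T4 : (Cmod (X + Y) <= (Cmod z * Cmod z * exp (Cmod z) + Cmod z) * (/ INR n * / INR n))%R).
    { assert (/ (INR n + 1) <= / INR n)%R by (apply Rinv_le_contravar; lra).
      assert (/ INR n * / (INR n + 1) <= / INR n * / INR n)%R by (apply Rmult_le_compat_l; lra).
      assert (Cmod z * (/ INR n * / (INR n + 1)) <= Cmod z * (/ INR n * / INR n))%R
        by (apply Rmult_le_compat_l; lra).
      lra. }
    assert (T5 : (/ Cmod (z + RtoC (INR n + 1)) <= / ((INR n + 1) / 2))%R)
      by (apply Rinv_le_contravar; lra).
    rewrite Rinv_mult; unfold K.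
    apply Rle_trans with ((INR n + 1) * Cmod (X + Y) * / ((INR n + 1) / 2))%R.
    + apply Rmult_le_compat_l; [|exact T5].
      apply Rmult_le_pos; [lra | apply Cmod_ge_0].
    + replace ((INR n + 1) * Cmod (X + Y) * / ((INR n + 1) / 2))%R with (2 * Cmod (X + Y))%R
        by (field; lra).
      lra.
  - intros n Hn; unfold gauss; apply Cmult_neq_0.
    + apply Cmult_neq_0; [|apply Cexp_neq_0].
      apply RtoC_neq_0, not_0_INR, fact_neq_0.
    + intros E; assert (P := poch_neq_0 z (S n) Hz).
      assert (F : poch z (S n) * / poch z (S n) = 1) by (apply Cinv_r, P).
      rewrite E, Cmult_0_r in F; apply (f_equal Re) in F; simpl in F; lra.
Qed.

Lemma CGamma_lim (z : C) : ~ Cis_nonpos_int z -> Clim (gauss z) (CGamma z).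
Proof.
  intros Hz; destruct (gauss_conv z Hz) as (l & Hl & _).
  replace (CGamma z) with l; [exact Hl|].
  symmetry; apply Clim_CLim_seq, Hl.
Qed.

Lemma CGamma_neq_0 (z : C) : ~ Cis_nonpos_int z -> CGamma z <> 0.
Proof.
  intros Hz; destruct (gauss_conv z Hz) as (l & Hl & N).
  rewrite (Clim_unique _ _ _ (CGamma_lim z Hz) Hl); exact N.
Qed.

(** At finite [n] the sequence for [z + 1] is [z] times that for [z], up to the factor
    [n / (z+1+n) = 1 - (z+1) / (z+1+n)], which tends to 1. *)
Lemma CGamma_succ (z : C) : ~ Cis_nonpos_int z -> CGamma (z + 1) = z * CGamma z.
Proof.
  intros Hz; assert (Hz1 := nonpos_shift z Hz).
  assert (L : Clim (fun n => z * gauss z n * (1 + - (z + 1) / (z + 1 + RtoC (INR n))))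
    (z * CGamma z * (1 + 0))).
  { apply Clim_mult; [apply Clim_mult; [apply Clim_const | apply CGamma_lim, Hz]|].
    apply Clim_plus; [apply Clim_const | apply Clim_inv_INR]. }
  replace (z * CGamma z) with (z * CGamma z * (1 + 0)) by ring.
  apply (Clim_unique (gauss (z + 1))); [apply CGamma_lim, Hz1|].
  eapply (Clim_ext_loc 1); [|exact L]; intros n Hn; unfold gauss.
  assert (P : (0 < INR n)%R) by (apply lt_0_INR; lia).
  assert (N1 := poch_neq_0 z (S n) Hz).
  assert (N2 := poch_neq_0 (z + 1) (S n) Hz1).
  assert (N0 : z <> 0).
  { intros E; apply Hz; exists O; rewrite E; simpl; ring. }
  assert (N3 : z + 1 + RtoC (INR n) <> 0).
  { intros E; apply N2; simpl; rewrite E; ring. }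
  assert (E : z * poch (z + 1) (S n) = poch z (S n) * (z + 1 + RtoC (INR n))).
  { rewrite <- poch_shift.
    change (poch z (S (S n))) with (poch z (S n) * (z + RtoC (INR (S n)))).
    rewrite S_INR, RtoC_plus; ring. }
  replace (poch (z + 1) (S n)) with (poch z (S n) * (z + 1 + RtoC (INR n)) / z)
    by (rewrite <- E; field; exact N0).
  replace (Cexp ((z + 1) * RtoC (ln (INR n)))) with (Cexp (z * RtoC (ln (INR n))) * RtoC (INR n)).
  - field; auto.
  - rewrite Cmult_plus_distr_r, Cexp_plus, Cmult_1_l; f_equal.
    rewrite <- Clog_RtoC by exact P; symmetry; apply Cexp_Clog_pos; exact P.
Qed.

(** * Beta and Dirichlet integrals *)

Lemma Re_shift (p : C) (n : nat) : Re (p + RtoC (INR n)) = (Re p + INR n)%R.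
Proof. apply re_plus. Qed.

Lemma Beta_sum (p q : C) : (2 <= Re p)%R -> (2 <= Re q)%R ->
  Beta p q = Beta (p + 1) q + Beta p (q + 1).
Proof.
  intros Hp Hq; unfold Beta.
  assert (Re (p + 1) = Re p + 1 /\ Re (q + 1) = Re q + 1)%R as [Ep Eq] by (split; apply re_plus).
  rewrite <- CInt_plus; try lra; try (apply contI_Beta; lra).
  apply CInt_ext; [lra|]; intros t Ht; rewrite !pw_succ, RtoC_minus by lra; ring.
Qed.

(** Integration of the derivative of [t^(p+1) (1-t)^(q+1)], which vanishes at both ends. *)
Lemma Beta_parts (p q : C) : (2 <= Re p)%R -> (2 <= Re q)%R ->
  (p + 1) * Beta p (q + 1) = (q + 1) * Beta (p + 1) q.
Proof.
  intros Hp Hq; unfold Beta.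
  assert (Re (p + 1) = Re p + 1 /\ Re (q + 1) = Re q + 1)%R as [Ep Eq] by (split; apply re_plus).
  assert (C1 : contI 1 (fun t => pw p t * pw (q + 1) (1 - t))) by (apply contI_Beta; lra).
  assert (C2 : contI 1 (fun t => pw (p + 1) t * pw q (1 - t))) by (apply contI_Beta; lra).
  rewrite <- !CInt_mult_l by (try assumption; lra).
  match goal with |- ?a = ?b => cut (a - b = 0) end.
  { intros E; match goal with |- ?a = ?b => transitivity (a - b + b) end; [ring | rewrite E; ring]. }
  rewrite <- CInt_minus by (try lra; apply contI_cmul; assumption).
  rewrite (CInt_der 1 (fun t => pw (p + 1) t * pw (q + 1) (1 - t))); [| lra | |].
  - replace (1 - 1)%R with 0%R by ring; rewrite !(pw_neg _ 0) by lra; ring.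
  - intros t Ht; eapply der_eq.
    + apply (der_mult (pw (p + 1)) (fun t => pw (q + 1) (1 - t))); [apply der_pw; lra|].
      apply (der_comp_R (pw (q + 1)) (fun t => 1 - t)%R t (-1)); [|apply der_pw; lra].
      auto_derive; [auto | ring].
    + rewrite !succ_pred; ring.
  - apply contI_minus; apply contI_cmul; assumption.
Qed.

Lemma Beta_up (p q : C) : (2 <= Re p)%R -> (2 <= Re q)%R ->
  (p + q + 2) * Beta p (q + 1) = (q + 1) * Beta p q.
Proof.
  intros Hp Hq; rewrite (Beta_sum p q Hp Hq), !Cmult_plus_distr_l, <- (Beta_parts p q Hp Hq); ring.
Qed.

Lemma Beta_shift (p q : C) (n : nat) : (2 <= Re p)%R -> (2 <= Re q)%R ->
  poch (p + q + 2) n * Beta p (q + RtoC (INR n)) = poch (q + 1) n * Beta p q.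
Proof.
  intros Hp Hq; induction n as [|n IH].
  - simpl; rewrite Cplus_0_r; ring.
  - rewrite S_INR, RtoC_plus.
    assert (E := Beta_up p (q + RtoC (INR n)) Hp).
    rewrite Re_shift in E; assert (Hn := pos_INR n); specialize (E ltac:(lra)).
    replace (q + (RtoC (INR n) + 1)) with (q + RtoC (INR n) + 1) by ring.
    simpl poch.
    transitivity (poch (p + q + 2) n * ((p + (q + RtoC (INR n)) + 2) *
      Beta p (q + RtoC (INR n) + 1))); [ring|].
    rewrite E.
    transitivity (poch (p + q + 2) n * Beta p (q + RtoC (INR n)) * (q + 1 + RtoC (INR n)));
      [ring|].
    rewrite IH; ring.
Qed.

Lemma CInt_pw (p : C) : (2 <= Re p)%R -> CInt (pw p) 0 1 = / (p + 1).
Proof.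
  intros Hp.
  assert (N : p + 1 <> 0).
  { intros E; apply (f_equal Re) in E; rewrite re_plus in E; simpl in E; lra. }
  assert (Cp : contI 1 (pw p)) by (apply contI_of_cont; [lra|]; intros; apply cont_pw, Hp).
  assert (E : (p + 1) * CInt (pw p) 0 1 = 1).
  { rewrite <- CInt_mult_l by (try assumption; lra).
    rewrite (CInt_der 1 (pw (p + 1))); [| lra | |apply contI_cmul, Cp].
    - rewrite pw_at_1, pw_neg by lra; ring.
    - intros t _; eapply der_eq; [apply der_pw; rewrite re_plus; simpl; lra|].
      rewrite succ_pred; reflexivity. }
  transitivity (/ (p + 1) * ((p + 1) * CInt (pw p) 0 1)); [field; exact N | rewrite E; ring].
Qed.

Lemma Beta_2 (p : C) : (2 <= Re p)%R -> Beta p 2 = 2 / ((p + 1) * (p + 2) * (p + 3)).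
Proof.
  intros Hp.
  assert (N : forall x : R, (0 <= x)%R -> p + RtoC x <> 0).
  { intros x Hx E; apply (f_equal Re) in E; rewrite re_plus in E; simpl in E; lra. }
  assert (Cp : forall x : R, (0 <= x)%R -> contI 1 (pw (p + RtoC x))).
  { intros x Hx; apply contI_of_cont; [lra|]; intros; apply cont_pw; rewrite re_plus; simpl; lra. }
  unfold Beta.
  assert (C0 := Cp 0%R ltac:(lra)); rewrite Cplus_0_r in C0.
  assert (C1 := Cp 1%R ltac:(lra)); assert (C2 := Cp 2%R ltac:(lra)).
  rewrite (CInt_ext 1 _ (fun t => (pw p t - 2 * pw (p + 1) t) + pw (p + 2) t)); [|lra|].
  2: { intros t Ht.
       replace (p + 2) with (p + 1 + 1) by ring.
       replace (RtoC 2) with (RtoC 1 + 1) at 1 by ring.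
       rewrite !pw_succ, pw_1, RtoC_minus by lra; ring. }
  assert (C1' : contI 1 (fun t => 2 * pw (p + 1) t)) by exact (contI_cmul 1 2 _ C1).
  assert (C01 : contI 1 (fun t => pw p t - 2 * pw (p + 1) t))
    by exact (contI_minus 1 _ _ C0 C1').
  assert (R1 : (2 <= Re (p + 1))%R) by (rewrite re_plus; simpl; lra).
  assert (R2 : (2 <= Re (p + 2))%R) by (rewrite re_plus; simpl; lra).
  rewrite (CInt_plus 1 _ _ Rle_0_1 C01 C2), (CInt_minus 1 _ _ Rle_0_1 C0 C1'),
    (CInt_mult_l 1 2 _ Rle_0_1 C1).
  rewrite !CInt_pw by assumption.
  replace (p + 1 + 1) with (p + 2) by ring; replace (p + 2 + 1) with (p + 3) by ring.
  field; repeat split; apply N; lra.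
Qed.

Lemma fact_poch (n : nat) : poch 3 n * 2 = RtoC (INR (fact (n + 2))).
Proof.
  induction n as [|n IH].
  - simpl; rewrite <- RtoC_mult; f_equal; ring.
  - simpl poch; simpl Nat.add; rewrite fact_simpl, mult_INR, RtoC_mult, <- IH.
    rewrite S_INR, plus_INR, !RtoC_plus; simpl; rewrite RtoC_plus; ring.
Qed.

Lemma nonpos_Re (z : C) : (0 < Re z)%R -> ~ Cis_nonpos_int z.
Proof.
  intros Hz [n Hn]; rewrite Hn in Hz; simpl in Hz; generalize (pos_INR n); lra.
Qed.

(** Euler's evaluation of the integral of [t^p (1-t)^n] as [n! / ((p+1) ... (p+n+1))]: Gauss's
    sequence is this integral times [n^(p+1)]. *)
Lemma Beta_nat (p : C) (n : nat) : (2 <= Re p)%R -> (2 <= n)%nat ->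
  Cexp ((p + 1) * RtoC (ln (INR n))) * Beta p (RtoC (INR n)) = gauss (p + 1) n.
Proof.
  intros Hp Hn; unfold gauss, Cdiv.
  rewrite (Cmult_comm (RtoC (INR (fact n)))), <- Cmult_assoc; f_equal.
  destruct n as [|[|m]]; try lia.
  assert (E := Beta_shift p 2 m Hp ltac:(simpl; lra)).
  replace (2 + RtoC (INR m)) with (RtoC (INR (S (S m)))) in E
    by (rewrite !S_INR, !RtoC_plus; ring).
  rewrite Beta_2 in E by exact Hp.
  replace (S (S m)) with (m + 2)%nat in * by lia.
  rewrite <- fact_poch.
  replace (S (m + 2)) with (S (S (S m))) by lia.
  rewrite !poch_shift.
  replace (p + 1 + 1) with (p + 2) by ring; replace (p + 2 + 1) with (p + 3) by ring.
  replace (p + 3 + 1) with (p + 2 + 2) by ring.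
  replace (2 + 1) with (RtoC 3) in E by ring.
  assert (N : forall x : R, (0 <= x)%R -> p + RtoC x <> 0).
  { intros x Hx F; apply (f_equal Re) in F; rewrite re_plus in F; simpl in F; lra. }
  assert (P : poch (p + 2 + 2) m <> 0).
  { apply poch_neq_0, nonpos_Re; rewrite !re_plus; simpl; lra. }
  transitivity (poch (p + 2 + 2) m * Beta p (RtoC (INR (m + 2))) / poch (p + 2 + 2) m);
    [field; exact P|].
  rewrite E; field; repeat split; try apply N; try lra; exact P.
Qed.

Lemma Cmod_CInt_le_CInt (f g : R -> C) :
  contI 1 f -> contI 1 g -> (forall t, (0 <= t <= 1)%R -> (Cmod (f t) <= Re (g t))%R) ->
  (Cmod (CInt f 0 1) <= Re (CInt g 0 1))%R.
Proof.
  intros Hf Hg H; rewrite <- norm_C_R.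
  apply (norm_RInt_le (V := C_R_NormedModule) f (fun t => Re (g t)) 0 1); [lra | | |].
  - intros t Ht; eapply Rle_trans; [|apply (H t Ht)]; right; apply norm_C_R.
  - apply is_CInt_is_RInt, cont_is_CInt; [lra | exact Hf].
  - exact (proj1 (cont_is_CInt 1 g Rle_0_1 Hg)).
Qed.

(** The extra factor satisfies [|(1-t)^q - 1| <= 2 |q| t]; the [t] raises the first exponent, which
    makes the difference smaller by a factor of order [1/n]. *)
Lemma Beta_diff (p q : C) (n : nat) : (2 <= Re p)%R -> (2 <= Re q)%R -> (2 <= n)%nat ->
  (Cmod (Beta p (q + RtoC (INR n)) - Beta p (RtoC (INR n))) <=
   2 * Cmod q * Cmod (Beta (RtoC (Re p) + 1) (RtoC (INR n))))%R.
Proof.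
  intros Hp Hq Hn.
  assert (Hn2 : (2 <= INR n)%R) by (apply (le_INR 2), Hn).
  assert (Hqn : (2 <= Re (q + RtoC (INR n)))%R) by (rewrite Re_shift; lra).
  assert (Hp1 : (2 <= Re (RtoC (Re p) + 1))%R) by (rewrite re_plus; simpl; lra).
  assert (C1 : contI 1 (fun t => pw p t * pw (q + RtoC (INR n)) (1 - t)))
    by (apply contI_Beta; assumption).
  assert (C2 : contI 1 (fun t => pw p t * pw (RtoC (INR n)) (1 - t)))
    by (apply contI_Beta; assumption).
  assert (C3 : contI 1 (fun t => pw (RtoC (Re p) + 1) t * pw (RtoC (INR n)) (1 - t)))
    by (apply contI_Beta; assumption).
  unfold Beta; rewrite <- CInt_minus by (try assumption; lra).
  apply Rle_trans with (Re (RtoC (2 * Cmod q) *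
    CInt (fun t => pw (RtoC (Re p) + 1) t * pw (RtoC (INR n)) (1 - t)) 0 1)).
  - rewrite <- CInt_mult_l by (try assumption; lra).
    apply Cmod_CInt_le_CInt.
    + apply contI_minus; assumption.
    + apply contI_cmul, C3.
    + intros t Ht.
      rewrite Re_scale, pw_plus, pw_succ by lra.
      replace (pw p t * (pw q (1 - t) * pw (RtoC (INR n)) (1 - t)) -
        pw p t * pw (RtoC (INR n)) (1 - t))
        with (pw p t * pw (RtoC (INR n)) (1 - t) * (pw q (1 - t) - pw q 1))
        by (rewrite pw_at_1; ring).
      assert (L := pw_Lipschitz q (1 - t) 1 Hq ltac:(lra) ltac:(lra)).
      replace (1 - t - 1)%R with (- t)%R in L by ring; rewrite Rabs_Ropp, Rabs_pos_eq in L by lra.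
      rewrite !Cmod_mult.
      rewrite <- Cmod_pw_real.
      change (RtoC (INR n)) with (RtoC (Re (RtoC (INR n)))) at 2.
      rewrite <- Cmod_pw_real, <- !RtoC_mult; simpl Re.
      assert (G := Cmod_ge_0 (pw p t)); assert (G' := Cmod_ge_0 (pw (RtoC (INR n)) (1 - t))).
      apply Rle_trans with (Cmod (pw p t) * Cmod (pw (RtoC (INR n)) (1 - t)) *
        (2 * Cmod q * t))%R; [|right; ring].
      apply Rmult_le_compat_l; [apply Rmult_le_pos; assumption | exact L].
  - rewrite Re_scale; apply Rmult_le_compat_l; [generalize (Cmod_ge_0 q); lra|].
    eapply Rle_trans; [apply Rle_abs | apply re_le_Cmod].
Qed.

(** [Beta_shift] relates [Beta p q] to [Beta p (q + n)] by a quotient of Pochhammer symbols, that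
    is, by Gauss's sequences at [q + 1] and [p + q + 2]. For large [n] the shift by [q] is
    negligible, and [n^(p+1) Beta p (q + n)] tends to [CGamma (p + 1)]. *)
Lemma Beta_Gamma (p q : C) : (2 <= Re p)%R -> (2 <= Re q)%R ->
  Beta p q * CGamma (p + q + 2) = CGamma (p + 1) * CGamma (q + 1).
Proof.
  intros Hp Hq.
  assert (Np : ~ Cis_nonpos_int (p + 1)) by (apply nonpos_Re; rewrite re_plus; simpl; lra).
  assert (Nq : ~ Cis_nonpos_int (q + 1)) by (apply nonpos_Re; rewrite re_plus; simpl; lra).
  assert (Npq : ~ Cis_nonpos_int (p + q + 2)) by (apply nonpos_Re; rewrite !re_plus; simpl; lra).
  pose (m := RtoC (Re p) + 1).
  assert (Hm : (2 <= Re m)%R) by (unfold m; rewrite re_plus; simpl; lra).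
  assert (Nm : ~ Cis_nonpos_int (m + 1)) by (apply nonpos_Re; rewrite re_plus; simpl; lra).
  assert (L1 : Clim (fun n => Cexp ((p + 1) * RtoC (ln (INR n))) * Beta p (q + RtoC (INR n)))
    (CGamma (p + 1))).
  { assert (D : Clim (fun n => Cexp ((p + 1) * RtoC (ln (INR n))) *
      (Beta p (q + RtoC (INR n)) - Beta p (RtoC (INR n)))) 0).
    (* The majorant from [Beta_diff]: since [m + 1 = Re p + 2], the product [n^(Re p + 1) Beta m n]
       is [gauss (m + 1) n / n]. The summand 0 in the denominator fits [Clim_inv_INR]. *)
    { pose (v := fun n => 2 * RtoC (Cmod q) * gauss (m + 1) n * (1 / (0 + RtoC (INR n)))).
      assert (V : Clim v 0).
      { replace (RtoC 0) with (2 * RtoC (Cmod q) * CGamma (m + 1) * 0) by ring.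
        apply Clim_mult; [|apply Clim_inv_INR].
        apply Clim_mult; [apply Clim_const | apply CGamma_lim, Nm]. }
      apply (Clim_dominated 2 _ _ (fun n => Cmod (v n))).
      - intros n Hn.
        assert (Pn : (2 <= INR n)%R) by (apply (le_INR 2), Hn).
        unfold v; rewrite <- Beta_nat by assumption.
        replace (Cexp ((p + 1) * RtoC (ln (INR n))) *
          (Beta p (q + RtoC (INR n)) - Beta p (RtoC (INR n))) - 0) with
          (Cexp ((p + 1) * RtoC (ln (INR n))) *
          (Beta p (q + RtoC (INR n)) - Beta p (RtoC (INR n)))) by ring.
        replace (m + 1) with (RtoC (Re p + 1) + 1) by (unfold m; rewrite RtoC_plus; ring).
        rewrite (Cmult_plus_distr_r (RtoC (Re p + 1)) 1), Cexp_plus, Cmult_1_l.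
        replace (Cexp (RtoC (ln (INR n)))) with (RtoC (INR n))
          by (rewrite <- Clog_RtoC by lra; symmetry; apply Cexp_Clog_pos; simpl; lra).
        replace (2 * RtoC (Cmod q) * (Cexp (RtoC (Re p + 1) * RtoC (ln (INR n))) * RtoC (INR n) *
          Beta m (RtoC (INR n))) * (1 / (0 + RtoC (INR n)))) with
          (RtoC (2 * Cmod q) * (Cexp (RtoC (Re p + 1) * RtoC (ln (INR n))) *
            Beta m (RtoC (INR n)))).
        2: { rewrite RtoC_mult; field; apply RtoC_neq_0; lra. }
        rewrite !Cmod_mult, Cmod_R, Rabs_pos_eq by (generalize (Cmod_ge_0 q); lra).
        rewrite !Cmod_Cexp.
        replace (Re ((p + 1) * RtoC (ln (INR n))))
          with (Re (RtoC (Re p + 1) * RtoC (ln (INR n)))) by (destruct p; simpl; ring).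
        assert (B := Beta_diff p q n Hp Hq Hn); fold m in B.
        assert (X := exp_pos (Re (RtoC (Re p + 1) * RtoC (ln (INR n))))).
        apply Rle_trans with (exp (Re (RtoC (Re p + 1) * RtoC (ln (INR n)))) *
          (2 * Cmod q * Cmod (Beta m (RtoC (INR n)))))%R; [|right; ring].
        apply Rmult_le_compat_l; lra.
      - rewrite <- Cmod_0; apply Clim_Cmod, V. }
    replace (CGamma (p + 1)) with (0 + CGamma (p + 1)) by ring.
    eapply (Clim_ext_loc 2); [|exact (Clim_plus _ _ _ _ D (CGamma_lim _ Np))].
    intros n Hn; simpl; rewrite <- Beta_nat by assumption; ring. }
  assert (L2 := Clim_mult _ _ _ _ L1 (CGamma_lim _ Nq)).
  (* The last factor is [(p+q+2+n) / (q+1+n)]: Gauss's denominators have [n + 1] factors, the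
     symbols in [Beta_shift] only [n]. *)
  assert (L3 : Clim (fun n => Beta p q * gauss (p + q + 2) n *
      (1 + (p + 1) / (q + 1 + RtoC (INR n)))) (Beta p q * CGamma (p + q + 2) * (1 + 0))).
  { apply Clim_mult; [apply Clim_mult; [apply Clim_const | apply CGamma_lim, Npq]|].
    apply Clim_plus; [apply Clim_const | apply Clim_inv_INR]. }
  transitivity (Beta p q * CGamma (p + q + 2) * (1 + 0)); [ring|].
  apply (Clim_unique _ _ _ L3); eapply (Clim_ext_loc 1); [|exact L2].
  intros n Hn; unfold gauss; cbv beta.
  assert (P1 := poch_neq_0 _ (S n) Nq); assert (P2 := poch_neq_0 _ (S n) Npq).
  assert (P2' := poch_neq_0 _ n Npq).
  assert (E := Beta_shift p q n Hp Hq).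
  simpl poch in P1, P2 |- *.
  assert (Q1 : q + 1 + RtoC (INR n) <> 0) by (intros F; apply P1; rewrite F; ring).
  assert (Q2 : p + q + 2 + RtoC (INR n) <> 0) by (intros F; apply P2; rewrite F; ring).
  assert (P1' := poch_neq_0 _ n Nq).
  replace (Beta p (q + RtoC (INR n))) with (poch (q + 1) n * Beta p q / poch (p + q + 2) n)
    by (rewrite <- E; field; exact P2').
  replace (Cexp ((p + q + 2) * RtoC (ln (INR n)))) with
    (Cexp ((p + 1) * RtoC (ln (INR n))) * Cexp ((q + 1) * RtoC (ln (INR n))))
    by (rewrite <- Cexp_plus; f_equal; ring).
  field; auto.
Qed.

(** * Integrality of exponents *)

(** The modulus forces the imaginary part of [p] to vanish; then the cosine of [2 PI x] is 1, so
    [sin (PI x) = 0] and [x] is an integer. *)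
Lemma mono_neq_1 (p : C) : ~ Cis_int p -> mono p <> 1.
Proof.
  intros Hp E; apply Hp.
  unfold mono in E; destruct p as [x y].
  replace (2 * RtoC PI * Ci * (x, y)) with ((- (2 * PI * y))%R, (2 * (PI * x))%R) in E
    by (apply C_ext; simpl; ring).
  assert (Hy : y = 0%R).
  { assert (M := f_equal Cmod E); rewrite Cmod_Cexp, Cmod_1 in M; simpl in M.
    rewrite <- exp_0 in M; apply exp_inv in M; generalize PI_RGT_0; nra. }
  subst y.
  assert (Hc := f_equal Re E); unfold Cexp in Hc; simpl in Hc.
  replace (- (2 * PI * 0))%R with 0%R in Hc by ring; rewrite exp_0, cos_2a_sin in Hc.
  assert (Hs : sin (PI * x) = 0%R) by nra.
  destruct (sin_eq_0_0 _ Hs) as [k Hk]; exists k.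
  replace x with (IZR k); [reflexivity|].
  apply (Rmult_eq_reg_l PI); [rewrite Hk; ring | apply PI_neq0].
Qed.

Lemma int_shift (p : C) (m : Z) : ~ Cis_int p -> ~ Cis_int (p + RtoC (IZR m)).
Proof.
  intros Hp [k Hk]; apply Hp; exists (k - m)%Z; rewrite minus_IZR, RtoC_minus, <- Hk; ring.
Qed.

Lemma int_succ (p : C) : ~ Cis_int p -> ~ Cis_int (p + 1).
Proof. apply (int_shift p 1). Qed.

Lemma int_nonpos (p : C) : ~ Cis_int p -> ~ Cis_nonpos_int p.
Proof.
  intros Hp [n Hn]; apply Hp; exists (- Z.of_nat n)%Z.
  rewrite opp_IZR, <- INR_IZR_INZ, RtoC_opp; exact Hn.
Qed.

Lemma int_neq_0 (p : C) : ~ Cis_int p -> p <> 0.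
Proof. intros Hp E; apply Hp; exists 0%Z; exact E. Qed.

(** * The Dirichlet formula for the regularized integral *)

Section Dirichlet.

Variable e : R.
Hypothesis He : (0 < e < 1 / 3)%R.

Definition dirichlet_at (p1 p2 p3 : C) : Prop :=
  Dreg p1 p2 p3 e * CGamma (p1 + p2 + p3 + 3) =
  CGamma (p1 + 1) * CGamma (p2 + 1) * CGamma (p3 + 1).

Lemma dirichlet_large (p1 p2 p3 : C) :
  ~ Cis_int p1 -> ~ Cis_int p2 -> ~ Cis_int p3 ->
  (2 <= Re p1)%R -> (2 <= Re p2)%R -> (2 <= Re p3)%R -> dirichlet_at p1 p2 p3.
Proof.
  intros N1 N2 N3 H1 H2 H3; unfold dirichlet_at.
  rewrite Dreg_Beta by (try apply mono_neq_1; assumption).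
  assert (B1 := Beta_Gamma p1 (p2 + p3 + 1) H1).
  assert (H23 : (2 <= Re (p2 + p3 + 1))%R) by (rewrite !re_plus; simpl; lra).
  specialize (B1 H23).
  replace (p1 + (p2 + p3 + 1) + 2) with (p1 + p2 + p3 + 3) in B1 by ring.
  replace (p2 + p3 + 1 + 1) with (p2 + p3 + 2) in B1 by ring.
  transitivity (Beta p1 (p2 + p3 + 1) * CGamma (p1 + p2 + p3 + 3) * Beta p2 p3); [ring|].
  rewrite B1, <- Cmult_assoc, (Cmult_comm (CGamma (p2 + p3 + 2))), (Beta_Gamma p2 p3 H2 H3); ring.
Qed.

(** The algebra of one downward step, common to the three exponents: [a] is the exponent plus 1,
    nonzero by non-integrality, and [c * G], [a * g] are the Gamma values after raising it. *)
Lemma dirichlet_descent (c a b g G D D' : C) :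
  a <> 0 -> c * D' = a * D -> D' * (c * G) = a * g * b -> D * G = g * b.
Proof.
  intros Ha E1 E2.
  transitivity (/ a * (a * D * G)); [field; exact Ha|].
  rewrite <- E1; transitivity (/ a * (D' * (c * G))); [ring|].
  rewrite E2; field; exact Ha.
Qed.

Lemma dirichlet_down1 (p1 p2 p3 : C) :
  ~ Cis_int p1 -> ~ Cis_int p2 -> ~ Cis_int p3 -> ~ Cis_nonpos_int (p1 + p2 + p3 + 3) ->
  dirichlet_at (p1 + 1) p2 p3 -> dirichlet_at p1 p2 p3.
Proof.
  unfold dirichlet_at; intros N1 N2 N3 N H; rewrite <- Cmult_assoc.
  apply (dirichlet_descent (p1 + p2 + p3 + 3) (p1 + 1) _ _ _ _ (Dreg (p1 + 1) p2 p3 e)).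
  - apply int_neq_0, int_succ, N1.
  - apply Dreg_up1; try apply mono_neq_1; assumption.
  - rewrite <- !CGamma_succ by (try exact N; apply int_nonpos, int_succ, N1).
    replace (p1 + p2 + p3 + 3 + 1) with (p1 + 1 + p2 + p3 + 3) by ring; rewrite H; ring.
Qed.

Lemma dirichlet_down2 (p1 p2 p3 : C) :
  ~ Cis_int p1 -> ~ Cis_int p2 -> ~ Cis_int p3 -> ~ Cis_nonpos_int (p1 + p2 + p3 + 3) ->
  dirichlet_at p1 (p2 + 1) p3 -> dirichlet_at p1 p2 p3.
Proof.
  unfold dirichlet_at; intros N1 N2 N3 N H.
  rewrite (Cmult_comm (CGamma (p1 + 1))), <- Cmult_assoc.
  apply (dirichlet_descent (p1 + p2 + p3 + 3) (p2 + 1) _ _ _ _ (Dreg p1 (p2 + 1) p3 e)).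
  - apply int_neq_0, int_succ, N2.
  - apply Dreg_up2; try apply mono_neq_1; assumption.
  - rewrite <- !CGamma_succ by (try exact N; apply int_nonpos, int_succ, N2).
    replace (p1 + p2 + p3 + 3 + 1) with (p1 + (p2 + 1) + p3 + 3) by ring; rewrite H; ring.
Qed.

Lemma dirichlet_down3 (p1 p2 p3 : C) :
  ~ Cis_int p1 -> ~ Cis_int p2 -> ~ Cis_int p3 -> ~ Cis_nonpos_int (p1 + p2 + p3 + 3) ->
  dirichlet_at p1 p2 (p3 + 1) -> dirichlet_at p1 p2 p3.
Proof.
  unfold dirichlet_at; intros N1 N2 N3 N H.
  rewrite (Cmult_comm (_ * _) (CGamma (p3 + 1))).
  apply (dirichlet_descent (p1 + p2 + p3 + 3) (p3 + 1) _ _ _ _ (Dreg p1 p2 (p3 + 1) e)).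
  - apply int_neq_0, int_succ, N3.
  - apply Dreg_up3; try apply mono_neq_1; assumption.
  - rewrite <- !CGamma_succ by (try exact N; apply int_nonpos, int_succ, N3).
    replace (p1 + p2 + p3 + 3 + 1) with (p1 + p2 + (p3 + 1) + 3) by ring; rewrite H; ring.
Qed.

(** Induction on how far the real parts lie below 2: each round raises all three exponents by 1. The
    condition on the total is preserved, since adding 1 cannot produce a new nonpositive integer. *)
Lemma Dreg_dirichlet (p1 p2 p3 : C) :
  ~ Cis_int p1 -> ~ Cis_int p2 -> ~ Cis_int p3 -> ~ Cis_nonpos_int (p1 + p2 + p3 + 3) ->
  Dreg p1 p2 p3 e * CGamma (p1 + p2 + p3 + 3) =
  CGamma (p1 + 1) * CGamma (p2 + 1) * CGamma (p3 + 1).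
Proof.
  assert (H : forall n p1 p2 p3, ~ Cis_int p1 -> ~ Cis_int p2 -> ~ Cis_int p3 ->
    ~ Cis_nonpos_int (p1 + p2 + p3 + 3) ->
    (2 - INR n <= Re p1)%R -> (2 - INR n <= Re p2)%R -> (2 - INR n <= Re p3)%R ->
    dirichlet_at p1 p2 p3).
  { induction n as [|n IH]; intros q1 q2 q3 N1 N2 N3 N H1 H2 H3.
    - simpl in H1, H2, H3; apply dirichlet_large; try assumption; lra.
    - rewrite S_INR in H1, H2, H3.
      assert (M1 := int_succ _ N1); assert (M2 := int_succ _ N2); assert (M3 := int_succ _ N3).
      assert (S1 : ~ Cis_nonpos_int (q1 + 1 + q2 + q3 + 3)).
      { replace (q1 + 1 + q2 + q3 + 3) with (q1 + q2 + q3 + 3 + 1) by ring.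
        apply nonpos_shift, N. }
      assert (S2 : ~ Cis_nonpos_int (q1 + 1 + (q2 + 1) + q3 + 3)).
      { replace (q1 + 1 + (q2 + 1) + q3 + 3) with (q1 + 1 + q2 + q3 + 3 + 1) by ring.
        apply nonpos_shift, S1. }
      assert (S3 : ~ Cis_nonpos_int (q1 + 1 + (q2 + 1) + (q3 + 1) + 3)).
      { replace (q1 + 1 + (q2 + 1) + (q3 + 1) + 3) with (q1 + 1 + (q2 + 1) + q3 + 3 + 1) by ring.
        apply nonpos_shift, S2. }
      apply dirichlet_down1, dirichlet_down2, dirichlet_down3; try assumption.
      apply IH; try assumption; rewrite re_plus; simpl; lra. }
  intros N1 N2 N3 N.
  destruct (INR_unbounded (2 + Rabs (Re p1) + Rabs (Re p2) + Rabs (Re p3))) as [n Hn].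
  generalize (Rabs_maj2 (Re p1)) (Rabs_maj2 (Re p2)) (Rabs_maj2 (Re p3))
    (Rabs_pos (Re p1)) (Rabs_pos (Re p2)) (Rabs_pos (Re p3)); intros.
  apply (H n); try assumption; lra.
Qed.

(** [Dreg_up1] and [Dreg_up2] iterated downward. Each step has the factor [p - n] on one side and
    [p1 + p2 + p3 + 2 - n] on the other; changing both signs turns the products into ascending
    Pochhammer symbols. *)
Lemma Dreg_lower (p1 p2 p3 : C) (n1 n2 : nat) :
  ~ Cis_int p1 -> ~ Cis_int p2 -> ~ Cis_int p3 ->
  Dreg (p1 - RtoC (INR n1)) (p2 - RtoC (INR n2)) p3 e * (poch (- p1) n1 * poch (- p2) n2) =
  poch (- (p1 + p2 + p3 + 2)) (n1 + n2) * Dreg p1 p2 p3 e.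
Proof.
  intros N1 N2 N3.
  assert (Sh : forall p n, ~ Cis_int p -> mono (p - RtoC (INR n)) <> 1).
  { intros p n Np; apply mono_neq_1.
    replace (p - RtoC (INR n)) with (p + RtoC (IZR (- Z.of_nat n)))
      by (rewrite opp_IZR, <- INR_IZR_INZ, RtoC_opp; ring).
    apply int_shift, Np. }
  assert (Ni : forall p n, p - RtoC (INR (S n)) + 1 = p - RtoC (INR n)).
  { intros p n; rewrite S_INR, RtoC_plus; ring. }
  induction n2 as [|n2 IH2].
  - induction n1 as [|n1 IH1].
    + simpl; replace (p1 - 0) with p1 by ring; replace (p2 - 0) with p2 by ring; ring.
    + assert (E := Dreg_up1 (p1 - RtoC (INR (S n1))) (p2 - RtoC (INR 0)) p3 e He
        (Sh _ _ N1) (Sh _ _ N2) (mono_neq_1 _ N3)).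
      rewrite !Ni in E; simpl poch; simpl Nat.add.
      transitivity (- ((p1 - RtoC (INR n1)) *
        Dreg (p1 - RtoC (INR (S n1))) (p2 - RtoC (INR 0)) p3 e) * (poch (- p1) n1)); [ring|].
      rewrite <- E; rewrite S_INR, RtoC_plus.
      transitivity ((- (p1 + p2 + p3 + 2) + RtoC (INR n1)) *
        (Dreg (p1 - RtoC (INR n1)) (p2 - RtoC (INR 0)) p3 e * (poch (- p1) n1 * poch (- p2) 0)));
        [simpl; ring|].
      rewrite IH1, Nat.add_0_r; ring.
  - assert (E := Dreg_up2 (p1 - RtoC (INR n1)) (p2 - RtoC (INR (S n2))) p3 e He
      (Sh _ _ N1) (Sh _ _ N2) (mono_neq_1 _ N3)).
    rewrite !Ni in E; rewrite Nat.add_succ_r; simpl poch.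
    transitivity (- ((p2 - RtoC (INR n2)) *
      Dreg (p1 - RtoC (INR n1)) (p2 - RtoC (INR (S n2))) p3 e) * (poch (- p1) n1 * poch (- p2) n2));
      [ring|].
    rewrite <- E, S_INR, RtoC_plus.
    transitivity ((- (p1 + p2 + p3 + 2) + RtoC (INR (n1 + n2))) *
      (Dreg (p1 - RtoC (INR n1)) (p2 - RtoC (INR n2)) p3 e * (poch (- p1) n1 * poch (- p2) n2)));
      [rewrite plus_INR, RtoC_plus; ring|].
    rewrite IH2; ring.
Qed.

End Dirichlet.

(** * Series *)

Definition Cser (f : nat -> C) (l : C) : Prop :=
  is_series (fun n => Re (f n)) (Re l) /\ is_series (fun n => Im (f n)) (Im l).

(** The first [n] terms, starting from the empty sum, whereas [sum_n] includes the index [n]. *)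
Fixpoint Csum (f : nat -> C) (n : nat) : C :=
  match n with O => 0 | S m => Csum f m + f m end.

Lemma Cser_CSeries (f : nat -> C) (l : C) : Cser f l -> CSeries f = l.
Proof.
  intros [H1 H2]; unfold CSeries.
  rewrite (is_series_unique _ _ H1), (is_series_unique _ _ H2); destruct l; reflexivity.
Qed.

Lemma Re_Csum (f : nat -> C) (n : nat) : sum_n (fun k => Re (f k)) n = Re (Csum f (S n)).
Proof.
  induction n as [|n IH].
  - rewrite sum_O; change (Re (f O) = 0 + Re (f O))%R; ring.
  - rewrite sum_Sn, IH; reflexivity.
Qed.

Lemma Im_Csum (f : nat -> C) (n : nat) : sum_n (fun k => Im (f k)) n = Im (Csum f (S n)).
Proof.
  induction n as [|n IH].
  - rewrite sum_O; change (Im (f O) = 0 + Im (f O))%R; ring.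
  - rewrite sum_Sn, IH; reflexivity.
Qed.

Lemma Cser_Clim (f : nat -> C) (l : C) : Cser f l <-> Clim (Csum f) l.
Proof.
  split; intros [H1 H2]; split.
  - apply is_lim_seq_incr_1; apply (is_lim_seq_ext (sum_n (fun k => Re (f k))));
      [apply Re_Csum | exact H1].
  - apply is_lim_seq_incr_1; apply (is_lim_seq_ext (sum_n (fun k => Im (f k))));
      [apply Im_Csum | exact H2].
  - apply is_lim_seq_incr_1 in H1.
    apply (is_lim_seq_ext _ (sum_n (fun k => Re (f k)))) in H1; [exact H1|].
    intros n; symmetry; apply Re_Csum.
  - apply is_lim_seq_incr_1 in H2.
    apply (is_lim_seq_ext _ (sum_n (fun k => Im (f k)))) in H2; [exact H2|].
    intros n; symmetry; apply Im_Csum.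
Qed.

Lemma Cser_ext (f g : nat -> C) (l : C) : (forall n, f n = g n) -> Cser f l -> Cser g l.
Proof.
  intros E [H1 H2]; split.
  - eapply is_series_ext; [|exact H1]; intros n; rewrite <- E; reflexivity.
  - eapply is_series_ext; [|exact H2]; intros n; rewrite <- E; reflexivity.
Qed.

Lemma Csum_plus (f g : nat -> C) (n : nat) :
  Csum (fun k => f k + g k) n = Csum f n + Csum g n.
Proof. induction n as [|n IH]; simpl; [ring | rewrite IH; ring]. Qed.

Lemma Csum_cmul (c : C) (f : nat -> C) (n : nat) : Csum (fun k => c * f k) n = c * Csum f n.
Proof. induction n as [|n IH]; simpl; [ring | rewrite IH; ring]. Qed.

Lemma Cser_plus (f g : nat -> C) (l m : C) :
  Cser f l -> Cser g m -> Cser (fun n => f n + g n) (l + m).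
Proof.
  rewrite !Cser_Clim; intros Hf Hg.
  eapply (Clim_ext_loc 0); [|exact (Clim_plus _ _ _ _ Hf Hg)].
  intros n _; symmetry; apply Csum_plus.
Qed.

Lemma Cser_cmul (c : C) (f : nat -> C) (l : C) : Cser f l -> Cser (fun n => c * f n) (c * l).
Proof.
  rewrite !Cser_Clim; intros Hf.
  eapply (Clim_ext_loc 0); [|exact (Clim_mult _ _ _ _ (Clim_const c) Hf)].
  intros n _; symmetry; apply Csum_cmul.
Qed.

Lemma Cser_zero : Cser (fun _ => 0) 0.
Proof.
  apply Cser_Clim; eapply (Clim_ext_loc 0); [|apply (Clim_const 0)].
  intros n _; induction n as [|n IH]; simpl; [reflexivity | rewrite <- IH; ring].
Qed.

Fixpoint Rsum (f : nat -> R) (n : nat) : R :=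
  match n with O => 0 | S m => Rsum f m + f m end.

Lemma Rsum_is_series (f : nat -> R) (l : R) : is_series f l -> is_lim_seq (Rsum f) l.
Proof.
  intros H; apply is_lim_seq_incr_1, (is_lim_seq_ext (sum_n f)); [|exact H].
  intros n; induction n as [|n IH]; [rewrite sum_O; simpl; ring|].
  rewrite sum_Sn, IH; reflexivity.
Qed.

Lemma Csum_tail (f : nat -> C) (M : nat -> R) (l : C) (s : R) (N : nat) :
  (forall n, (Cmod (f n) <= M n)%R) -> is_series M s -> Cser f l ->
  (Cmod (l - Csum f N) <= s - Rsum M N)%R.
Proof.
  intros HM Hs Hf; apply Cser_Clim in Hf; apply Rsum_is_series in Hs.
  assert (B : forall k, (Cmod (Csum f (k + N) - Csum f N) <= Rsum M (k + N) - Rsum M N)%R).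
  { induction k as [|k IH]; simpl.
    - replace (Csum f N - Csum f N) with (RtoC 0) by ring; rewrite Cmod_0; lra.
    - replace (Csum f (k + N) + f (k + N)%nat - Csum f N) with
        ((Csum f (k + N) - Csum f N) + f (k + N)%nat) by ring.
      eapply Rle_trans; [apply Cmod_triangle|]; specialize (HM (k + N)%nat); lra. }
  assert (L1 : is_lim_seq (fun k => Cmod (Csum f (k + N) - Csum f N)) (Cmod (l - Csum f N))).
  { apply Clim_Cmod; apply Clim_plus; [|apply (Clim_const (- Csum f N))].
    destruct Hf as [F1 F2]; split.
    - apply (is_lim_seq_incr_n (fun k => Re (Csum f k)) N) in F1; exact F1.
    - apply (is_lim_seq_incr_n (fun k => Im (Csum f k)) N) in F2; exact F2. }
  assert (L2 : is_lim_seq (fun k => Rsum M (k + N) - Rsum M N)%R (s - Rsum M N)%R).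
  { apply is_lim_seq_minus'; [|apply is_lim_seq_const].
    apply (is_lim_seq_incr_n (Rsum M) N) in Hs; exact Hs. }
  exact (is_lim_seq_le _ _ _ _ B L1 L2).
Qed.

(** The form in which the M-test is used: [V] will be the volume of the box, and [s - Rsum M N] the
    tail of the majorant. *)
Lemma Cser_uniform (f : nat -> C) (l : C) (M : nat -> R) (s V : R) :
  is_series M s -> (forall N, (Cmod (l - Csum f N) <= V * (s - Rsum M N))%R) -> Cser f l.
Proof.
  intros Hs H; apply Cser_Clim, (Clim_dominated 0 _ _ (fun N => V * (s - Rsum M N))%R).
  - intros N _; rewrite <- Cmod_opp; replace (- (Csum f N - l)) with (l - Csum f N) by ring.
    apply H.
  - replace (Finite 0) with (Finite (V * (s - s))%R) by (f_equal; ring).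
    apply is_lim_seq_mult'; [apply is_lim_seq_const|].
    apply is_lim_seq_minus'; [apply is_lim_seq_const | apply Rsum_is_series, Hs].
Qed.

(** * Fourfold integrals *)

Section CInt4.

Variables a b c d : R.
Hypotheses (Ha : (0 <= a)%R) (Hb : (0 <= b)%R) (Hc : (0 <= c)%R) (Hd : (0 <= d)%R).

(** Unfolds to the four nested integrals of [int_cell4], grouped into the variables of the two
    triangles. *)
Definition CInt4 (f : R -> R -> R -> R -> C) : C :=
  CInt2 a b (fun u1 u2 => CInt2 c d (fun u3 u4 => f u1 u2 u3 u4)).

Definition cont4 (f : R -> R -> R -> R -> C) : Prop :=
  forall q : (R * R) * (R * R), cont (fun q : (R * R) * (R * R) =>
    f (clamp a (fst (fst q))) (clamp b (snd (fst q)))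
      (clamp c (fst (snd q))) (clamp d (snd (snd q)))) q.

Lemma cont4_row (f : R -> R -> R -> R -> C) (u1 u2 : R) : cont4 f ->
  (0 <= u1 <= a)%R -> (0 <= u2 <= b)%R -> cont2 c d (f u1 u2).
Proof.
  intros Hf H1 H2 q; rewrite <- (clamp_id a u1 H1), <- (clamp_id b u2 H2).
  apply (cont_comp (fun q : R * R => ((u1, u2), q)) (fun q : (R * R) * (R * R) =>
    f (clamp a (fst (fst q))) (clamp b (snd (fst q)))
      (clamp c (fst (snd q))) (clamp d (snd (snd q))))); [|apply Hf].
  apply continuous_pair; [apply continuous_const | apply continuous_id].
Qed.

Lemma cont4_inner (f : R -> R -> R -> R -> C) : cont4 f ->
  cont2 a b (fun u1 u2 => CInt2 c d (f u1 u2)).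
Proof.
  intros Hf q.
  apply (cont_CInt2_global c d Hc Hd
    (fun q : R * R => f (clamp a (fst q)) (clamp b (snd q))) q).
  apply Hf.
Qed.

Lemma CInt4_ext (f g : R -> R -> R -> R -> C) :
  (forall u1 u2 u3 u4, (0 <= u1 <= a)%R -> (0 <= u2 <= b)%R -> (0 <= u3 <= c)%R ->
    (0 <= u4 <= d)%R -> f u1 u2 u3 u4 = g u1 u2 u3 u4) ->
  CInt4 f = CInt4 g.
Proof.
  intros E; unfold CInt4; apply (CInt2_ext a b Ha Hb); intros u1 u2 H1 H2.
  apply (CInt2_ext c d Hc Hd); intros u3 u4 H3 H4; apply E; assumption.
Qed.

Lemma cont4_plus (f g : R -> R -> R -> R -> C) : cont4 f -> cont4 g ->
  cont4 (fun u1 u2 u3 u4 => f u1 u2 u3 u4 + g u1 u2 u3 u4).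
Proof. intros Hf Hg q; apply cont_plus; [apply Hf | apply Hg]. Qed.

Lemma cont4_minus (f g : R -> R -> R -> R -> C) : cont4 f -> cont4 g ->
  cont4 (fun u1 u2 u3 u4 => f u1 u2 u3 u4 - g u1 u2 u3 u4).
Proof. intros Hf Hg q; apply cont_minus; [apply Hf | apply Hg]. Qed.

Lemma CInt4_plus (f g : R -> R -> R -> R -> C) : cont4 f -> cont4 g ->
  CInt4 (fun u1 u2 u3 u4 => f u1 u2 u3 u4 + g u1 u2 u3 u4) = CInt4 f + CInt4 g.
Proof.
  intros Hf Hg; unfold CInt4.
  rewrite <- CInt2_plus by (try assumption; apply cont4_inner; assumption).
  apply (CInt2_ext a b Ha Hb); intros u1 u2 H1 H2.
  apply (CInt2_plus c d Hc Hd); apply cont4_row; assumption.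
Qed.

Lemma CInt4_minus (f g : R -> R -> R -> R -> C) : cont4 f -> cont4 g ->
  CInt4 (fun u1 u2 u3 u4 => f u1 u2 u3 u4 - g u1 u2 u3 u4) = CInt4 f - CInt4 g.
Proof.
  intros Hf Hg; unfold CInt4.
  rewrite <- CInt2_minus by (try assumption; apply cont4_inner; assumption).
  apply (CInt2_ext a b Ha Hb); intros u1 u2 H1 H2.
  apply (CInt2_minus c d Hc Hd); apply cont4_row; assumption.
Qed.

Lemma CInt4_cmul (k : C) (f : R -> R -> R -> R -> C) : cont4 f ->
  CInt4 (fun u1 u2 u3 u4 => k * f u1 u2 u3 u4) = k * CInt4 f.
Proof.
  intros Hf; unfold CInt4.
  rewrite <- (CInt2_mult_l a b Ha Hb k) by (apply cont4_inner, Hf).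
  apply (CInt2_ext a b Ha Hb); intros u1 u2 H1 H2.
  apply (CInt2_mult_l c d Hc Hd), cont4_row; assumption.
Qed.

Lemma CInt4_separate (g h : R -> R -> C) : cont2 a b g -> cont2 c d h ->
  CInt4 (fun u1 u2 u3 u4 => g u1 u2 * h u3 u4) = CInt2 a b g * CInt2 c d h.
Proof.
  intros Hg Hh; unfold CInt4.
  rewrite <- CInt2_mult_r by assumption.
  apply (CInt2_ext a b Ha Hb); intros u1 u2 H1 H2.
  apply (CInt2_mult_l c d Hc Hd); assumption.
Qed.

Lemma Cmod_CInt4_le (f : R -> R -> R -> R -> C) (M : R) : cont4 f ->
  (forall u1 u2 u3 u4, (0 <= u1 <= a)%R -> (0 <= u2 <= b)%R -> (0 <= u3 <= c)%R ->
    (0 <= u4 <= d)%R -> (Cmod (f u1 u2 u3 u4) <= M)%R) ->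
  (Cmod (CInt4 f) <= a * b * c * d * M)%R.
Proof.
  intros Hf HM.
  replace (a * b * c * d * M)%R with (a * (b * (c * (d * M))))%R by ring.
  unfold CInt4; apply (Cmod_CInt2_le a b Ha Hb); [apply cont4_inner, Hf|].
  intros u1 u2 H1 H2; apply (Cmod_CInt2_le c d Hc Hd); [apply cont4_row; assumption|].
  intros u3 u4 H3 H4; apply HM; assumption.
Qed.

(** Weierstrass' M-test: the remainder of the series is bounded on the whole box by the tail of [M],
    and integration multiplies this at most by the volume. *)
Lemma CInt4_series (f : nat -> R -> R -> R -> R -> C) (F : R -> R -> R -> R -> C)
  (M : nat -> R) :
  (forall n, cont4 (f n)) -> cont4 F -> ex_series M ->
  (forall n u1 u2 u3 u4, (0 <= u1 <= a)%R -> (0 <= u2 <= b)%R -> (0 <= u3 <= c)%R ->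
    (0 <= u4 <= d)%R -> (Cmod (f n u1 u2 u3 u4) <= M n)%R) ->
  (forall u1 u2 u3 u4, (0 <= u1 <= a)%R -> (0 <= u2 <= b)%R -> (0 <= u3 <= c)%R ->
    (0 <= u4 <= d)%R -> Cser (fun n => f n u1 u2 u3 u4) (F u1 u2 u3 u4)) ->
  Cser (fun n => CInt4 (f n)) (CInt4 F).
Proof.
  intros Hf HF [s Hs] HM HS.
  pose (P := fun N u1 u2 u3 u4 => Csum (fun n => f n u1 u2 u3 u4) N).
  assert (HP : forall N, cont4 (P N) /\ Csum (fun n => CInt4 (f n)) N = CInt4 (P N)).
  { induction N as [|N [IH1 IH2]].
    - split; [intros q; apply cont_const|]; simpl.
      symmetry; apply Cmod_eq_0, Rle_antisym; [|apply Cmod_ge_0].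
      replace 0%R with (a * b * c * d * 0)%R by ring.
      apply Cmod_CInt4_le; [intros q; apply cont_const|].
      intros; unfold P; simpl; rewrite Cmod_0; lra.
    - split; [apply (cont4_plus (P N) (f N)); auto|].
      simpl; rewrite IH2; symmetry; apply (CInt4_plus (P N) (f N)); auto. }
  apply (Cser_uniform _ _ M s (a * b * c * d)%R Hs); intros N.
  destruct (HP N) as [H1 H2]; rewrite H2, <- CInt4_minus by assumption.
  apply Cmod_CInt4_le; [apply cont4_minus; assumption|].
  intros u1 u2 u3 u4 U1 U2 U3 U4; apply Csum_tail; auto.
Qed.

End CInt4.

(** * The binomial series *)

(** The coefficient of [w^n] in [(1 - w)^(-al)]. *)
Definition binom (al : C) (n : nat) : C := poch al n / RtoC (INR (fact n)).

Lemma fact_RtoC_neq_0 (n : nat) : RtoC (INR (fact n)) <> 0.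
Proof. apply RtoC_neq_0, not_0_INR, fact_neq_0. Qed.

Lemma binom_succ (al : C) (n : nat) :
  RtoC (INR (S n)) * binom al (S n) = (al + RtoC (INR n)) * binom al n.
Proof.
  assert (N : RtoC (INR (S n)) <> 0) by (apply RtoC_neq_0, not_0_INR; lia).
  assert (F := fact_RtoC_neq_0 n).
  unfold binom; rewrite fact_simpl, mult_INR, RtoC_mult; simpl poch; field; auto.
Qed.

Lemma bounded_of_ratio (u : nat -> R) (N : nat) :
  (forall n, (N <= n)%nat -> (u (S n) <= u n)%R) -> exists M, forall n, (u n <= M)%R.
Proof.
  intros H.
  assert (A : exists M, forall n, (n <= N)%nat -> (u n <= M)%R).
  { clear H; induction N as [|N [M HM]].
    - exists (u O); intros n Hn; replace n with O by lia; lra.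
    - exists (Rmax M (u (S N))); intros n Hn; destruct (Nat.eq_dec n (S N)) as [->|Hne].
      + apply Rmax_r.
      + eapply Rle_trans; [apply HM; lia | apply Rmax_l]. }
  destruct A as [M HM]; exists M; intros n.
  destruct (Nat.le_gt_cases n N) as [L|G]; [apply HM, L|].
  replace n with ((n - N) + N)%nat by lia.
  induction (n - N)%nat as [|k IH]; [apply HM; simpl; lia|].
  simpl; eapply Rle_trans; [apply H; lia | exact IH].
Qed.

Lemma binom_bounded (al : C) (x : R) : (0 <= x < 1)%R ->
  exists M, forall n, (Cmod (binom al n) * x ^ n <= M)%R.
Proof.
  intros Hx.
  (* From this index on the ratio bound [(|al| + n) x / (n + 1)] is at most 1. *)
  destruct (INR_lt_up (Cmod al * x / (1 - x))) as [N HN].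
  apply (bounded_of_ratio _ N); intros n Hn; specialize (HN n Hn).
  assert (Hn0 := pos_INR n); assert (G := Cmod_ge_0 al).
  assert (E : (INR (S n) * Cmod (binom al (S n)) <= (Cmod al + INR n) * Cmod (binom al n))%R).
  { rewrite <- (Rabs_pos_eq (INR (S n))) at 1 by apply pos_INR.
    rewrite <- Cmod_R, <- Cmod_mult, binom_succ, Cmod_mult.
    apply Rmult_le_compat_r; [apply Cmod_ge_0|].
    eapply Rle_trans; [apply Cmod_triangle|].
    rewrite Cmod_R, Rabs_pos_eq by exact Hn0; lra. }
  rewrite S_INR in E.
  assert (K : ((Cmod al + INR n) * x <= INR n + 1)%R).
  { apply (Rmult_lt_compat_r (1 - x)) in HN; [|lra].
    unfold Rdiv in HN; rewrite Rmult_assoc, Rinv_l in HN by lra. nra. }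
  assert (B := Cmod_ge_0 (binom al n)); assert (B' := Cmod_ge_0 (binom al (S n))).
  assert (X : (0 <= x ^ n)%R) by (apply pow_le; lra).
  apply (Rmult_le_reg_l (INR n + 1)); [lra|]; simpl.
  apply Rle_trans with ((Cmod al + INR n) * Cmod (binom al n) * (x * x ^ n))%R.
  - rewrite <- Rmult_assoc; apply Rmult_le_compat_r; [nra | exact E].
  - replace ((Cmod al + INR n) * Cmod (binom al n) * (x * x ^ n))%R
      with (((Cmod al + INR n) * x) * (Cmod (binom al n) * x ^ n))%R by ring.
    apply Rmult_le_compat_r; [nra | exact K].
Qed.

Lemma binom_summable (al : C) (x : R) : (0 <= x < 1)%R ->
  ex_series (fun n => Cmod (binom al n) * x ^ n)%R.
Proof.
  (* With [th] strictly between [x] and 1, the coefficients times [(x / th)^n] stay bounded, and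
     [th^n] is a convergent geometric factor. *)
  intros Hx; pose (th := ((1 + x) / 2)%R).
  destruct (binom_bounded al (x / th)) as [M HM].
  { unfold th; split; [apply Rmult_le_pos; [lra|]; left; apply Rinv_0_lt_compat; lra|].
    apply (Rmult_lt_reg_r ((1 + x) / 2)); [lra|].
    unfold Rdiv at 1; rewrite Rmult_assoc, Rinv_l by lra; lra. }
  apply (ex_series_le (V := R_CompleteNormedModule) _ (fun n => M * th ^ n)%R).
  - intros n; change (Rabs (Cmod (binom al n) * x ^ n) <= M * th ^ n)%R.
    assert (X : (0 <= x ^ n)%R) by (apply pow_le; lra).
    rewrite Rabs_pos_eq by (apply Rmult_le_pos; [apply Cmod_ge_0 | exact X]).
    replace (x ^ n)%R with ((x / th) ^ n * th ^ n)%R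
      by (rewrite <- Rpow_mult_distr; f_equal; unfold th; field; lra).
    rewrite <- Rmult_assoc; apply Rmult_le_compat_r; [apply pow_le; unfold th; lra | apply HM].
  - apply (ex_series_scal (V := R_NormedModule) M).
    apply ex_series_geom; unfold th; rewrite Rabs_pos_eq; lra.
Qed.

Section Binomial.

Variables al w : C.
Hypothesis Hw : (Cmod w < 1)%R.

Let dd (n : nat) : C := binom al n * Cpow w n.
(** The binomial series along the segment from 0 to [w], as a pair of real power series in [t]. *)
Let G (t : R) : C := (PSeries (fun n => Re (dd n)) t, PSeries (fun n => Im (dd n)) t).
Let G' (t : R) : C :=
  (PSeries (PS_derive (fun n => Re (dd n))) t, PSeries (PS_derive (fun n => Im (dd n))) t).

Lemma binom_radius : exists rho : R, (1 < rho)%R /\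
  Rbar_le rho (CV_radius (fun n => Re (dd n))) /\ Rbar_le rho (CV_radius (fun n => Im (dd n))).
Proof.
  assert (W := Cmod_ge_0 w).
  (* Chosen so that [rho > 1] while [|w| rho = 2 |w| / (1 + |w|)] stays below 1; thus [t = 1] lies
     inside the disc of convergence. *)
  pose (rho := (2 / (1 + Cmod w))%R); exists rho.
  assert (Hr : (1 < rho)%R).
  { unfold rho; apply (Rmult_lt_reg_r (1 + Cmod w)); [lra|].
    unfold Rdiv; rewrite Rmult_assoc, Rinv_l by lra; lra. }
  destruct (binom_bounded al (Cmod w * rho)) as [M HM].
  { split; [apply Rmult_le_pos; lra|].
    unfold rho; apply (Rmult_lt_reg_r (1 + Cmod w)); [lra|].
    replace (Cmod w * (2 / (1 + Cmod w)) * (1 + Cmod w))%R with (2 * Cmod w)%R by (field; lra).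
    lra. }
  assert (B : forall n, (Cmod (dd n) * rho ^ n <= M)%R).
  { intros n; unfold dd; rewrite Cmod_mult, Cmod_pow, Rmult_assoc, <- Rpow_mult_distr; apply HM. }
  assert (R0 : forall n, (0 <= rho ^ n)%R) by (intros n; apply pow_le; lra).
  split; [exact Hr|]; split; apply CV_radius_bounded; exists M; intros n;
    rewrite Rabs_mult, (Rabs_pos_eq (rho ^ n)) by apply R0;
    (eapply Rle_trans; [|apply (B n)]); apply Rmult_le_compat_r; try apply R0;
    [apply re_le_Cmod | apply im_le_Cmod].
Qed.

Lemma binom_inside (t : R) : (0 <= t <= 1)%R ->
  Rbar_lt (Rabs t) (CV_radius (fun n => Re (dd n))) /\
  Rbar_lt (Rabs t) (CV_radius (fun n => Im (dd n))).
Proof.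
  intros Ht; destruct binom_radius as (rho & H1 & H2 & H3).
  split; (eapply Rbar_lt_le_trans; [|eassumption]); simpl; rewrite Rabs_pos_eq; lra.
Qed.

Lemma der_G (t : R) : (0 <= t <= 1)%R -> der G t (G' t).
Proof. intros Ht; destruct (binom_inside t Ht); split; simpl; apply is_derive_PSeries; assumption. Qed.

Lemma Cser_PSeries (f : nat -> C) (t : R) :
  ex_pseries (fun n => Re (f n)) t -> ex_pseries (fun n => Im (f n)) t ->
  Cser (fun n => f n * RtoC (t ^ n))
    (PSeries (fun n => Re (f n)) t, PSeries (fun n => Im (f n)) t).
Proof.
  intros H1 H2; apply PSeries_correct in H1, H2; split.
  - eapply is_series_ext; [|exact H1]; intros n; rewrite pow_n_pow.
    change (t ^ n * Re (f n) = Re (f n * RtoC (t ^ n)))%R; destruct (f n); simpl; ring.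
  - eapply is_series_ext; [|exact H2]; intros n; rewrite pow_n_pow.
    change (t ^ n * Im (f n) = Im (f n * RtoC (t ^ n)))%R; destruct (f n); simpl; ring.
Qed.

Lemma Cser_G (t : R) : (0 <= t <= 1)%R -> Cser (fun n => dd n * RtoC (t ^ n)) (G t).
Proof.
  intros Ht; destruct (binom_inside t Ht); apply Cser_PSeries; apply CV_radius_inside; assumption.
Qed.

Lemma Cser_G' (t : R) : (0 <= t <= 1)%R ->
  Cser (fun n => RtoC (INR (S n)) * dd (S n) * RtoC (t ^ n)) (G' t).
Proof.
  intros Ht; destruct (binom_inside t Ht) as [I1 I2].
  assert (E1 : forall n, PS_derive (fun n => Re (dd n)) n = Re (RtoC (INR (S n)) * dd (S n)))
    by (intros n; rewrite Re_scale; reflexivity).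
  assert (E2 : forall n, PS_derive (fun n => Im (dd n)) n = Im (RtoC (INR (S n)) * dd (S n))).
  { intros n; rewrite Im_mult.
    change (INR (S n) * Im (dd (S n)) = INR (S n) * Im (dd (S n)) + 0 * Re (dd (S n)))%R; ring. }
  unfold G'; rewrite (PSeries_ext _ _ t E1), (PSeries_ext _ _ t E2).
  apply Cser_PSeries.
  - eapply ex_series_ext; [|apply (ex_pseries_derive _ _ I1)]; intros n; cbv beta; rewrite E1;
      reflexivity.
  - eapply ex_series_ext; [|apply (ex_pseries_derive _ _ I2)]; intros n; cbv beta; rewrite E2;
      reflexivity.
Qed.

(** The coefficient recursion [(n+1) dd(n+1) = (al + n) w dd(n)], summed. *)
Lemma binom_ode (t : R) : (0 <= t <= 1)%R -> (1 - RtoC t * w) * G' t = al * w * G t.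
Proof.
  intros Ht; assert (S1 := Cser_G t Ht); assert (S2 := Cser_G' t Ht).
  apply Cser_Clim in S1, S2.
  set (f := fun n => dd n * RtoC (t ^ n)) in *.
  set (g := fun n => RtoC (INR (S n)) * dd (S n) * RtoC (t ^ n)) in *.
  (* The last sum has one term fewer because multiplication by [t * w] shifts the coefficients; in
     the limit the lag disappears. *)
  assert (I : forall n, Csum g (S n) = al * w * Csum f (S n) + RtoC t * w * Csum g n).
  { assert (D : forall n, RtoC (INR (S n)) * dd (S n) = (al + RtoC (INR n)) * w * dd n).
    { intros n; unfold dd; rewrite Cpow_S, Cmult_assoc, binom_succ; ring. }
    induction n as [|n IH].
    - simpl; unfold f, g; rewrite D; simpl; ring.
    - change (Csum g (S n) + g (S n) = al * w * (Csum f (S n) + f (S n)) +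
        RtoC t * w * (Csum g n + g n)).
      assert (Es : g (S n) = al * w * f (S n) + RtoC t * w * g n).
      { unfold f, g; rewrite (D (S n)); simpl (t ^ S n)%R.
        rewrite RtoC_mult, S_INR, RtoC_plus; ring. }
      rewrite IH, Es; ring. }
  assert (E : G' t = al * w * G t + RtoC t * w * G' t).
  { apply (Clim_unique (fun n => Csum g (S n))).
    - destruct S2 as [A1 A2]; split.
      + apply (is_lim_seq_incr_1 (fun n => Re (Csum g n))), A1.
      + apply (is_lim_seq_incr_1 (fun n => Im (Csum g n))), A2.
    - eapply (Clim_ext_loc 0); [intros n _; symmetry; apply I|].
      apply Clim_plus; (apply Clim_mult; [apply Clim_const|]); [|exact S2].
      destruct S1 as [A1 A2]; split.
      + apply (is_lim_seq_incr_1 (fun n => Re (Csum f n))), A1.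
      + apply (is_lim_seq_incr_1 (fun n => Im (Csum f n))), A2. }
  transitivity (G' t - RtoC t * w * G' t); [ring | rewrite E at 1; ring].
Qed.

(** By the differential equation, [G t] times [(a - t a w)^al] is constant on [[0, 1]]. The factor
    [a] is carried along so that the principal logarithms of [a] and [a - a w] occur separately and
    no logarithm of a quotient has to be split. *)
Lemma binom_series_unit (a : C) : (forall t, (0 <= t <= 1)%R -> (0 < Re (a - RtoC t * (a * w)))%R) ->
  Cser dd (Cexp (al * Clog a) * Cexp (- al * Clog (a - a * w))).
Proof.
  intros Ha.
  assert (HG : Cser dd (G 1)).
  { eapply Cser_ext; [|apply (Cser_G 1); lra].
    intros n; cbv beta; rewrite pow1; apply Cmult_1_r. }
  cut (G 1 = Cexp (al * Clog a) * Cexp (- al * Clog (a - a * w)));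
    [intros <-; exact HG|].
  assert (Hc : forall t, (0 <= t <= 1)%R ->
    der (fun t => G t * Cexp (al * Clog (a - RtoC t * (a * w)))) t 0).
  { intros t Ht; assert (N := neq_0_Re_pos _ (Ha t Ht)).
    eapply der_eq.
    - apply (der_mult G (fun t => Cexp (al * Clog (a - RtoC t * (a * w))))); [apply der_G, Ht|].
      apply (der_Cexp (fun t => al * Clog (a - RtoC t * (a * w)))).
      apply (der_mult (fun _ => al) (fun t => Clog (a - RtoC t * (a * w)))); [apply der_const|].
      apply (der_Clog (fun t => a - RtoC t * (a * w))); [apply Ha, Ht|].
      apply (der_minus (fun _ => a) (fun t => RtoC t * (a * w))); [apply der_const|].
      apply (der_mult RtoC (fun _ => a * w)); [apply der_id | apply der_const].
    - transitivity (a * ((1 - RtoC t * w) * G' t - al * w * G t) *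
        Cexp (al * Clog (a - RtoC t * (a * w))) / (a - RtoC t * (a * w))).
      + field; exact N.
      + rewrite binom_ode by exact Ht; field; exact N. }
  assert (E : G 1 * Cexp (al * Clog (a - 1 * (a * w))) =
    G 0 * Cexp (al * Clog (a - 0 * (a * w)))).
  { apply C_ext; symmetry.
    - apply (eq_is_derive (V := R_NormedModule)
        (fun t => Re (G t * Cexp (al * Clog (a - RtoC t * (a * w)))))); [|lra].
      intros t Ht; apply (Hc t Ht).
    - apply (eq_is_derive (V := R_NormedModule)
        (fun t => Im (G t * Cexp (al * Clog (a - RtoC t * (a * w)))))); [|lra].
      intros t Ht; apply (Hc t Ht). }
  assert (G0 : G 0 = 1).
  { unfold G; rewrite !PSeries_0; unfold dd, binom; simpl.
    apply C_ext; simpl; field. }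
  rewrite G0 in E; replace (a - 0 * (a * w)) with a in E by ring.
  replace (a - 1 * (a * w)) with (a - a * w) in E by ring.
  rewrite Cmult_1_l in E; rewrite <- E, <- Cmult_assoc, <- Cexp_plus.
  replace (al * Clog (a - a * w) + - al * Clog (a - a * w)) with (RtoC 0) by ring.
  rewrite Cexp_0; ring.
Qed.

End Binomial.

Lemma Cexp_INR (n : nat) (z : C) : Cexp (RtoC (INR n) * z) = Cpow (Cexp z) n.
Proof.
  induction n as [|n IH]; [simpl; rewrite Cmult_0_l; apply Cexp_0|].
  rewrite S_INR, RtoC_plus, Cmult_plus_distr_r, Cexp_plus, IH, Cpow_S, Cmult_1_l; ring.
Qed.

(** The expansion of [(a - y)^(-al)] around [a]; it is applied with [a = 1], [y = y2] and with
    [a = 1 - y2], [y = y1]. *)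
Lemma binom_series (al a y : C) :
  (forall t, (0 <= t <= 1)%R -> (0 < Re (a - RtoC t * y))%R) -> (Cmod y < Cmod a)%R ->
  Cser (fun n => binom al n * Cpow y n * Cexp (- (al + RtoC (INR n)) * Clog a))
    (Cexp (- al * Clog (a - y))).
Proof.
  intros Ha Hy.
  assert (Ra : (0 < Re a)%R).
  { specialize (Ha 0%R ltac:(lra)); replace (a - 0 * y) with a in Ha by ring; exact Ha. }
  assert (Na := neq_0_Re_pos _ Ra).
  assert (Ea : Cexp (Clog a) = a) by (apply Cexp_Clog_pos, Ra).
  assert (Hw : (Cmod (y / a) < 1)%R).
  { rewrite Cmod_div by exact Na.
    assert (P : (0 < Cmod a)%R) by (apply Cmod_gt_0, Na).
    apply (Rmult_lt_reg_r (Cmod a)); [exact P|].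
    unfold Rdiv; rewrite Rmult_assoc, Rinv_l; lra. }
  assert (Ey : a * (y / a) = y) by (field; exact Na).
  assert (B := binom_series_unit al (y / a) Hw a); rewrite Ey in B; specialize (B Ha).
  apply (Cser_cmul (Cexp (- al * Clog a))) in B.
  replace (Cexp (- al * Clog a) * (Cexp (al * Clog a) * Cexp (- al * Clog (a - y))))
    with (Cexp (- al * Clog (a - y))) in B.
  2: { rewrite Cmult_assoc, <- Cexp_plus.
       replace (- al * Clog a + al * Clog a) with (RtoC 0) by ring; rewrite Cexp_0; ring. }
  eapply Cser_ext; [|exact B]; intros n; cbv beta.
  replace (- (al + RtoC (INR n)) * Clog a) with (- al * Clog a - RtoC (INR n) * Clog a) by ring.
  rewrite Cexp_minus, Cexp_INR, Ea.
  unfold Cdiv; rewrite Cpow_mult_l, Cpow_inv by exact Na; ring.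
Qed.

Lemma poch_add (z : C) (m n : nat) : poch z (m + n) = poch z m * poch (z + RtoC (INR m)) n.
Proof.
  induction n as [|n IH]; [rewrite Nat.add_0_r; simpl; ring|].
  rewrite Nat.add_succ_r; simpl; rewrite IH, plus_INR, RtoC_plus; ring.
Qed.

(** * Expansion of the integral over a product of two cells *)

Lemma cont_bounded (b : R) (f : R -> C) :
  (0 <= b)%R -> (forall v, cont f v) ->
  exists v, (0 <= v <= b)%R /\ forall w, (0 <= w <= b)%R -> (Cmod (f w) <= Cmod (f v))%R.
Proof.
  intros Hb Hf.
  destruct (continuity_ab_maj (fun v => Cmod (f v)) 0 b Hb) as [v [H1 H2]].
  - intros v _; apply continuity_pt_filterlim, continuous_Cmod, Hf.
  - exists v; split; assumption.
Qed.

(** Extreme values in two variables from the one-variable theorem: the maximum [m u] of a row is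
    attained, is continuous in [u] by [cont_tube], and has a maximum itself. *)
Lemma cont2_bounded (a b : R) (f : R -> R -> C) : (0 <= a)%R -> (0 <= b)%R -> cont2 a b f ->
  exists M, (0 <= M)%R /\
    forall u v, (0 <= u <= a)%R -> (0 <= v <= b)%R -> (Cmod (f u v) <= M)%R.
Proof.
  intros Ha Hb Hf.
  pose (g := fun u v => f (clamp a u) (clamp b v)).
  assert (Hrow : forall u v, cont (g u) v).
  { intros u v.
    apply (cont_comp (fun v : R => (u, v)) (fun q : R * R => g (fst q) (snd q))); [|apply Hf].
    apply continuous_pair; [apply continuous_const | apply continuous_id]. }
  assert (Hex : forall u, exists v, (0 <= v <= b)%R /\
    forall w, (0 <= w <= b)%R -> (Cmod (g u w) <= Cmod (g u v))%R)
    by (intros u; apply cont_bounded; auto).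
  pose (m := fun u => Cmod (g u (proj1_sig (constructive_indefinite_description _ (Hex u))))).
  assert (Hm : forall u w, (0 <= w <= b)%R -> (Cmod (g u w) <= m u)%R).
  { intros u; exact (proj2 (proj2_sig (constructive_indefinite_description _ (Hex u)))). }
  assert (Hm' : forall u, exists v, (0 <= v <= b)%R /\ m u = Cmod (g u v)).
  { intros u; eexists; split; [|reflexivity].
    exact (proj1 (proj2_sig (constructive_indefinite_description _ (Hex u)))). }
  assert (Hc : forall u, continuous m u).
  { intros u; apply filterlim_locally; intros eps.
    generalize (cont_tube b g u eps (fun v _ => Hf (u, v))).
    apply filter_imp; intros s Hs.
    assert (Tri : forall x y : C, (Cmod x <= Cmod y + Cmod (x - y))%R).
    { intros x y; replace x with (y + (x - y)) at 1 by ring; apply Cmod_triangle. }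
    change (Rabs (m s - m u) < eps)%R; apply Rabs_def1.
    - destruct (Hm' s) as (v & Hv & ->); specialize (Hs v Hv); specialize (Hm u v Hv).
      generalize (Tri (g s v) (g u v)); lra.
    - destruct (Hm' u) as (v & Hv & ->); specialize (Hs v Hv); specialize (Hm s v Hv).
      generalize (Tri (g u v) (g s v)).
      rewrite <- (Cmod_opp (g u v - g s v)).
      replace (- (g u v - g s v)) with (g s v - g u v) by ring; lra. }
  destruct (continuity_ab_maj m 0 a Ha) as [u0 [H1 H2]].
  { intros u _; apply continuity_pt_filterlim, Hc. }
  exists (m u0); split.
  - destruct (Hm' u0) as (v & _ & ->); apply Cmod_ge_0.
  - intros u v Hu Hv; eapply Rle_trans; [|apply (H1 u Hu)].
    specialize (Hm u v Hv); unfold g in Hm; rewrite !clamp_id in Hm by assumption; exact Hm.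
Qed.

Lemma cont2_ext (a b : R) (f g : R -> R -> C) : (0 <= a)%R -> (0 <= b)%R ->
  (forall u v, (0 <= u <= a)%R -> (0 <= v <= b)%R -> f u v = g u v) ->
  cont2 a b f -> cont2 a b g.
Proof.
  intros Ha Hb E Hf q; eapply cont_ext; [|apply (Hf q)].
  intros p; apply E; apply clamp_in; assumption.
Qed.

Lemma cont2_inv_pow (a b : R) (f : R -> R -> C) (n : nat) : (0 <= a)%R -> (0 <= b)%R ->
  (forall u v, (0 <= u <= a)%R -> (0 <= v <= b)%R -> f u v <> 0) ->
  cont2 a b f -> cont2 a b (fun u v => / Cpow (f u v) n).
Proof.
  intros Ha Hb N Hf q; apply cont_inv; [|apply cont_pow, Hf].
  apply Cpow_nz, N; apply clamp_in; assumption.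
Qed.

Lemma Cpow_div (x y : C) (n : nat) : y <> 0 -> Cpow (x / y) n = Cpow x n / Cpow y n.
Proof. intros Hy; unfold Cdiv; rewrite Cpow_mult_l, Cpow_inv by exact Hy; reflexivity. Qed.

Lemma Cmod_Cexp_Clog_le (al z : C) (Y : R) : (0 <= Y < 1)%R -> (1 - Y <= Cmod z <= 2)%R ->
  (Cmod (Cexp (- al * Clog z)) <=
   exp (Rabs (Re al) * (2 - ln (1 - Y)) + Rabs (Im al) * PI))%R.
Proof.
  intros HY Hz; rewrite Cmod_Cexp; apply exp_le.
  replace (Re (- al * Clog z)) with (- (Re al * ln (Cmod z)) + Im al * Carg z)%R
    by (destruct al; simpl; ring).
  assert (L0 : (ln (1 - Y) <= 0)%R) by (apply ln_le_0; lra).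
  assert (L1 : (ln (1 - Y) <= ln (Cmod z))%R) by (apply ln_le; lra).
  assert (L2 : (ln (Cmod z) <= 2)%R) by (apply ln_le_id; lra).
  assert (L3 : (Rabs (ln (Cmod z)) <= 2 - ln (1 - Y))%R) by (apply Rabs_le; lra).
  apply Rplus_le_compat.
  - eapply Rle_trans; [apply Rle_abs|]; rewrite Rabs_Ropp, Rabs_mult.
    apply Rmult_le_compat_l; [apply Rabs_pos | exact L3].
  - eapply Rle_trans; [apply Rle_abs|]; rewrite Rabs_mult.
    apply Rmult_le_compat_l; [apply Rabs_pos | apply Rabs_Carg].
Qed.

Section Pair.

Variables a b c d : R.
Hypotheses (Ha : (0 <= a)%R) (Hb : (0 <= b)%R) (Hc : (0 <= c)%R) (Hd : (0 <= d)%R).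
Variables (g z1 z3 h z2 z4 : R -> R -> C) (e1 e2 : R) (x1 x2 al : C).
Hypotheses (He1 : (0 < e1)%R) (He2 : (0 < e2)%R).
Hypotheses (Cg : cont2 a b g) (C1 : cont2 a b z1) (C3 : cont2 a b z3).
Hypotheses (Ch : cont2 c d h) (C2 : cont2 c d z2) (C4 : cont2 c d z4).
Hypothesis L13 : forall u v, (0 <= u <= a)%R -> (0 <= v <= b)%R ->
  (e1 <= Cmod (z1 u v))%R /\ (e1 <= Cmod (z3 u v))%R.
Hypothesis L24 : forall u v, (0 <= u <= c)%R -> (0 <= v <= d)%R ->
  (e2 <= Cmod (z2 u v))%R /\ (e2 <= Cmod (z4 u v))%R.

(** Uniform bounds for the moduli of [y1] and [y2] on the pair of cells, from the lower bounds [e1],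
    [e2] of the coordinates. *)
Let X : R := (Cmod x1 / (e1 * e2))%R.
Let Y : R := (Cmod x2 / (e1 * e2))%R.
Hypothesis HXY : (X + Y < 1)%R.

Let y1 (u1 u2 u3 u4 : R) : C := x1 / (z1 u1 u2 * z2 u3 u4).
Let y2 (u1 u2 u3 u4 : R) : C := x2 / (z3 u1 u2 * z4 u3 u4).

Let box (u1 u2 u3 u4 : R) : Prop :=
  (0 <= u1 <= a)%R /\ (0 <= u2 <= b)%R /\ (0 <= u3 <= c)%R /\ (0 <= u4 <= d)%R.

Lemma neq_0_of_lower (e : R) (z : C) : (0 < e)%R -> (e <= Cmod z)%R -> z <> 0.
Proof. intros H1 H2; apply Cmod_gt_0; lra. Qed.

Lemma z_neq_0 (u1 u2 u3 u4 : R) : box u1 u2 u3 u4 ->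
  z1 u1 u2 <> 0 /\ z2 u3 u4 <> 0 /\ z3 u1 u2 <> 0 /\ z4 u3 u4 <> 0.
Proof.
  intros (U1 & U2 & U3 & U4); destruct (L13 u1 u2 U1 U2), (L24 u3 u4 U3 U4).
  repeat split; first [apply (neq_0_of_lower e1); assumption | apply (neq_0_of_lower e2); assumption].
Qed.

Lemma Cmod_quot_le (x z w : C) : (e1 <= Cmod z)%R -> (e2 <= Cmod w)%R ->
  (Cmod (x / (z * w)) <= Cmod x / (e1 * e2))%R.
Proof.
  intros Hz Hw; rewrite Cmod_div, Cmod_mult by
    (apply Cmult_neq_0; [apply (neq_0_of_lower e1) | apply (neq_0_of_lower e2)]; assumption).
  apply Rmult_le_compat_l; [apply Cmod_ge_0|].
  apply Rinv_le_contravar; [nra|].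
  apply Rmult_le_compat; lra.
Qed.

Lemma y_bounds (u1 u2 u3 u4 : R) : box u1 u2 u3 u4 ->
  (Cmod (y1 u1 u2 u3 u4) <= X)%R /\ (Cmod (y2 u1 u2 u3 u4) <= Y)%R.
Proof.
  intros (U1 & U2 & U3 & U4); destruct (L13 u1 u2 U1 U2), (L24 u3 u4 U3 U4).
  split; apply Cmod_quot_le; assumption.
Qed.

Lemma X_ge_0 : (0 <= X)%R.
Proof. apply Rmult_le_pos; [apply Cmod_ge_0 | left; apply Rinv_0_lt_compat; nra]. Qed.

Lemma Y_ge_0 : (0 <= Y)%R.
Proof. apply Rmult_le_pos; [apply Cmod_ge_0 | left; apply Rinv_0_lt_compat; nra]. Qed.

Lemma Re_1_minus_pos (z : C) : (Cmod z < 1)%R -> (0 < Re (1 - z))%R.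
Proof.
  intros H; assert (R := re_le_Cmod z); assert (R' := Rle_abs (Re z)).
  change (0 < 1 - Re z)%R; lra.
Qed.

Lemma box_clamp (q : (R * R) * (R * R)) :
  box (clamp a (fst (fst q))) (clamp b (snd (fst q)))
      (clamp c (fst (snd q))) (clamp d (snd (snd q))).
Proof. repeat split; apply clamp_in; assumption. Qed.

Lemma cont4_l (f : R -> R -> C) : cont2 a b f -> cont4 a b c d (fun u1 u2 _ _ => f u1 u2).
Proof.
  intros Hf q; apply (cont_comp fst (fun p : R * R => f (clamp a (fst p)) (clamp b (snd p))));
    [apply continuous_fst | apply Hf].
Qed.

Lemma cont4_r (f : R -> R -> C) : cont2 c d f -> cont4 a b c d (fun _ _ u3 u4 => f u3 u4).
Proof.
  intros Hf q; apply (cont_comp snd (fun p : R * R => f (clamp c (fst p)) (clamp d (snd p))));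
    [apply continuous_snd | apply Hf].
Qed.

Lemma cont4_mult (f k : R -> R -> R -> R -> C) : cont4 a b c d f -> cont4 a b c d k ->
  cont4 a b c d (fun u1 u2 u3 u4 => f u1 u2 u3 u4 * k u1 u2 u3 u4).
Proof. intros Hf Hk q; apply cont_mult; [apply Hf | apply Hk]. Qed.

Lemma cont4_const (k : C) : cont4 a b c d (fun _ _ _ _ => k).
Proof. intros q; apply cont_const. Qed.

Lemma cont4_pow (f : R -> R -> R -> R -> C) (n : nat) : cont4 a b c d f ->
  cont4 a b c d (fun u1 u2 u3 u4 => Cpow (f u1 u2 u3 u4) n).
Proof. intros Hf q; apply (cont_pow _ n q (Hf q)). Qed.

Lemma cont4_y1 : cont4 a b c d y1.
Proof.
  intros q; destruct (z_neq_0 _ _ _ _ (box_clamp q)) as (N1 & N2 & _ & _).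
  apply cont_div; [apply Cmult_neq_0; assumption | apply cont_const|].
  apply cont_mult; [apply (cont4_l z1 C1 q) | apply (cont4_r z2 C2 q)].
Qed.

Lemma cont4_y2 : cont4 a b c d y2.
Proof.
  intros q; destruct (z_neq_0 _ _ _ _ (box_clamp q)) as (_ & _ & N1 & N2).
  apply cont_div; [apply Cmult_neq_0; assumption | apply cont_const|].
  apply cont_mult; [apply (cont4_l z3 C3 q) | apply (cont4_r z4 C4 q)].
Qed.

Lemma cont4_gh : cont4 a b c d (fun u1 u2 u3 u4 => g u1 u2 * h u3 u4).
Proof. apply cont4_mult; [apply cont4_l, Cg | apply cont4_r, Ch]. Qed.

Lemma cont4_Cexp_Clog (be : C) (f : R -> R -> R -> R -> C) :
  (forall u1 u2 u3 u4, box u1 u2 u3 u4 -> (0 < Re (f u1 u2 u3 u4))%R) ->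
  cont4 a b c d f -> cont4 a b c d (fun u1 u2 u3 u4 => Cexp (be * Clog (f u1 u2 u3 u4))).
Proof.
  intros P Hf q; apply cont_Cexp, cont_mult; [apply cont_const|].
  apply cont_Clog; [apply P, box_clamp | apply Hf].
Qed.

Lemma Re_pos_12 (u1 u2 u3 u4 t : R) : box u1 u2 u3 u4 -> (0 <= t <= 1)%R ->
  (0 < Re (1 - y2 u1 u2 u3 u4 - RtoC t * y1 u1 u2 u3 u4))%R.
Proof.
  intros B Ht; destruct (y_bounds _ _ _ _ B) as [B1 B2]; assert (HX := X_ge_0).
  replace (1 - y2 u1 u2 u3 u4 - RtoC t * y1 u1 u2 u3 u4)
    with (1 - (y2 u1 u2 u3 u4 + RtoC t * y1 u1 u2 u3 u4)) by ring.
  apply Re_1_minus_pos; eapply Rle_lt_trans; [apply Cmod_triangle|].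
  rewrite Cmod_mult, Cmod_R, Rabs_pos_eq by lra.
  assert (Cmod (y1 u1 u2 u3 u4) * t <= X * 1)%R
    by (apply Rmult_le_compat; try lra; apply Cmod_ge_0).
  lra.
Qed.

Definition pair_term (n1 n2 : nat) : C :=
  binom al n1 * binom (al + RtoC (INR n1)) n2 * (Cpow x1 n1 * Cpow x2 n2) *
  (CInt2 a b (fun u v => g u v * (/ Cpow (z1 u v) n1 * / Cpow (z3 u v) n2)) *
   CInt2 c d (fun u v => h u v * (/ Cpow (z2 u v) n1 * / Cpow (z4 u v) n2))).

(** The sum of [fn n1 n2] over [n2] in closed form, the term of index [n1] in the expansion of
    [((1 - y2) - y1)^(-al)] around [1 - y2]. *)
Let Fn (n1 : nat) (u1 u2 u3 u4 : R) : C :=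
  g u1 u2 * h u3 u4 * (binom al n1 * Cpow (y1 u1 u2 u3 u4) n1 *
    Cexp (- (al + RtoC (INR n1)) * Clog (1 - y2 u1 u2 u3 u4))).
Let fn (n1 n2 : nat) (u1 u2 u3 u4 : R) : C :=
  g u1 u2 * h u3 u4 * (binom al n1 * Cpow (y1 u1 u2 u3 u4) n1 *
    (binom (al + RtoC (INR n1)) n2 * Cpow (y2 u1 u2 u3 u4) n2)).

Lemma Re_pos_2 (u1 u2 u3 u4 : R) : box u1 u2 u3 u4 -> (0 < Re (1 - y2 u1 u2 u3 u4))%R.
Proof.
  intros B; replace (1 - y2 u1 u2 u3 u4) with (1 - y2 u1 u2 u3 u4 - RtoC 0 * y1 u1 u2 u3 u4)
    by ring.
  apply Re_pos_12; [exact B | lra].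
Qed.

Lemma cont4_one_minus (f : R -> R -> R -> R -> C) : cont4 a b c d f ->
  cont4 a b c d (fun u1 u2 u3 u4 => 1 - f u1 u2 u3 u4).
Proof. intros Hf q; apply cont_minus; [apply cont_const | apply Hf]. Qed.

Lemma cont4_Fn (n1 : nat) : cont4 a b c d (Fn n1).
Proof.
  apply cont4_mult; [apply cont4_gh|]; apply cont4_mult; [apply cont4_mult|].
  - apply cont4_const.
  - apply (cont4_pow y1), cont4_y1.
  - apply (cont4_Cexp_Clog _ (fun u1 u2 u3 u4 => 1 - y2 u1 u2 u3 u4)); [apply Re_pos_2|].
    apply (cont4_one_minus y2), cont4_y2.
Qed.

Lemma cont4_fn (n1 n2 : nat) : cont4 a b c d (fn n1 n2).
Proof.
  apply cont4_mult; [apply cont4_gh|].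
  apply cont4_mult; (apply cont4_mult; [apply cont4_const|]).
  - apply (cont4_pow y1), cont4_y1.
  - apply (cont4_pow y2), cont4_y2.
Qed.

Lemma CInt4_fn (n1 n2 : nat) : CInt4 a b c d (fn n1 n2) = pair_term n1 n2.
Proof.
  set (k := binom al n1 * binom (al + RtoC (INR n1)) n2 * (Cpow x1 n1 * Cpow x2 n2)).
  assert (G' : cont2 a b (fun u v => g u v * (/ Cpow (z1 u v) n1 * / Cpow (z3 u v) n2))).
  { apply cont2_mult; [exact Cg|]; apply cont2_mult;
      apply cont2_inv_pow; try assumption; intros u v Hu Hv;
      apply (neq_0_of_lower e1); try assumption; apply (L13 u v Hu Hv). }
  assert (H' : cont2 c d (fun u v => h u v * (/ Cpow (z2 u v) n1 * / Cpow (z4 u v) n2))).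
  { apply cont2_mult; [exact Ch|]; apply cont2_mult;
      apply cont2_inv_pow; try assumption; intros u v Hu Hv;
      apply (neq_0_of_lower e2); try assumption; apply (L24 u v Hu Hv). }
  unfold pair_term; fold k.
  rewrite Cmult_assoc, <- (CInt2_mult_l a b Ha Hb k _ G').
  rewrite <- (CInt4_separate a b c d Ha Hb Hc Hd); [|apply cont2_mult; [apply cont2_const | exact G'] | exact H'].
  apply (CInt4_ext a b c d Ha Hb Hc Hd); intros u1 u2 u3 u4 U1 U2 U3 U4.
  destruct (z_neq_0 u1 u2 u3 u4) as (N1 & N2 & N3 & N4); [repeat split; lra|].
  unfold fn, y1, y2, k; rewrite !Cpow_div, !Cpow_mult_l by (apply Cmult_neq_0; assumption).
  field; repeat split; apply Cpow_nz; assumption.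
Qed.

Lemma pair_cont : cont4 a b c d (fun u1 u2 u3 u4 => g u1 u2 * h u3 u4 *
    Cexp (- al * Clog (1 - x1 / (z1 u1 u2 * z2 u3 u4) - x2 / (z3 u1 u2 * z4 u3 u4)))).
Proof.
  apply cont4_mult; [apply cont4_gh|].
  apply (cont4_Cexp_Clog _ (fun u1 u2 u3 u4 => 1 - y1 u1 u2 u3 u4 - y2 u1 u2 u3 u4)).
  - intros u1 u2 u3 u4 B.
    replace (1 - y1 u1 u2 u3 u4 - y2 u1 u2 u3 u4)
      with (1 - y2 u1 u2 u3 u4 - RtoC 1 * y1 u1 u2 u3 u4) by ring.
    apply Re_pos_12; [exact B | lra].
  - apply cont4_minus; [apply (cont4_one_minus y1), cont4_y1 | apply cont4_y2].
Qed.

(** The order of expansion follows the iterated sum in [Fser]: for fixed [n1] the powers of [1 - y2]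
    are expanded in [y2], and the outer series is that in [y1 / (1 - y2)]. The two M-tests need
    [Y < 1] and [X / (1 - Y) < 1]. *)
Lemma pair_series : exists r,
  (forall n1, Cser (pair_term n1) (r n1)) /\
  Cser r (CInt4 a b c d (fun u1 u2 u3 u4 => g u1 u2 * h u3 u4 *
    Cexp (- al * Clog (1 - x1 / (z1 u1 u2 * z2 u3 u4) - x2 / (z3 u1 u2 * z4 u3 u4))))).
Proof.
  destruct (cont2_bounded a b g Ha Hb Cg) as (Mg & Pg & Bg).
  destruct (cont2_bounded c d h Hc Hd Ch) as (Mh & Ph & Bh).
  assert (HX := X_ge_0); assert (HY := Y_ge_0).
  assert (Bgh : forall u1 u2 u3 u4, box u1 u2 u3 u4 ->
    (Cmod (g u1 u2 * h u3 u4) <= Mg * Mh)%R).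
  { intros u1 u2 u3 u4 (U1 & U2 & U3 & U4); rewrite Cmod_mult.
    apply Rmult_le_compat; try apply Cmod_ge_0; [apply Bg | apply Bh]; assumption. }
  assert (By1 : forall n u1 u2 u3 u4, box u1 u2 u3 u4 ->
    (Cmod (binom al n * Cpow (y1 u1 u2 u3 u4) n) <= Cmod (binom al n) * X ^ n)%R).
  { intros n u1 u2 u3 u4 B; rewrite Cmod_mult, Cmod_pow.
    apply Rmult_le_compat_l; [apply Cmod_ge_0|]; apply pow_incr.
    split; [apply Cmod_ge_0 | apply (y_bounds _ _ _ _ B)]. }
  exists (fun n1 => CInt4 a b c d (Fn n1)); split.
  - intros n1; eapply Cser_ext; [intros n2; apply CInt4_fn|].
    apply (CInt4_series a b c d Ha Hb Hc Hd (fn n1) (Fn n1)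
      (fun n2 => (Mg * Mh) * (Cmod (binom al n1) * X ^ n1) *
        (Cmod (binom (al + RtoC (INR n1)) n2) * Y ^ n2))%R).
    + apply cont4_fn.
    + apply cont4_Fn.
    + apply (ex_series_scal (V := R_NormedModule)), binom_summable; lra.
    + intros n2 u1 u2 u3 u4 U1 U2 U3 U4.
      assert (B : box u1 u2 u3 u4) by (repeat split; lra).
      unfold fn; rewrite Cmod_mult, Rmult_assoc.
      apply Rmult_le_compat; try apply Cmod_ge_0; [apply Bgh, B|].
      rewrite Cmod_mult; apply Rmult_le_compat; try apply Cmod_ge_0; [apply By1, B|].
      rewrite Cmod_mult, Cmod_pow; apply Rmult_le_compat_l; [apply Cmod_ge_0|].
      apply pow_incr; split; [apply Cmod_ge_0 | apply (y_bounds _ _ _ _ B)].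
    + intros u1 u2 u3 u4 U1 U2 U3 U4.
      assert (B : box u1 u2 u3 u4) by (repeat split; lra).
      destruct (y_bounds _ _ _ _ B) as [B1 B2].
      apply Cser_cmul, Cser_cmul.
      eapply Cser_ext; [|apply (binom_series (al + RtoC (INR n1)) 1 (y2 u1 u2 u3 u4))].
      * intros n2; cbv beta.
        replace (Clog 1) with (RtoC 0) by (rewrite Clog_RtoC, ln_1 by lra; reflexivity).
        rewrite Cmult_0_r, Cexp_0; ring.
      * intros t Ht; apply Re_1_minus_pos; rewrite Cmod_mult, Cmod_R, Rabs_pos_eq by lra.
        generalize (Cmod_ge_0 (y2 u1 u2 u3 u4)); nra.
      * rewrite Cmod_1; lra.
  (* Bounds [|(1 - y2)^(-al)|], as [1 - Y <= |1 - y2| <= 2]. *)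
  - pose (Q := exp (Rabs (Re al) * (2 - ln (1 - Y)) + Rabs (Im al) * PI)).
    assert (HQ : (0 < Q)%R) by apply exp_pos.
    (* The bound for [|y1 / (1 - y2)|]; it is below 1 exactly when [X + Y < 1]. *)
    pose (x := (X / (1 - Y))%R).
    assert (Hx : (0 <= x < 1)%R).
    { unfold x; split; [apply Rmult_le_pos; [lra|]; left; apply Rinv_0_lt_compat; lra|].
      apply (Rmult_lt_reg_r (1 - Y)); [lra|].
      unfold Rdiv; rewrite Rmult_assoc, Rinv_l; lra. }
    apply (CInt4_series a b c d Ha Hb Hc Hd Fn _
      (fun n1 => (Mg * Mh) * Q * (Cmod (binom al n1) * x ^ n1))%R).
    + apply cont4_Fn.
    + exact pair_cont.
    + apply (ex_series_scal (V := R_NormedModule)), binom_summable, Hx.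
    + intros n1 u1 u2 u3 u4 U1 U2 U3 U4.
      assert (B : box u1 u2 u3 u4) by (repeat split; lra).
      destruct (y_bounds _ _ _ _ B) as [B1 B2]; assert (R2 := Re_pos_2 _ _ _ _ B).
      set (z := 1 - y2 u1 u2 u3 u4) in *.
      assert (Z : (1 - Y <= Cmod z <= 2)%R).
      { split.
        - assert (T := Cmod_triangle z (y2 u1 u2 u3 u4)).
          replace (z + y2 u1 u2 u3 u4) with (RtoC 1) in T by (unfold z; ring).
          rewrite Cmod_1 in T; lra.
        - unfold z, Cminus; eapply Rle_trans; [apply Cmod_triangle|].
          rewrite Cmod_opp, Cmod_1; lra. }
      unfold Fn; fold z; rewrite Cmod_mult, Rmult_assoc.
      apply Rmult_le_compat; try apply Cmod_ge_0; [apply Bgh, B|].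
      rewrite Cmod_mult.
      apply Rle_trans with ((Cmod (binom al n1) * X ^ n1) * (Q * / (1 - Y) ^ n1))%R.
      * apply Rmult_le_compat; try apply Cmod_ge_0; [apply By1, B|].
        replace (- (al + RtoC (INR n1)) * Clog z) with
          (- al * Clog z - RtoC (INR n1) * Clog z) by ring.
        rewrite Cexp_minus, Cexp_INR, Cexp_Clog_pos by exact R2.
        assert (Nz : z <> 0) by (apply neq_0_Re_pos, R2).
        rewrite Cmod_div, Cmod_pow by (apply Cpow_nz, Nz).
        apply Rmult_le_compat; [apply Cmod_ge_0 | | |].
        -- left; apply Rinv_0_lt_compat, pow_lt; lra.
        -- apply Cmod_Cexp_Clog_le; lra.
        -- apply Rinv_le_contravar; [apply pow_lt; lra | apply pow_incr; lra].
      * right; unfold x, Rdiv; rewrite Rpow_mult_distr, pow_inv; ring.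
    + intros u1 u2 u3 u4 U1 U2 U3 U4.
      assert (B : box u1 u2 u3 u4) by (repeat split; lra).
      destruct (y_bounds _ _ _ _ B) as [B1 B2].
      apply Cser_cmul.
      replace (1 - x1 / (z1 u1 u2 * z2 u3 u4) - x2 / (z3 u1 u2 * z4 u3 u4))
        with (1 - y2 u1 u2 u3 u4 - y1 u1 u2 u3 u4) by (unfold y1, y2; ring).
      apply binom_series.
      * intros t Ht; apply Re_pos_12; assumption.
      * assert (T := Cmod_triangle (1 - y2 u1 u2 u3 u4) (y2 u1 u2 u3 u4)).
        replace (1 - y2 u1 u2 u3 u4 + y2 u1 u2 u3 u4) with (RtoC 1) in T by ring.
        rewrite Cmod_1 in T; lra.
Qed.

End Pair.

(** * The cells of [reg] *)

Definition jac2 (K : cell2) (u v : R) : C :=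
  CDerive (fun s => pt1 K s v) u * CDerive (fun s => pt2 K u s) v -
  CDerive (fun s => pt1 K u s) v * CDerive (fun s => pt2 K s v) u.

Definition weight (p1 p2 p3 : C) (K : cell2) (u v : R) : C :=
  Cexp (p1 * lg1 K u v + p2 * lg2 K u v + p3 * lg3 K u v).

Definition Icell (p1 p2 p3 : C) (K : cell2) : C :=
  CInt2 (len1 K) (len2 K) (fun u v => weight p1 p2 p3 K u v * jac2 K u v).

Definition has_partials (f : R -> R -> C) (u v : R) : Prop :=
  (exists l, der (fun s => f s v) u l) /\ (exists l, der (fun s => f u s) v l).

(** What the expansion and the Jacobian computation use about a cell, collected so that the three
    kinds are treated alike in every product. *)
Record regular_cell (e : R) (K : cell2) : Prop := RegularCell {
  rc_len1 : (0 <= len1 K)%R;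
  rc_len2 : (0 <= len2 K)%R;
  rc_pt1 : cont2 (len1 K) (len2 K) (pt1 K);
  rc_pt2 : cont2 (len1 K) (len2 K) (pt2 K);
  rc_form : forall p1 p2 p3,
    cont2 (len1 K) (len2 K) (fun u v => weight p1 p2 p3 K u v * jac2 K u v);
  rc_partial : forall u v, has_partials (pt1 K) u v /\ has_partials (pt2 K) u v;
  rc_lower : forall u v, in_box2 K u v -> (e <= Cmod (pt1 K u v))%R /\ (e <= Cmod (pt2 K u v))%R
}.

Lemma Cmod_ge_of_Re (e : R) (z : C) : (e <= Re z)%R -> (e <= Cmod z)%R.
Proof. intros H; eapply Rle_trans; [exact H|]; eapply Rle_trans; [apply Rle_abs | apply re_le_Cmod]. Qed.

Section Reg.

Variables (q1 q2 q3 : C) (e : R).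
Hypothesis He : (0 < e < 1 / 3)%R.

Lemma seg_lower (u v : R) : (0 <= v <= 1)%R -> (e <= Cmod (seg e u v))%R.
Proof.
  intros Hv; apply Cmod_ge_of_Re; generalize (COS_bound u); intros Hc.
  replace (Re (seg e u v)) with (e + v * (1 - 2 * e - Re (circ e u)))%R
    by (rewrite seg_eq; simpl; ring).
  rewrite Re_circ.
  assert (0 <= 1 - 2 * e - e * cos u)%R by nra. nra.
Qed.

Lemma third_lower (u v : R) : (e <= Cmod (third e u v))%R.
Proof.
  apply Cmod_ge_of_Re; generalize (COS_bound u) (COS_bound v); intros Hc Hd.
  replace (Re (third e u v)) with (1 - Re (circ e u) - Re (circ e v))%R by (simpl; ring).
  rewrite !Re_circ; nra.
Qed.

Lemma circ_lower (u : R) : (e <= Cmod (circ e u))%R.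
Proof. rewrite Cmod_circ; lra. Qed.

Let Hpi := two_PI_ge_0.

Ltac partials := intros u v; split; split; eexists; cbv beta; der_auto.

Ltac cont_pt :=
  apply cont2_of_cont; [lra | lra |]; intros u v _ _; cbv beta; cont_auto.

Lemma cell_S (K : cell2) :
  len1 K = 1%R -> len2 K = 1%R ->
  pt1 K = (fun u _ => sig1 e u) -> pt2 K = (fun u v => sig2 e u v) ->
  (forall p1 p2 p3 u v, weight p1 p2 p3 K u v = wS p1 p2 p3 e u v) ->
  regular_cell e K /\ forall p1 p2 p3, Icell p1 p2 p3 K = IS p1 p2 p3 e.
Proof.
  intros L1 L2 P1 P2 W.
  assert (J : forall u v, jac2 K u v = JS e u).
  { intros u v; unfold jac2; rewrite P1, P2.
    rewrite (der_CDerive _ _ _ (der_sig1_u e u)), (der_CDerive _ _ _ (der_sig2_v e u v)),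
      (der_CDerive _ _ _ (der_sig2_u e u v)), (der_CDerive _ _ _ (der_const (sig1 e u) v)).
    unfold JS; ring. }
  assert (E : forall p1 p2 p3 u v, weight p1 p2 p3 K u v * jac2 K u v =
    wS p1 p2 p3 e u v * JS e u) by (intros; rewrite W, J; reflexivity).
  split; [constructor; rewrite ?L1, ?L2, ?P1, ?P2|]; try lra.
  - cont_pt.
  - cont_pt.
  - intros p1 p2 p3; eapply cont2_ext; [lra | lra | intros u v _ _; symmetry; apply E |].
    apply cont2_S, He.
  - partials.
  - intros u v [Hu Hv]; rewrite L1 in Hu; rewrite L2 in Hv.
    split; apply Cmod_ge_of_Re; unfold sig1, sig2; simpl.
    + assert (0 <= (1 - 3 * e) * u)%R by nra. lra.
    + assert (0 <= (1 - u) * v)%R by nra. assert (0 <= (1 - 3 * e) * ((1 - u) * v))%R by nra. lra.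
  - intros p1 p2 p3; unfold Icell; rewrite L1, L2; apply CInt2_ext; [lra | lra|].
    intros; apply E.
Qed.

(** The functions [s1], [s2], [s3] permute the exponents cyclically into the order expected by [wE],
    the encircled form first. *)
Lemma cell_E (K : cell2) (s1 s2 s3 : C -> C -> C -> C) :
  len1 K = (2 * PI)%R -> len2 K = 1%R ->
  cont2 (2 * PI) 1 (pt1 K) -> cont2 (2 * PI) 1 (pt2 K) ->
  (forall u v, has_partials (pt1 K) u v /\ has_partials (pt2 K) u v) ->
  (forall u v, (0 <= v <= 1)%R -> (e <= Cmod (pt1 K u v))%R /\ (e <= Cmod (pt2 K u v))%R) ->
  (forall u v, jac2 K u v = JE e u) ->
  (forall p1 p2 p3 u v, weight p1 p2 p3 K u v =
    wE (s1 p1 p2 p3) (s2 p1 p2 p3) (s3 p1 p2 p3) e u v) ->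
  regular_cell e K /\ forall p1 p2 p3,
    Icell p1 p2 p3 K = IE (s1 p1 p2 p3) (s2 p1 p2 p3) (s3 p1 p2 p3) e.
Proof.
  intros L1 L2 P1 P2 D B J W.
  assert (E : forall p1 p2 p3 u v, weight p1 p2 p3 K u v * jac2 K u v =
    wE (s1 p1 p2 p3) (s2 p1 p2 p3) (s3 p1 p2 p3) e u v * JE e u)
    by (intros; rewrite W, J; reflexivity).
  split; [constructor; rewrite ?L1, ?L2|]; try assumption; try lra.
  - intros p1 p2 p3; eapply cont2_ext; [lra | lra | intros u v _ _; symmetry; apply E |].
    apply cont2_E, He.
  - intros u v [Hu Hv]; rewrite L2 in Hv; apply B, Hv.
  - intros p1 p2 p3; unfold Icell; rewrite L1, L2; apply CInt2_ext; [lra | lra|].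
    intros; apply E.
Qed.

Lemma cell_T (K : cell2) (s1 s2 s3 : C -> C -> C -> C) :
  len1 K = (2 * PI)%R -> len2 K = (2 * PI)%R ->
  cont2 (2 * PI) (2 * PI) (pt1 K) -> cont2 (2 * PI) (2 * PI) (pt2 K) ->
  (forall u v, has_partials (pt1 K) u v /\ has_partials (pt2 K) u v) ->
  (forall u v, (e <= Cmod (pt1 K u v))%R /\ (e <= Cmod (pt2 K u v))%R) ->
  (forall u v, jac2 K u v = JT e u v) ->
  (forall p1 p2 p3 u v, weight p1 p2 p3 K u v =
    wT (s1 p1 p2 p3) (s2 p1 p2 p3) (s3 p1 p2 p3) e u v) ->
  regular_cell e K /\ forall p1 p2 p3,
    Icell p1 p2 p3 K = IT (s1 p1 p2 p3) (s2 p1 p2 p3) (s3 p1 p2 p3) e.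
Proof.
  intros L1 L2 P1 P2 D B J W.
  assert (E : forall p1 p2 p3 u v, weight p1 p2 p3 K u v * jac2 K u v =
    wT (s1 p1 p2 p3) (s2 p1 p2 p3) (s3 p1 p2 p3) e u v * JT e u v)
    by (intros; rewrite W, J; reflexivity).
  split; [constructor; rewrite ?L1, ?L2|]; try assumption; try lra.
  - intros p1 p2 p3; eapply cont2_ext; [lra | lra | intros u v _ _; symmetry; apply E |].
    apply cont2_T, He.
  - intros u v _; apply B.
  - intros p1 p2 p3; unfold Icell; rewrite L1, L2; apply CInt2_ext; [lra | lra|].
    intros; apply E.
Qed.

(** The first four arguments are the partial derivatives of [pt1] in [u], [pt1] in [v], [pt2] in
    [u], [pt2] in [v]; the last is the relation [Ci * Ci = -1] for [ring]. *)
Ltac solve_cell d11 d12 d21 d22 Hi :=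
  repeat match goal with K := _ : cell2 |- context [?K'] => constr_eq K K'; unfold K end;
  cbn [pt1 pt2 len1 len2];
  lazymatch goal with
  | |- @eq R _ _ => reflexivity
  | |- cont2 _ _ _ => cont_pt
  | |- forall u v, has_partials _ u v /\ _ => partials
  | |- forall u v, jac2 _ u v = _ =>
      intros u v; unfold jac2; cbn [pt1 pt2];
      rewrite (der_CDerive _ _ _ (d11 u v)), (der_CDerive _ _ _ (d22 u v)),
        (der_CDerive _ _ _ (d12 u v)), (der_CDerive _ _ _ (d21 u v));
      unfold JE, JT; rewrite ?RtoC_minus; ring [Hi]
  | |- forall p1 p2 p3 u v, weight _ _ _ _ _ _ = _ =>
      intros p1 p2 p3 u v; unfold weight, wE, wT; cbn [lg1 lg2 lg3]; f_equal; ring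
  | |- _ => intros; split; first [apply circ_lower | apply third_lower | apply seg_lower; lra]
  end.

(** The exponents [p] of the integrand may differ from the exponents [q] of the chain as long as the
    monodromies agree: the expansion shifts the former by integers while the chain stays fixed. *)
Lemma reg_cells :
  (forall K, In K (reg q1 q2 q3 e) -> regular_cell e K) /\
  forall p1 p2 p3, mono p1 = mono q1 -> mono p2 = mono q2 -> mono p3 = mono q3 ->
    fold_right (fun K acc => coef2 K * Icell p1 p2 p3 K + acc) 0 (reg q1 q2 q3 e) =
    Dreg p1 p2 p3 e.
Proof.
  assert (Hi : Ci * Ci = -(1)) by (apply C_ext; simpl; ring).
  unfold reg.
  set (K1 := Cell2 1 _ _ _ _ _ _ _).
  set (K2 := Cell2 (/ (Cexp (2 * RtoC PI * Ci * q1) - 1)) _ _ _ _ _ _ _).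
  set (K3 := Cell2 (/ (Cexp (2 * RtoC PI * Ci * q2) - 1)) _ _ _ _ _ _ _).
  set (K4 := Cell2 (/ (Cexp (2 * RtoC PI * Ci * q3) - 1)) _ _ _ _ _ _ _).
  set (K5 := Cell2 (/ (Cexp (2 * RtoC PI * Ci * q1) - 1) * _) _ _ _ _ _ _ _).
  set (K6 := Cell2 (/ (Cexp (2 * RtoC PI * Ci * q2) - 1) * _) _ _ _ _ _ _ _).
  set (K7 := Cell2 (/ (Cexp (2 * RtoC PI * Ci * q3) - 1) * _) _ _ _ _ _ _ _).
  destruct (cell_S K1) as [R1 V1]; try reflexivity.
  destruct (cell_E K2 (fun a b c => a) (fun a b c => b) (fun a b c => c)) as [R2 V2].
  1-8: solve_cell (fun u v : R => der_circ_u e u) (fun u v : R => der_const (circ e u) v)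
    (fun u v => der_seg_u e u v) (fun u v => der_seg_v e u v) Hi.
  destruct (cell_E K3 (fun a b c => b) (fun a b c => c) (fun a b c => a)) as [R3 V3].
  1-8: solve_cell (fun u v : R => der_seg_u e u (1 - v)) (fun u v => der_seg_v' e u v)
    (fun u v : R => der_circ_u e u) (fun u v : R => der_const (circ e u) v) Hi.
  destruct (cell_E K4 (fun a b c => c) (fun a b c => a) (fun a b c => b)) as [R4 V4].
  1-8: solve_cell (fun u v => der_seg_u e u v) (fun u v => der_seg_v e u v)
    (fun u v : R => der_seg_u e u (1 - v)) (fun u v => der_seg_v' e u v) Hi.
  destruct (cell_T K5 (fun a b c => a) (fun a b c => b) (fun a b c => c)) as [R5 V5].
  1-8: solve_cell (fun u v : R => der_circ_u e u) (fun u v : R => der_const (circ e u) v)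
    (fun u v : R => der_const (circ e v) u) (fun u v : R => der_circ_u e v) Hi.
  destruct (cell_T K6 (fun a b c => b) (fun a b c => c) (fun a b c => a)) as [R6 V6].
  1-8: solve_cell (fun u v => der_third_u e u v) (fun u v => der_third_v e u v)
    (fun u v : R => der_circ_u e u) (fun u v : R => der_const (circ e u) v) Hi.
  destruct (cell_T K7 (fun a b c => c) (fun a b c => a) (fun a b c => b)) as [R7 V7].
  1-8: solve_cell (fun u v : R => der_const (circ e v) u) (fun u v : R => der_circ_u e v)
    (fun u v => der_third_u e u v) (fun u v => der_third_v e u v) Hi.
  split.
  - intros K [<-|[<-|[<-|[<-|[<-|[<-|[<-|[]]]]]]]]; assumption.
  - intros p1 p2 p3 E1 E2 E3.
    cbn [fold_right]; rewrite V1, V2, V3, V4, V5, V6, V7.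
    unfold Dreg; rewrite E1, E2, E3; unfold mono.
    cbn [coef2 K1 K2 K3 K4 K5 K6 K7]; ring.
Qed.

End Reg.

(** * Evaluation of the integral over the cycle *)

Lemma Cdet_succ (m : nat) (M : nat -> nat -> C) :
  Cdet (S m) M = Csum (fun j => Cpow (-1) j * M O j *
    Cdet m (fun i k => M (S i) (if Nat.ltb k j then k else S k))) (S m).
Proof.
  assert (E : forall (f : nat -> C) n, sum_n (G := C_AbelianMonoid) f n = Csum f (S n)).
  { intros f n; induction n as [|n IH]; [rewrite sum_O; simpl; ring|].
    rewrite sum_Sn, IH; reflexivity. }
  apply E.
Qed.

(** In the order [t1, t3, t2, t4] the last two coordinates depend on the second triangle only, so
    the lower left block of the Jacobian matrix vanishes. *)
Lemma Cdet4_block (M : nat -> nat -> C) :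
  M 2%nat O = 0 -> M 2%nat 1%nat = 0 -> M 3%nat O = 0 -> M 3%nat 1%nat = 0 ->
  Cdet 4 M = (M O O * M 1%nat 1%nat - M O 1%nat * M 1%nat O) *
    (M 2%nat 2%nat * M 3%nat 3%nat - M 2%nat 3%nat * M 3%nat 2%nat).
Proof.
  intros H1 H2 H3 H4.
  repeat (rewrite Cdet_succ; cbn [Csum Nat.ltb Nat.leb]).
  cbn [Cdet]; rewrite ?H1, ?H2, ?H3, ?H4; cbn [Cpow]; ring.
Qed.

Lemma der_quot_l (x c : C) (f : R -> C) (t : R) (l : C) : f t <> 0 -> c <> 0 -> der f t l ->
  der (fun s => x / (f s * c)) t (- x * l / (f t * f t * c)).
Proof.
  intros Hf Hc H; eapply der_eq.
  - apply (der_mult (fun _ => x) (fun s => / (f s * c))); [apply der_const|].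
    apply (der_inv (fun s => f s * c)); [apply Cmult_neq_0; assumption|].
    apply (der_mult f (fun _ => c)); [exact H | apply der_const].
  - field; auto.
Qed.

(** The derivatives of [x1 / (s1 s2)] in [s1] and of [x2 / (s3 s4)] in [s3] each bring a minus sign;
    the two cancel. *)
Lemma jac_dt_iota11 (x1 x2 : C) (K L : cell2) (u1 u2 u3 u4 : R) :
  has_partials (pt1 K) u1 u2 -> has_partials (pt2 K) u1 u2 ->
  has_partials (pt1 L) u3 u4 -> has_partials (pt2 L) u3 u4 ->
  pt1 K u1 u2 <> 0 -> pt2 K u1 u2 <> 0 -> pt1 L u3 u4 <> 0 -> pt2 L u3 u4 <> 0 ->
  let s := prod_pt K L u1 u2 u3 u4 in
  jac_dt (fun u1 u2 u3 u4 => iota11 x1 x2 (prod_pt K L u1 u2 u3 u4)) u1 u2 u3 u4 =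
  x1 * x2 / (Defs.c1 s * Defs.c1 s * c2 s * (c3 s * c3 s) * c4 s) * (jac2 K u1 u2 * jac2 L u3 u4).
Proof.
  intros [[a11 A11] [a12 A12]] [[a21 A21] [a22 A22]] [[b11 B11] [b12 B12]] [[b21 B21] [b22 B22]]
    N1 N3 N2 N4 s.
  unfold jac_dt; rewrite Cdet4_block by
    (unfold partial, dt_coord, iota11, prod_pt; cbn [Defs.c1 c2 c3 c4];
     apply der_CDerive, der_const).
  unfold partial, dt_coord, iota11, prod_pt; cbn [Defs.c1 c2 c3 c4].
  rewrite (der_CDerive _ _ _ (der_quot_l x1 _ (fun s => pt1 K s u2) _ _ N1 N2 A11)),
    (der_CDerive _ _ _ (der_quot_l x2 _ (fun s => pt2 K u1 s) _ _ N3 N4 A22)),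
    (der_CDerive _ _ _ (der_quot_l x1 _ (fun s => pt1 K u1 s) _ _ N1 N2 A12)),
    (der_CDerive _ _ _ (der_quot_l x2 _ (fun s => pt2 K s u2) _ _ N3 N4 A21)).
  unfold jac2.
  rewrite (der_CDerive _ _ _ A11), (der_CDerive _ _ _ A12), (der_CDerive _ _ _ A21),
    (der_CDerive _ _ _ A22), (der_CDerive _ _ _ B11), (der_CDerive _ _ _ B12),
    (der_CDerive _ _ _ B21), (der_CDerive _ _ _ B22).
  unfold s, prod_pt; cbn [Defs.c1 c2 c3 c4]; field; auto.
Qed.

Lemma mono_IZR (k : Z) : mono (RtoC (IZR k)) = 1.
Proof.
  induction k as [|k IH|k IH] using Z.peano_ind.
  - unfold mono; rewrite Cmult_0_r; apply Cexp_0.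
  - rewrite succ_IZR, RtoC_plus, mono_shift; exact IH.
  - unfold Z.pred; rewrite plus_IZR, RtoC_plus.
    replace (RtoC (IZR k) + RtoC (IZR (-1))) with (RtoC (IZR k) - 1)
      by (unfold Cminus; rewrite <- RtoC_opp; reflexivity).
    rewrite mono_pred; exact IH.
Qed.

Lemma cis_period (y : R) : exists th, (0 <= th <= 2 * PI)%R /\ cis th = cis y.
Proof.
  assert (Hpi := PI_RGT_0).
  pose (k := Int_part (y / (2 * PI))).
  exists (y - 2 * PI * IZR k)%R; split.
  - destruct (base_Int_part (y / (2 * PI))) as [H1 H2]; fold k in H1, H2.
    assert (E : y = (y / (2 * PI) * (2 * PI))%R) by (field; lra).
    split.
    + assert (IZR k * (2 * PI) <= y / (2 * PI) * (2 * PI))%R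
        by (apply Rmult_le_compat_r; lra). lra.
    + assert (y / (2 * PI) * (2 * PI) <= (IZR k + 1) * (2 * PI))%R
        by (apply Rmult_le_compat_r; lra). lra.
  - rewrite <- (Cmult_1_r (cis _)), <- (mono_IZR k); unfold cis, mono; rewrite <- Cexp_plus.
    f_equal; rewrite RtoC_minus, !RtoC_mult; ring.
Qed.

(** The angle is normalized to [[0, 2 PI]], the parameter range of a torus cell. *)
Lemma polar (lx : C) : exists th, (0 <= th <= 2 * PI)%R /\
  Cexp lx = RtoC (Cmod (Cexp lx)) * cis th.
Proof.
  destruct (cis_period (Im lx)) as (th & Hth & E); exists th; split; [exact Hth|].
  rewrite E, Cmod_Cexp; unfold cis, Cexp; apply C_ext; simpl.
  - replace (0 * Im lx - 1 * 0)%R with 0%R by ring.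
    replace (0 * 0 + 1 * Im lx)%R with (Im lx) by ring.
    rewrite exp_0; ring.
  - replace (0 * Im lx - 1 * 0)%R with 0%R by ring.
    replace (0 * 0 + 1 * Im lx)%R with (Im lx) by ring.
    rewrite exp_0; ring.
Qed.

(** On the product of the tori over [s1 = s3 = 0] and [s2 = s4 = 0] the phases of the two
    terms can be chosen independently. *)
Lemma close_to_origin_sum (a2 a3 b1 b2 b3 b4 : C) (e1 e2 : R) (lx1 lx2 : C) :
  (0 < e1)%R -> (0 < e2)%R ->
  close_to_origin a2 a3 b1 b2 b3 b4 e1 e2 (Cexp lx1) (Cexp lx2) ->
  (Cmod (Cexp lx1) / (e1 * e2) + Cmod (Cexp lx2) / (e1 * e2) < 1)%R.
Proof.
  intros He1 He2 H; assert (Hpi := PI_RGT_0).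
  destruct (polar lx1) as (t1 & T1 & E1); destruct (polar lx2) as (t2 & T2 & E2).
  specialize (H (circ e1 t1) (circ e1 t2) (circ e2 0) (circ e2 0)).
  set (r1 := Cmod (Cexp lx1)) in *; set (r2 := Cmod (Cexp lx2)) in *.
  assert (N1 := cis_neq_0 t1); assert (N2 := cis_neq_0 t2).
  assert (M1 : RtoC e1 <> 0) by (apply RtoC_neq_0; lra).
  assert (M2 : RtoC e2 <> 0) by (apply RtoC_neq_0; lra).
  rewrite E1, E2 in H.
  replace (_ / _ + _) with (RtoC (r1 / (e1 * e2) + r2 / (e1 * e2))) in H.
  2: { rewrite !circ_cis, cis_0, RtoC_plus, !RtoC_div, !RtoC_mult by nra; field; auto. }
  rewrite Cmod_R in H; eapply Rle_lt_trans; [apply Rle_abs | apply H].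
  - unfold reg1, reg; eexists; exists t1, t2; split; [right; right; right; right; left; reflexivity|].
    split; [split; assumption | split; reflexivity].
  - unfold reg2, reg; eexists; exists 0%R, 0%R;
      split; [right; right; right; right; left; reflexivity|].
    split; [split; cbn [len1 len2]; lra | split; reflexivity].
Qed.

(** * Iterated double series and sums over lists of cells *)

(** Iterated convergence with [n1] outside, matching the nested [CSeries] of [Fser]. *)
Definition Cser2 (T : nat -> nat -> C) (l : C) : Prop :=
  exists r, (forall n1, Cser (T n1) (r n1)) /\ Cser r l.

Lemma Cser2_plus (S T : nat -> nat -> C) (l m : C) :
  Cser2 S l -> Cser2 T m -> Cser2 (fun n1 n2 => S n1 n2 + T n1 n2) (l + m).
Proof.
  intros (r & H1 & H2) (q & H3 & H4); exists (fun n => r n + q n); split.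
  - intros n; apply Cser_plus; [apply H1 | apply H3].
  - apply Cser_plus; assumption.
Qed.

Lemma Cser2_cmul (c : C) (T : nat -> nat -> C) (l : C) :
  Cser2 T l -> Cser2 (fun n1 n2 => c * T n1 n2) (c * l).
Proof.
  intros (r & H1 & H2); exists (fun n => c * r n); split.
  - intros n; apply Cser_cmul, H1.
  - apply Cser_cmul, H2.
Qed.

Lemma Cser2_zero : Cser2 (fun _ _ => 0) 0.
Proof. exists (fun _ => 0); split; [intros _|]; apply Cser_zero. Qed.

Lemma Cser2_ext (S T : nat -> nat -> C) (l : C) :
  (forall n1 n2, S n1 n2 = T n1 n2) -> Cser2 S l -> Cser2 T l.
Proof.
  intros E (r & H1 & H2); exists r; split; [|exact H2].
  intros n; eapply Cser_ext; [apply E | apply H1].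
Qed.

Lemma Cser2_CSeries (T : nat -> nat -> C) (l : C) :
  Cser2 T l -> CSeries (fun n1 => CSeries (T n1)) = l.
Proof.
  intros (r & H1 & H2); apply Cser_CSeries; eapply Cser_ext; [|exact H2].
  intros n; symmetry; apply Cser_CSeries, H1.
Qed.

(** With [F := int_cell4] this is convertible to [int_chain4]. *)
Definition Clsum {A : Type} (F : A -> C) (l : list A) : C :=
  fold_right (fun x acc => F x + acc) 0 l.

Lemma Cser2_list {A : Type} (T : A -> nat -> nat -> C) (V : A -> C) (l : list A) :
  (forall x, In x l -> Cser2 (T x) (V x)) ->
  Cser2 (fun n1 n2 => Clsum (fun x => T x n1 n2) l) (Clsum V l).
Proof.
  induction l as [|x l IH]; intros H; simpl; [apply Cser2_zero|].
  apply Cser2_plus; [apply H; left; reflexivity | apply IH; intros y Hy; apply H; right; exact Hy].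
Qed.

Lemma Clsum_app {A : Type} (F : A -> C) (l m : list A) : Clsum F (l ++ m) = Clsum F l + Clsum F m.
Proof. induction l as [|x l IH]; simpl; [ring | rewrite IH; ring]. Qed.

Lemma Clsum_cmul {A : Type} (c : C) (F : A -> C) (l : list A) :
  Clsum (fun x => c * F x) l = c * Clsum F l.
Proof. induction l as [|x l IH]; simpl; [ring | rewrite IH; ring]. Qed.

Lemma Clsum_map {A B : Type} (F : B -> C) (f : A -> B) (l : list A) :
  Clsum F (map f l) = Clsum (fun x => F (f x)) l.
Proof. induction l as [|x l IH]; simpl; [reflexivity | rewrite IH; reflexivity]. Qed.

Lemma Clsum_ext {A : Type} (F G : A -> C) (l : list A) :
  (forall x, In x l -> F x = G x) -> Clsum F l = Clsum G l.
Proof.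
  induction l as [|x l IH]; intros H; simpl; [reflexivity|].
  rewrite (H x (or_introl eq_refl)), IH; [reflexivity|]; intros y Hy; apply H; right; exact Hy.
Qed.

Lemma Clsum_prod {A B : Type} (F : A -> C) (G : B -> C) (l : list A) (m : list B) :
  Clsum (fun p => F (fst p) * G (snd p)) (list_prod l m) = Clsum F l * Clsum G m.
Proof.
  induction l as [|x l IH]; simpl; [ring|].
  rewrite Clsum_app, IH, Clsum_map; simpl; rewrite Clsum_cmul; ring.
Qed.

(** The chosen logarithms are logarithms of the coordinates, so dividing by integral powers lowers
    the exponents without a change of branch. *)
Lemma weight_lower (p1 p2 p3 : C) (n1 n2 : nat) (K : cell2) (u v : R) :
  Cexp (lg1 K u v) = pt1 K u v -> Cexp (lg2 K u v) = pt2 K u v ->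
  weight (p1 - RtoC (INR n1)) (p2 - RtoC (INR n2)) p3 K u v =
  weight p1 p2 p3 K u v * (/ Cpow (pt1 K u v) n1 * / Cpow (pt2 K u v) n2).
Proof.
  intros E1 E2; unfold weight; rewrite <- E1, <- E2, <- !Cexp_INR, <- !Cexp_opp, <- !Cexp_plus.
  f_equal; ring.
Qed.

(** * The integral over the cycle as a double series *)

Section Final.

Variables (a1 a2 a3 b1 b2 b3 b4 : C) (e1 e2 : R) (lx1 lx2 : C).
Hypotheses (he1 : (0 < e1 < 1 / 3)%R) (he2 : (0 < e2 < 1 / 3)%R).
Hypothesis hx : close_to_origin a2 a3 b1 b2 b3 b4 e1 e2 (Cexp lx1) (Cexp lx2).

Let x1 : C := Cexp lx1.
Let x2 : C := Cexp lx2.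
Let al : C := a1 - b1 - b3 + 2.
Let pref : C := Cexp ((1 - b1) * lx1) * Cexp ((1 - b3) * lx2).
Let R1 : list cell2 := reg1 a3 b1 b3 e1.
Let R2 : list cell2 := reg2 a2 b1 b2 b3 b4 e2.

(** The shifts come from [y1^n1 y2^n2], which contains [s1^(-n1) s3^(-n2)] on the first triangle and
    [s2^(-n1) s4^(-n2)] on the second; [n1 = n2 = 0] gives the original weight. *)
Let w1 (n1 n2 : nat) : cell2 -> R -> R -> C :=
  weight (b1 - 2 - RtoC (INR n1)) (b3 - 2 - RtoC (INR n2)) (- a3).
Let w2 (n1 n2 : nat) : cell2 -> R -> R -> C :=
  weight (b1 - b2 - 1 - RtoC (INR n1)) (b3 - b4 - 1 - RtoC (INR n2)) (b2 + b4 - a2 - 2).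

Let V (KL : cell2 * cell2) : C :=
  let (K, L) := KL in
  CInt4 (len1 K) (len2 K) (len1 L) (len2 L) (fun u1 u2 u3 u4 =>
    w1 0 0 K u1 u2 * jac2 K u1 u2 * (w2 0 0 L u3 u4 * jac2 L u3 u4) *
    Cexp (- al * Clog (1 - x1 / (pt1 K u1 u2 * pt1 L u3 u4) - x2 / (pt2 K u1 u2 * pt2 L u3 u4)))).

Let binoms (n1 n2 : nat) : C :=
  binom al n1 * binom (al + RtoC (INR n1)) n2 * (Cpow x1 n1 * Cpow x2 n2).

Let I1 (n1 n2 : nat) : cell2 -> C :=
  Icell (b1 - 2 - RtoC (INR n1)) (b3 - 2 - RtoC (INR n2)) (- a3).
Let I2 (n1 n2 : nat) : cell2 -> C :=
  Icell (b1 - b2 - 1 - RtoC (INR n1)) (b3 - b4 - 1 - RtoC (INR n2)) (b2 + b4 - a2 - 2).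

Lemma pair_Cser2 (K L : cell2) : In K R1 -> In L R2 ->
  Cser2 (fun n1 n2 => binoms n1 n2 * (I1 n1 n2 K * I2 n1 n2 L)) (V (K, L)).
Proof.
  intros HK HL.
  assert (RK := proj1 (reg_cells _ _ _ e1 he1) K HK).
  assert (RL := proj1 (reg_cells _ _ _ e2 he2) L HL).
  assert (LK := rc_len1 _ _ RK); assert (LK' := rc_len2 _ _ RK).
  assert (LL := rc_len1 _ _ RL); assert (LL' := rc_len2 _ _ RL).
  assert (HXY := close_to_origin_sum a2 a3 b1 b2 b3 b4 e1 e2 lx1 lx2 ltac:(lra) ltac:(lra) hx).
  destruct (pair_series (len1 K) (len2 K) (len1 L) (len2 L) LK LK' LL LL'
    (fun u v => w1 0 0 K u v * jac2 K u v) (pt1 K) (pt2 K)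
    (fun u v => w2 0 0 L u v * jac2 L u v) (pt1 L) (pt2 L) e1 e2 x1 x2 al
    ltac:(lra) ltac:(lra) (rc_form _ _ RK _ _ _) (rc_pt1 _ _ RK) (rc_pt2 _ _ RK)
    (rc_form _ _ RL _ _ _) (rc_pt1 _ _ RL) (rc_pt2 _ _ RL)
    (fun u v Hu Hv => rc_lower _ _ RK u v (conj Hu Hv))
    (fun u v Hu Hv => rc_lower _ _ RL u v (conj Hu Hv)) HXY) as (r & H1 & H2).
  apply (Cser2_ext (pair_term (len1 K) (len2 K) (len1 L) (len2 L)
    (fun u v => w1 0 0 K u v * jac2 K u v) (pt1 K) (pt2 K)
    (fun u v => w2 0 0 L u v * jac2 L u v) (pt1 L) (pt2 L) x1 x2 al)).
  2: exists r; split; assumption.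
  assert (Z : forall p, p - RtoC (INR 0) = p) by (intros; simpl; ring).
  intros n1 n2.
  assert (EK : CInt2 (len1 K) (len2 K) (fun u v => w1 0 0 K u v * jac2 K u v *
    (/ Cpow (pt1 K u v) n1 * / Cpow (pt2 K u v) n2)) = I1 n1 n2 K).
  { apply (CInt2_ext _ _ LK LK'); intros u v Hu Hv.
    destruct (reg_logs _ _ _ _ _ _ _ he1 HK (conj Hu Hv)) as (E1 & E2 & _).
    unfold w1; rewrite !Z, (weight_lower _ _ _ n1 n2) by assumption; ring. }
  assert (EL : CInt2 (len1 L) (len2 L) (fun u v => w2 0 0 L u v * jac2 L u v *
    (/ Cpow (pt1 L u v) n1 * / Cpow (pt2 L u v) n2)) = I2 n1 n2 L).
  { apply (CInt2_ext _ _ LL LL'); intros u v Hu Hv.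
    destruct (reg_logs _ _ _ _ _ _ _ he2 HL (conj Hu Hv)) as (E1 & E2 & _).
    unfold w2; rewrite !Z, (weight_lower _ _ _ n1 n2) by assumption; ring. }
  unfold pair_term; rewrite EK, EL; reflexivity.
Qed.

(** [jac_dt_iota11] produces exactly the factor [x1 x2 / (s1^2 s2 s3^2 s4)] that [Delta11_pullback]
    expects, leaving the two cell Jacobians for the factors [w1] and [w2]. *)
Lemma integrand_eq (K L : cell2) (u1 u2 u3 u4 : R) : In K R1 -> In L R2 ->
  in_box2 K u1 u2 -> in_box2 L u3 u4 ->
  u_branch a1 a2 a3 b1 b2 b3 b4 (logs11 x1 x2 lx1 lx2 K L u1 u2 u3 u4) *
  jac_dt (fun u1 u2 u3 u4 => iota11 x1 x2 (prod_pt K L u1 u2 u3 u4)) u1 u2 u3 u4 =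
  pref * (w1 0 0 K u1 u2 * jac2 K u1 u2 * (w2 0 0 L u3 u4 * jac2 L u3 u4) *
    Cexp (- al * Clog (1 - x1 / (pt1 K u1 u2 * pt1 L u3 u4) - x2 / (pt2 K u1 u2 * pt2 L u3 u4)))).
Proof.
  intros HK HL BK BL.
  assert (RK := proj1 (reg_cells _ _ _ e1 he1) K HK).
  assert (RL := proj1 (reg_cells _ _ _ e2 he2) L HL).
  destruct (rc_partial _ _ RK u1 u2) as [D1 D2]; destruct (rc_partial _ _ RL u3 u4) as [D3 D4].
  destruct (rc_lower _ _ RK u1 u2 BK) as [M1 M2]; destruct (rc_lower _ _ RL u3 u4 BL) as [M3 M4].
  assert (E := jac_dt_iota11 x1 x2 K L u1 u2 u3 u4 D1 D2 D3 D4
    (neq_0_of_lower e1 _ ltac:(lra) M1) (neq_0_of_lower e1 _ ltac:(lra) M2)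
    (neq_0_of_lower e2 _ ltac:(lra) M3) (neq_0_of_lower e2 _ ltac:(lra) M4)).
  cbv zeta in E; rewrite E, Cmult_assoc; clear E.
  assert (P := Delta11_pullback a1 a2 a3 b1 b2 b3 b4 e1 e2 x1 x2 lx1 lx2 K L u1 u2 u3 u4
    he1 he2 eq_refl eq_refl HK HL BK BL).
  cbv zeta in P; rewrite P; clear P.
  assert (Z : forall p, p - RtoC (INR 0) = p) by (intros; simpl; ring).
  unfold w1, w2, weight; rewrite !Z, !Cexp_plus.
  replace (b1 + b3 - a1 - 2) with (- al) by (unfold al; ring).
  unfold prod_pt; cbn [Defs.c1 c2 c3 c4]; unfold pref; ring.
Qed.

Lemma int_chain4_V :
  int_chain4 (Delta11 a1 a2 a3 b1 b2 b3 b4 e1 e2 x1 x2 lx1 lx2) =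
  pref * Clsum (fun KL => coef2 (fst KL) * coef2 (snd KL) * V KL) (list_prod R1 R2).
Proof.
  unfold Delta11.
  change (Clsum int_cell4 (map (fun KL : cell2 * cell2 => let (K, L) := KL in
         Cell4 (coef2 K * coef2 L) (len1 K) (len2 K) (len1 L) (len2 L)
           (fun u1 u2 u3 u4 => iota11 x1 x2 (prod_pt K L u1 u2 u3 u4))
           (fun u1 u2 u3 u4 =>
              u_branch a1 a2 a3 b1 b2 b3 b4 (logs11 x1 x2 lx1 lx2 K L u1 u2 u3 u4)))
      (list_prod R1 R2)) = pref * Clsum (fun KL => coef2 (fst KL) * coef2 (snd KL) * V KL)
      (list_prod R1 R2)).
  rewrite Clsum_map, <- Clsum_cmul; apply Clsum_ext; intros [K L] HKL.
  apply in_prod_iff in HKL; destruct HKL as [HK HL]; cbn [fst snd].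
  assert (RK := proj1 (reg_cells _ _ _ e1 he1) K HK).
  assert (RL := proj1 (reg_cells _ _ _ e2 he2) L HL).
  assert (LK := rc_len1 _ _ RK); assert (LK' := rc_len2 _ _ RK).
  assert (LL := rc_len1 _ _ RL); assert (LL' := rc_len2 _ _ RL).
  unfold int_cell4; cbn [coef4 box1 box2 box3 box4 load4 map4].
  transitivity (coef2 K * coef2 L * (pref * V (K, L))); [|ring].
  apply (f_equal (Cmult (coef2 K * coef2 L))).
  assert (HXY := close_to_origin_sum a2 a3 b1 b2 b3 b4 e1 e2 lx1 lx2 ltac:(lra) ltac:(lra) hx).
  unfold V.
  pose (G := fun u1 u2 u3 u4 => w1 0 0 K u1 u2 * jac2 K u1 u2 * (w2 0 0 L u3 u4 * jac2 L u3 u4) *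
    Cexp (- al * Clog (1 - x1 / (pt1 K u1 u2 * pt1 L u3 u4) - x2 / (pt2 K u1 u2 * pt2 L u3 u4)))).
  assert (CG : cont4 (len1 K) (len2 K) (len1 L) (len2 L) G).
  { apply (pair_cont (len1 K) (len2 K) (len1 L) (len2 L) LK LK' LL LL'
    (fun u v => w1 0 0 K u v * jac2 K u v) (pt1 K) (pt2 K)
    (fun u v => w2 0 0 L u v * jac2 L u v) (pt1 L) (pt2 L) e1 e2 x1 x2 al
    ltac:(lra) ltac:(lra) (rc_form _ _ RK _ _ _) (rc_pt1 _ _ RK) (rc_pt2 _ _ RK)
    (rc_form _ _ RL _ _ _) (rc_pt1 _ _ RL) (rc_pt2 _ _ RL)
    (fun u v Hu Hv => rc_lower _ _ RK u v (conj Hu Hv))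
    (fun u v Hu Hv => rc_lower _ _ RL u v (conj Hu Hv)) HXY). }
  transitivity (CInt4 (len1 K) (len2 K) (len1 L) (len2 L)
    (fun u1 u2 u3 u4 => pref * G u1 u2 u3 u4)).
  - change (CInt4 (len1 K) (len2 K) (len1 L) (len2 L) (fun u1 u2 u3 u4 =>
      u_branch a1 a2 a3 b1 b2 b3 b4 (logs11 x1 x2 lx1 lx2 K L u1 u2 u3 u4) *
      jac_dt (fun u1 u2 u3 u4 => iota11 x1 x2 (prod_pt K L u1 u2 u3 u4)) u1 u2 u3 u4) =
      CInt4 (len1 K) (len2 K) (len1 L) (len2 L) (fun u1 u2 u3 u4 => pref * G u1 u2 u3 u4)).
    apply (CInt4_ext _ _ _ _ LK LK' LL LL'); intros u1 u2 u3 u4 U1 U2 U3 U4.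
    apply integrand_eq; try assumption; split; assumption.
  - apply (CInt4_cmul _ _ _ _ LK LK' LL LL' pref G CG).
Qed.

Lemma mono_minus_INR (p : C) (n : nat) : mono (p - RtoC (INR n)) = mono p.
Proof.
  induction n as [|n IH]; [f_equal; simpl; ring|].
  rewrite <- IH, <- (mono_pred (p - RtoC (INR n))), S_INR, RtoC_plus; f_equal; ring.
Qed.

(** For fixed [n1] and [n2] the sum over pairs of cells factors into a sum over each triangle's
    cells, and each of these is a [Dreg] with lowered exponents. *)
Lemma chain_series :
  Cser2 (fun n1 n2 => binom al n1 * binom (al + RtoC (INR n1)) n2 * (Cpow x1 n1 * Cpow x2 n2) *
    (Dreg (b1 - 2 - RtoC (INR n1)) (b3 - 2 - RtoC (INR n2)) (- a3) e1 *
     Dreg (b1 - b2 - 1 - RtoC (INR n1)) (b3 - b4 - 1 - RtoC (INR n2)) (b2 + b4 - a2 - 2) e2))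
    (Clsum (fun KL => coef2 (fst KL) * coef2 (snd KL) * V KL) (list_prod R1 R2)).
Proof.
  eapply Cser2_ext; [|apply (Cser2_list (fun KL n1 n2 => coef2 (fst KL) * coef2 (snd KL) *
    (binoms n1 n2 * (I1 n1 n2 (fst KL) * I2 n1 n2 (snd KL)))))].
  - intros n1 n2; cbv beta.
    rewrite (Clsum_ext _ (fun KL => binoms n1 n2 *
      ((coef2 (fst KL) * I1 n1 n2 (fst KL)) * (coef2 (snd KL) * I2 n1 n2 (snd KL)))))
      by (intros; ring).
    rewrite Clsum_cmul.
    rewrite (Clsum_prod (fun K => coef2 K * I1 n1 n2 K) (fun L => coef2 L * I2 n1 n2 L)).
    unfold binoms; f_equal; f_equal.
    + exact (proj2 (reg_cells (b1 - 2) (b3 - 2) (- a3) e1 he1) _ _ _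
        (mono_minus_INR _ _) (mono_minus_INR _ _) eq_refl).
    + exact (proj2 (reg_cells (b1 - b2 - 1) (b3 - b4 - 1) (b2 + b4 - a2 - 2) e2 he2) _ _ _
        (mono_minus_INR _ _) (mono_minus_INR _ _) eq_refl).
  - intros [K L] HKL; apply in_prod_iff in HKL; destruct HKL as [HK HL].
    apply Cser2_cmul, pair_Cser2; assumption.
Qed.

Lemma int_chain4_series : exists S,
  int_chain4 (Delta11 a1 a2 a3 b1 b2 b3 b4 e1 e2 x1 x2 lx1 lx2) = pref * S /\
  Cser2 (fun n1 n2 => binom al n1 * binom (al + RtoC (INR n1)) n2 * (Cpow x1 n1 * Cpow x2 n2) *
    (Dreg (b1 - 2 - RtoC (INR n1)) (b3 - 2 - RtoC (INR n2)) (- a3) e1 *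
     Dreg (b1 - b2 - 1 - RtoC (INR n1)) (b3 - b4 - 1 - RtoC (INR n2)) (b2 + b4 - a2 - 2) e2)) S.
Proof. eexists; split; [apply int_chain4_V | apply chain_series]. Qed.

End Final.

Lemma poch_1 (n : nat) : poch 1 n = RtoC (INR (fact n)).
Proof.
  induction n as [|n IH]; [reflexivity|].
  rewrite fact_simpl, mult_INR, RtoC_mult, <- IH, S_INR, RtoC_plus; simpl; ring.
Qed.

Lemma int_opp (p : C) : ~ Cis_int p -> ~ Cis_int (- p).
Proof.
  intros H [k Hk]; apply H; exists (- k)%Z; rewrite opp_IZR, RtoC_opp, <- Hk; ring.
Qed.

Lemma int_shift_eq (p q : C) (m : Z) : ~ Cis_int p -> q = p + RtoC (IZR m) -> ~ Cis_int q.
Proof. intros H ->; apply int_shift, H. Qed.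

Theorem corollary3p3 (a1 a2 a3 b1 b2 b3 b4 : C)
  (hb1 : ~ Cis_int b1) (hb3 : ~ Cis_int b3) (ha3 : ~ Cis_int a3)
  (hb12 : ~ Cis_int (b1 - b2)) (hb34 : ~ Cis_int (b3 - b4))
  (hb24 : ~ Cis_int (b2 + b4 - a2))
  (hc2 : ~ Cis_nonpos_int (b1 + b3 - a2 - 1))
  (hc3 : ~ Cis_nonpos_int (b1 + b3 - a3 - 1))
  (e1 e2 : R) (he1 : (0 < e1 < 1 / 3)%R) (he2 : (0 < e2 < 1 / 3)%R)
  (x1 x2 lx1 lx2 : C) (hx1 : Cexp lx1 = x1) (hx2 : Cexp lx2 = x2)
  (hx : close_to_origin a2 a3 b1 b2 b3 b4 e1 e2 x1 x2) :
  F11 a1 a2 a3 b1 b2 b3 b4 x1 x2 lx1 lx2 =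
  C11 a2 a3 b1 b2 b3 b4 *
  int_chain4 (Delta11 a1 a2 a3 b1 b2 b3 b4 e1 e2 x1 x2 lx1 lx2).
Proof.
  subst x1 x2.
  destruct (int_chain4_series a1 a2 a3 b1 b2 b3 b4 e1 e2 lx1 lx2 he1 he2 hx) as (S & -> & HS).
  cut (Fser (a1 - b1 - b3 + 2) (a2 - b1 - b3 + 2) (a3 - b1 - b3 + 2)
       (2 - b1) (b2 - b1 + 1) (2 - b3) (b4 - b3 + 1) (Cexp lx1) (Cexp lx2) =
    C11 a2 a3 b1 b2 b3 b4 * S); [intros E; unfold F11; rewrite E; ring|].
  apply (Cser2_cmul (C11 a2 a3 b1 b2 b3 b4)) in HS.
  (* It remains to compare the terms of index [(n1, n2)]; convergence is inherited from the
     integral. *)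
  apply Cser2_CSeries; eapply Cser2_ext; [|exact HS]; clear HS.
  intros n1 n2; cbv beta.
  assert (P1 : ~ Cis_int (b1 - 2)) by (apply (int_shift_eq b1 _ (-2)); [exact hb1 | ring]).
  assert (P2 : ~ Cis_int (b3 - 2)) by (apply (int_shift_eq b3 _ (-2)); [exact hb3 | ring]).
  assert (P3 : ~ Cis_int (- a3)) by (apply int_opp, ha3).
  assert (Q1 : ~ Cis_int (b1 - b2 - 1))
    by (apply (int_shift_eq (b1 - b2) _ (-1)); [exact hb12 | ring]).
  assert (Q2 : ~ Cis_int (b3 - b4 - 1))
    by (apply (int_shift_eq (b3 - b4) _ (-1)); [exact hb34 | ring]).
  assert (Q3 : ~ Cis_int (b2 + b4 - a2 - 2))
    by (apply (int_shift_eq (b2 + b4 - a2) _ (-2)); [exact hb24 | ring]).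
  (* The lowered integrals become Pochhammer quotients times the integrals at [n1 = n2 = 0], which
     the Dirichlet formula evaluates. *)
  assert (E1 := Dreg_lower e1 he1 _ _ _ n1 n2 P1 P2 P3).
  assert (E2 := Dreg_lower e2 he2 _ _ _ n1 n2 Q1 Q2 Q3).
  assert (G1 := Dreg_dirichlet e1 he1 _ _ _ P1 P2 P3).
  assert (G2 := Dreg_dirichlet e2 he2 _ _ _ Q1 Q2 Q3).
  replace (b1 - 2 + (b3 - 2) + - a3 + 3) with (b1 + b3 - a3 - 1) in G1 by ring.
  replace (b1 - b2 - 1 + (b3 - b4 - 1) + (b2 + b4 - a2 - 2) + 3)
    with (b1 + b3 - a2 - 1) in G2 by ring.
  specialize (G1 hc3); specialize (G2 hc2).
  replace (b1 - 2 + 1) with (b1 - 1) in G1 by ring.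
  replace (b3 - 2 + 1) with (b3 - 1) in G1 by ring.
  replace (- a3 + 1) with (1 - a3) in G1 by ring.
  replace (b1 - b2 - 1 + 1) with (b1 - b2) in G2 by ring.
  replace (b3 - b4 - 1 + 1) with (b3 - b4) in G2 by ring.
  replace (b2 + b4 - a2 - 2 + 1) with (b2 + b4 - a2 - 1) in G2 by ring.
  replace (- (b1 - 2 + (b3 - 2) + - a3 + 2)) with (a3 - b1 - b3 + 2) in E1 by ring.
  replace (- (b1 - b2 - 1 + (b3 - b4 - 1) + (b2 + b4 - a2 - 2) + 2))
    with (a2 - b1 - b3 + 2) in E2 by ring.
  assert (N1 := poch_neq_0 _ n1 (int_nonpos _ (int_opp _ P1))).
  assert (N2 := poch_neq_0 _ n2 (int_nonpos _ (int_opp _ P2))).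
  assert (N3 := poch_neq_0 _ n1 (int_nonpos _ (int_opp _ Q1))).
  assert (N4 := poch_neq_0 _ n2 (int_nonpos _ (int_opp _ Q2))).
  replace (2 - b1) with (- (b1 - 2)) by ring.
  replace (2 - b3) with (- (b3 - 2)) by ring.
  replace (b2 - b1 + 1) with (- (b1 - b2 - 1)) by ring.
  replace (b4 - b3 + 1) with (- (b3 - b4 - 1)) by ring.
  (* The symbol of length [n1 + n2] splits as the two-stage binomial expansion does: [n1] factors
     from the power of [y1], then [n2] factors starting at [a1 - b1 - b3 + 2 + n1]. *)
  rewrite !poch_1, (poch_add (a1 - b1 - b3 + 2)).
  assert (F1 := fact_RtoC_neq_0 n1); assert (F2 := fact_RtoC_neq_0 n2).
  assert (T1 : CGamma (b1 - 1) <> 0).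
  { apply CGamma_neq_0, int_nonpos, (int_shift_eq b1 _ (-1)); [exact hb1 | ring]. }
  assert (T2 : CGamma (b3 - 1) <> 0).
  { apply CGamma_neq_0, int_nonpos, (int_shift_eq b3 _ (-1)); [exact hb3 | ring]. }
  assert (T3 : CGamma (1 - a3) <> 0).
  { apply CGamma_neq_0, int_nonpos, (int_shift_eq (- a3) _ 1); [exact P3 | ring]. }
  assert (T4 : CGamma (b1 - b2) <> 0) by (apply CGamma_neq_0, int_nonpos, hb12).
  assert (T5 : CGamma (b3 - b4) <> 0) by (apply CGamma_neq_0, int_nonpos, hb34).
  assert (T6 : CGamma (b2 + b4 - a2 - 1) <> 0).
  { apply CGamma_neq_0, int_nonpos, (int_shift_eq (b2 + b4 - a2) _ (-1)); [exact hb24 | ring]. }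
  set (D1 := Dreg (b1 - 2 - _) _ _ _) in *.
  set (D2 := Dreg (b1 - b2 - 1 - _) _ _ _) in *.
  set (d1 := Dreg (b1 - 2) _ _ _) in *.
  set (d2 := Dreg (b1 - b2 - 1) _ _ _) in *.
  set (u1 := poch (- (b1 - 2)) n1) in *; set (u2 := poch (- (b3 - 2)) n2) in *.
  set (u3 := poch (- (b1 - b2 - 1)) n1) in *; set (u4 := poch (- (b3 - b4 - 1)) n2) in *.
  set (p3 := poch (a3 - b1 - b3 + 2) (n1 + n2)) in *.
  set (p2 := poch (a2 - b1 - b3 + 2) (n1 + n2)) in *.
  assert (X1 : D1 = p3 * d1 / (u1 * u2)) by (rewrite <- E1; field; auto).
  assert (X2 : D2 = p2 * d2 / (u3 * u4)) by (rewrite <- E2; field; auto).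
  unfold C11, binom.
  set (g3 := CGamma (b1 + b3 - a3 - 1)) in *; set (g2 := CGamma (b1 + b3 - a2 - 1)) in *.
  rewrite X1, X2; symmetry.
  (* The constant [C11] is distributed over the two triangles; by the Dirichlet formula each of the
     last two factors equals 1. *)
  transitivity (poch (a1 - b1 - b3 + 2) n1 * poch (a1 - b1 - b3 + 2 + RtoC (INR n1)) n2 /
    (RtoC (INR (fact n1)) * RtoC (INR (fact n2))) * p2 * p3 / (u1 * u2 * u3 * u4) *
    (Cpow (Cexp lx1) n1 * Cpow (Cexp lx2) n2) *
    ((d1 * g3) / (CGamma (b1 - 1) * CGamma (b3 - 1) * CGamma (1 - a3))) *
    ((d2 * g2) / (CGamma (b1 - b2) * CGamma (b3 - b4) * CGamma (b2 + b4 - a2 - 1)))).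
  - rewrite G1, G2; field; repeat split; assumption.
  - field; repeat split; assumption.
Qed.
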